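(* Let $A$ be a non-empty finite subset of $\mathbb{Z}^2$ such that for all $x\notin A$ and all $y\notin A$ there exists $n\ge 1$ with $p_A^n(x,y)>0$. Then, uniformly for $x\in U(R)$, as $R\to\infty$, $$P_x[\tau_{U(R)}<\sigma_A]=\frac{\kappa\,u_A(x)}{\log R}\,(1+o(1));$$ and if $E[|X|^2\log|X|]<\infty$, then the error term $o(1)$ can be replaced by $O(1/\log R)$.
   Context: Let $X,X_1,X_2,\ldots$ be i.i.d. $\mathbb{Z}^2$-valued random variables and $S_n=S_0+X_1+\cdots+X_n$ the associated random walk; $P_x$ denotes the conditional law given $S_0=x$. Standing assumptions: the walk is irreducible (for every $x\in\mathbb{Z}^2$, $P_0[S_n=x]>0$ for some $n>0$), $E X=0$ and $E|X|^2<\infty$, where $|\cdot|$ is the Euclidean norm. For $B\subset\mathbb{Z}^2$ let $\sigma_B=\inf\{n\ge1:S_n\in B\}$ and $\tau_B=\inf\{n\ge1:S_n\notin B\}$. Put $U(R)=\{x\in\mathbb{Z}^2:|x|<R\}$ for $R>0$. The transition probability of the walk killed on entering $A$ is $p_A^n(x,y)=P_x[S_n=y,\ \sigma_A>n]$ for $n\ge0$; in particular $p_A^0(x,y)=\delta(x,y)$ (Kronecker delta). The starting point may lie in $A$. Put $g_A(x,y)=\sum_{n=0}^\infty p_A^n(x,y)$ and $u_A(x)=\lim_{|y|\to\infty}g_A(x,y)$ for $x\in\mathbb{Z}^2$ (the limit is known to exist). $Q$ is the $2\times2$ covariance matrix of $X$ and $\kappa=\pi\sqrt{\det Q}$. $\log$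 is the natural logarithm, and $|X|^2\log|X|$ is read as $0$ when $X=0$. *)

(* Defs.v *)
From HB Require Import structures.
From mathcomp Require Import all_boot all_order all_algebra.
From mathcomp Require Import finmap.
From mathcomp Require Import all_classical all_reals all_analysis.

Set Implicit Arguments.
Unset Strict Implicit.
Unset Printing Implicit Defensive.

Import Order.TTheory GRing.Theory Num.Theory.
Import numFieldNormedType.Exports.

Local Open Scope classical_set_scope.
Local Open Scope ring_scope.

(* int carries the discrete sigma-algebra; the library's product sigma-algebra
   on int * int is then the discrete one as well, by countability. *)
HB.instance Definition _ := isPointed.Build int 0.
HB.instance Definition _ := @isMeasurable.Build default_measure_display
  int (@discrete_measurable int) (@discrete_measurable0 int)
  (@discrete_measurableC int) (@discrete_measurableU int).

Notation Z2 := (int * int)%type.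

Definition coordZ2 (i : 'I_2) (z : Z2) : int := if i == ord0 then z.1 else z.2.

Definition enorm (R : realType) (z : Z2) : R :=
  Num.sqrt (\sum_(i < 2) (coordZ2 i z)%:~R ^+ 2).

Definition disc (R : realType) (r : R) : set Z2 := [set z | enorm R z < r].

Definition at_infinity (R : realType) : set_system Z2 :=
  filter_from [set: R] (fun r => [set y | r < enorm R y]).

(* Infima over the empty set are +oo. *)
Definition sigma (R : realType) (B : set Z2) (s : nat -> Z2) : \bar R :=
  ereal_inf [set n%:R%:E | n in [set n | (1 <= n)%N /\ B (s n)]].

Definition tau (R : realType) (B : set Z2) (s : nat -> Z2) : \bar R :=
  ereal_inf [set n%:R%:E | n in [set n | (1 <= n)%N /\ ~ B (s n)]].

Section RandomWalk.
Context d (T : measurableType d) (R : realType) (P : probability T R).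

(* The step written X_(i+1) in the usual indexing is X i here, and X 0 also
   serves as the generic step. *)
Implicit Type X : nat -> {RV P >-> Z2}.

Definition iid X : Prop :=
  (forall (J : {fset nat}) (B : nat -> set Z2),
     P (\bigcap_(i in [set` J]) (X i @^-1` B i)) =
     (\prod_(i <- J) P (X i @^-1` B i))%E) /\
  (forall (i : nat) (B : set Z2), P (X i @^-1` B) = P (X 0%N @^-1` B)).

Definition walk X (x : Z2) (w : T) (n : nat) : Z2 := x + \sum_(i < n) X i w.

(* The law P_x of the walk started at x, evaluated on an event E of the space
   of paths. *)
Definition Pr X (x : Z2) (E : set (nat -> Z2)) : \bar R :=
  P [set w | E (walk X x w)].

Definition irreducible X : Prop :=
  forall x : Z2, exists2 n : nat,
    (0 < n)%N & (0 < Pr X (0%R : Z2) [set s | s n = x])%E.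

Definition coordRV X (i : 'I_2) : T -> R := fun w => (coordZ2 i (X 0%N w))%:~R.

Definition centered X : Prop := forall i : 'I_2, ('E_P[coordRV X i] = 0)%E.

Definition finite_variance X : Prop :=
  ('E_P[fun w => (enorm R (X 0%N w) ^+ 2)%R] < +oo)%E.

(* ln 0 = 0 in the library, so that the integrand vanishes where X 0 = 0. *)
Definition finite_log_variance X : Prop :=
  ('E_P[fun w =>
     (enorm R (X 0%N w) ^+ 2 * ln (enorm R (X 0%N w)))%R] < +oo)%E.

Definition covmx X : 'M[R]_2 :=
  \matrix_(i, j) fine (covariance P (coordRV X i) (coordRV X j)).

Definition kappa X : R := pi * Num.sqrt (\det (covmx X)).

Definition killed X (A : set Z2) (n : nat) (x y : Z2) : \bar R :=
  Pr X x [set s | s n = y /\ (n%:R%:E < sigma R A s)%E].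

Definition green X (A : set Z2) (x y : Z2) : \bar R :=
  (\sum_(0 <= n <oo) killed X A n x y)%E.

Definition uA X (A : set Z2) (x : Z2) : \bar R :=
  lim (green X A x @ at_infinity R).

End RandomWalk.

(* Main.v *)
Require Import Defs.
From HB Require Import structures.
From mathcomp Require Import finmap all_boot all_order all_algebra.
From mathcomp Require Import ring lra zify.
From mathcomp Require Import all_classical all_reals all_analysis measurable_realfun.

(* The proof avoids Fourier analysis.  A lazy version of the walk contains, with
   positive probability, a fair choice between staying and making a unit step;
   each such choice smooths by a factor [n^(-1/2)], and since the point mass at
   the origin is a mixed second difference of a bounded function, all finite
   differences of the [n]-step probabilities decay at the expected rate.  Hence
   the potential kernel [a] exists.  Its asymptotics [kappa a(x) = log |x| +
   o(log |x|)], with [O(1)] when [E |X|^2 log |X|] is finite, are found for a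
   finite-range symmetric walk with proportional covariance, where [log (M^2 +
   Q^-1(z))] is an approximate potential whose total charge is a Riemann sum, and
   are transferred by a discrete Taylor (Lindeberg) comparison of the two
   transition probabilities.

   The maximum principle on [A] expresses the Green function of the killed walk
   through [a] and the hitting distribution of [A]; letting [y] tend to infinity
   gives [u_A], which is harmonic for the killed walk and equal to [log |x| /
   kappa] up to the same errors.  Optional stopping of [u_A] at the exit from
   [U(R)] then yields the theorem: the overshoot is controlled by the tail
   [E (|X|^2; |X| > R)], because [4 R^2 - |x|^2] is a Lyapunov function for
   the walk in [U(R)].  Uniformity holds since [u_A] is either [0] or bounded
   below by a positive constant. *)

Set Implicit Arguments.
Unset Strict Implicit.
Unset Printing Implicit Defensive.

Import Order.TTheory GRing.Theory Num.Theory.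
Import numFieldNormedType.Exports.

Local Open Scope classical_set_scope.
Local Open Scope ring_scope.

(** All estimates are made for an abstract expectation functional, so that the step of the walk, its
    lazy version and the reference law share them. Laziness meets the obstacle of periodicity: for
    [P' = (1 - ep) + ep P] one has [P' - 1 = ep (P - 1)], so [ep] times the lazy potential kernel is
    a kernel for the original walk. The reference law gets covariance [ep Q], like the lazy walk;
    being a finite combination of shifts it commutes with the other transition operator, so steps
    can be exchanged one at a time in any order. Exchanging all steps up to time [n] costs about
    [E(|v|^2 min(1/n, |v|/n^(3/2)))], which needs no third moment; summed up to the diffusive time
    [|x|^2] this is [o(log |x|)], or bounded under the logarithmic moment. The parameter [M] is
    present because the total charge is computed only up to [O(1/M)]. For each [M], however, the
    expansion has an error bounded in [x], so the charge cannot depend on [M] and equals its limit.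
    The errors produced by optional stopping are additive, and the lower bound on nonzero values of
    [u_A] is what makes them relative. *)

Section Scalar.
Context (R : realType).
Implicit Types (h x y : R) (n N : nat).

(** * Elementary bounds for logarithms and for sums over time *)

Lemma sqrtS_gt0 n : 0 < Num.sqrt n.+1%:R :> R.
Proof. by rewrite sqrtr_gt0 ltr0n. Qed.

Lemma sqrtSS n : Num.sqrt n.+1%:R ^+ 2 = n.+1%:R :> R.
Proof. by rewrite sqr_sqrtr ?ler0n. Qed.

Lemma ln1D_ge y : 0 <= y -> y / (1 + y) <= ln (1 + y) :> R.
Proof.
move=> y0; have p : 0 < 1 + y by lra.
have := @le_ln1Dx R ((1 + y)^-1 - 1).
have -> : 1 + ((1 + y)^-1 - 1) = (1 + y)^-1 by ring.
rewrite lnV ?posrE // => H.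
have q : -1 < (1 + y)^-1 - 1 by rewrite ltrBrDr addNr invr_gt0.
move: (H q); rewrite lerNl; apply: le_trans.
by rewrite le_eqVlt; apply/orP; left; apply/eqP; field; rewrite gt_eqF.
Qed.

Lemma ln1D_le y : 0 <= y -> ln (1 + y) <= y :> R.
Proof. by move=> y0; apply: le_ln1Dx; apply: lt_le_trans y0; rewrite ltrN10. Qed.

(* The increments of [4 ln (u / (h + u))], [u = sqrt n], dominate the summands. *)
Lemma min_step h u w : 0 <= h -> 0 < u -> 0 < w -> w ^+ 2 = u ^+ 2 + 1 ->
  Num.min (w ^+ 2)^-1 (h / w ^+ 3) <= 4 * (ln (w / (h + w)) - ln (u / (h + u))).
Proof.
move=> h0 u0 w0 wu.
have uw : u < w by rewrite -(ltr_pXn2r (n:=2)) ?nnegrE ?ltW // wu ltrDl.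
have hu : 0 < h + u by lra.
have hw : 0 < h + w by lra.
set y := h * (w - u) / (u * (h + w)).
have y0 : 0 <= y by rewrite divr_ge0 ?mulr_ge0 ?subr_ge0 // ?ltW.
rewrite -ln_div ?posrE ?divr_gt0 //.
have -> : w / (h + w) / (u / (h + u)) = 1 + y.
  by rewrite /y; field; rewrite !gt_eqF.
apply: le_trans (ler_wpM2l (ler0n _ 4) (ln1D_ge y0)).
have -> : y / (1 + y) = h * (w - u) / (w * (h + u)).
  rewrite /y; field; rewrite !gt_eqF //=.
  have -> : u * (h + w) + h * (w - u) = w * (h + u) by ring.
  by rewrite mulr_gt0.
have wuE : w - u = (w + u)^-1.
  apply: (mulIf (lt0r_neq0 (addr_gt0 w0 u0))).
  rewrite mulVf ?gt_eqF ?addr_gt0 //; rewrite -subr_sqr wu; ring.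
have lo : (2 * w)^-1 <= w - u.
  by rewrite wuE lef_pV2 ?posrE ?addr_gt0 ?mulr_gt0 //; lra.
have step : 2 * h / (w ^+ 2 * (h + w)) <= 4 * (h * (w - u) / (w * (h + u))).
  apply: (@le_trans _ _ (4 * (h * (2 * w)^-1 / (w * (h + u))))).
    have -> : 4 * (h * (2 * w)^-1 / (w * (h + u))) = 2 * h / (w ^+ 2 * (h + u)).
      by field; rewrite !gt_eqF.
    rewrite ler_wpM2l ?mulr_ge0 // lef_pV2 ?posrE ?mulr_gt0 ?exprn_gt0 //.
    by rewrite ler_pM2l ?exprn_gt0 // lerD2l ltW.
  rewrite ler_wpM2l // ler_wpM2r //; first by rewrite invr_ge0 mulr_ge0 // ltW.
  by rewrite ler_wpM2l.
apply: le_trans step.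
have [hw'|wh] := lerP h w.
- apply: (@le_trans _ _ (h / w ^+ 3)); first by rewrite ge_min lexx orbT.
  have -> : h / w ^+ 3 = 2 * h / (w ^+ 2 * (2 * w)) by field; rewrite gt_eqF.
  rewrite ler_wpM2l ?mulr_ge0 // lef_pV2 ?posrE ?mulr_gt0 ?exprn_gt0 //.
  rewrite ler_pM2l ?exprn_gt0 //; lra.
- apply: (@le_trans _ _ (w ^+ 2)^-1); first by rewrite ge_min lexx.
  have h1 : 0 < h by lra.
  have -> : (w ^+ 2)^-1 = 2 * h / (w ^+ 2 * (2 * h)) by field; rewrite !gt_eqF.
  rewrite ler_wpM2l ?mulr_ge0 // lef_pV2 ?posrE ?mulr_gt0 ?exprn_gt0 //.
  rewrite ler_pM2l ?exprn_gt0 //; lra.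
Qed.

(** The terms are [1/n] up to a crossover of order [h^2] and [h / n^(3/2)] beyond it, whence a
    logarithm of [h], uniformly in [N]. With [h] the length of a displacement, this is the source of
    the logarithmic growth of the potential kernel. *)
Lemma sum_min_le h N : 0 <= h ->
  \sum_(n < N) Num.min (n.+1%:R)^-1 (h / Num.sqrt n.+1%:R ^+ 3) <= 1 + 4 * ln (1 + h).
Proof.
move=> h0; case: N => [|N].
  by rewrite big_ord0 addr_ge0 // mulr_ge0 // ln_ge0 // lerDl.
pose phi n : R := 4 * ln (Num.sqrt n.+1%:R / (h + Num.sqrt n.+1%:R)).
suff H : \sum_(n < N.+1) Num.min (n.+1%:R)^-1 (h / Num.sqrt n.+1%:R ^+ 3) <=
   1 + (phi N - phi 0%N).
  apply: le_trans H _; rewrite lerD2l.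
  have p0 : phi N <= 0.
    rewrite /phi mulr_ge0_le0 // ln_le0 // ler_pdivrMr ?mul1r ?lerDr //.
    by rewrite ltr_pwDr // sqrtS_gt0.
  apply: (@le_trans _ _ (- phi 0%N)); first by rewrite gerDr.
  rewrite /phi sqrtr1 div1r lnV ?posrE; last by rewrite ltr_wpDl.
  by rewrite mulrN opprK addrC.
elim: N => [|N IH].
  rewrite big_ord_recl big_ord0 addr0 subrr addr0 /= ge_min.
  by rewrite invr1 lexx.
rewrite big_ord_recr /=; have -> : phi N.+1 - phi 0%N = (phi N - phi 0%N) + (phi N.+1 - phi N) by ring.
rewrite addrA; apply: lerD IH _.
rewrite /phi -mulrBr -[X in Num.min X^-1 _]sqrtSS; apply: min_step => //; rewrite ?sqrtS_gt0 //.
by rewrite !sqrtSS -natr1.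
Qed.

(** Taking [h = sqrt N] in [sum_min_le] keeps the crossover outside the range of summation. *)
Lemma harmonic_le N : \sum_(n < N) (n.+1%:R)^-1 <= 1 + 4 * ln (1 + Num.sqrt N%:R) :> R.
Proof.
apply: le_trans (sum_min_le N (sqrtr_ge0 _)).
apply: ler_sum => i _; rewrite le_min lexx /= -[X in X^-1](@sqrtSS i).
have s := sqrtS_gt0 i; have s3 : 0 < Num.sqrt i.+1%:R ^+ 3 :> R by rewrite exprn_gt0.
have -> : (Num.sqrt i.+1%:R ^+ 2)^-1 = Num.sqrt i.+1%:R / (Num.sqrt i.+1%:R ^+ 3) :> R.
  by field; rewrite gt_eqF.
by rewrite ler_pM2r ?invr_gt0 // ler_wsqrtr // ler_nat.
Qed.

(** Discrete form of integrating [t^(-3/2)], arranged so as to telescope. *)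
Lemma inv_sqrt3_le n : (0 < n)%N ->
  (Num.sqrt n.+1%:R ^+ 3)^-1 <= 2 * ((Num.sqrt n%:R)^-1 - (Num.sqrt n.+1%:R)^-1) :> R.
Proof.
case: n => // n _; set u := Num.sqrt n.+1%:R; set w := Num.sqrt n.+2%:R.
have u0 : 0 < u by apply: sqrtS_gt0.
have w0 : 0 < w by apply: sqrtS_gt0.
have uw : u <= w by rewrite ler_wsqrtr // ler_nat.
have wu : w ^+ 2 = u ^+ 2 + 1 by rewrite !sqrtSS -natr1.
clearbody u w.
have wuE : w - u = (w + u)^-1.
  apply: (mulIf (lt0r_neq0 (addr_gt0 w0 u0))).
  rewrite mulVf ?gt_eqF ?addr_gt0 //; rewrite -subr_sqr wu; ring.
have -> : u^-1 - w^-1 = (u * w * (w + u))^-1.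
  have -> : u^-1 - w^-1 = (w - u) / (u * w) by field; rewrite !gt_eqF.
  by rewrite wuE -invfM mulrC.
have -> : 2 * (u * w * (w + u))^-1 = (u * w * ((w + u) / 2))^-1.
  by field; rewrite !gt_eqF ?addr_gt0.
have k0 : 0 < (w + u) / 2 by rewrite divr_gt0 ?addr_gt0.
rewrite lef_pV2 ?posrE ?exprn_gt0 //; last by apply: mulr_gt0 => //; apply: mulr_gt0.
have -> : w ^+ 3 = w * w * w by ring.
apply: ler_pM; [by rewrite mulr_ge0 // ltW | exact: ltW | | lra].
by apply: ler_wpM2r => //; exact: ltW.
Qed.

Lemma sum_inv_sqrt3_le N M : (0 < N)%N ->
  \sum_(N <= n < M) (Num.sqrt n.+1%:R ^+ 3)^-1 <= 2 / Num.sqrt N%:R :> R.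
Proof.
move=> N0; have [MN|NM] := leqP M N; first by rewrite big_geq // divr_ge0.
apply: (@le_trans _ _ (2 * ((Num.sqrt N%:R)^-1 - (Num.sqrt M%:R)^-1))); last first.
  by rewrite ler_wpM2l // gerBl invr_ge0.
elim: M NM => // M IH; rewrite ltnS leq_eqVlt => /predU1P[<-|NM].
  by rewrite big_nat1 inv_sqrt3_le.
rewrite big_nat_recr //=; last exact: ltnW.
have := inv_sqrt3_le (ltn_trans N0 NM); have := IH NM; lra.
Qed.

Lemma eq_ler x y : x = y -> x <= y. Proof. by move=> ->. Qed.

Lemma nat_gt x : exists N, x < N%:R.
Proof.
exists (Num.bound `|x|); apply: le_lt_trans (ler_norm _) _.
by rewrite archi_boundP.
Qed.

Lemma seq_cvgP (u : nat -> R) l : (u @ \oo --> l) <->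
  (forall e, 0 < e -> exists N, forall n, (N <= n)%N -> `|u n - l| <= e).
Proof.
split=> [/cvgrPdist_le H e e0|H].
  by have [N _ HN] := H e e0; exists N => n Nn; rewrite distrC; apply: HN.
apply/cvgrPdist_le => e e0; have [N HN] := H e e0.
by exists N => // n /= Nn; rewrite distrC; apply: HN.
Qed.

Lemma inv_sqrt_small e : 0 < e -> exists N, (0 < N)%N /\
  forall n, (N <= n)%N -> (Num.sqrt n%:R)^-1 <= e :> R.
Proof.
move=> e0; have [N HN] := nat_gt ((e^-1) ^+ 2); exists N.+1; split=> // n Nn.
have n0 : (0 < n)%N by apply: leq_trans Nn.
rewrite -[leRHS]invrK lef_pV2 ?posrE ?invr_gt0 ?sqrtr_gt0 ?ltr0n //.
have <- : Num.sqrt ((e^-1) ^+ 2) = e^-1.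
  by rewrite sqrtr_sqr ger0_norm // invr_ge0 ltW.
rewrite ler_wsqrtr //; apply: le_trans (ltW HN) _.
by rewrite ler_nat ltnW.
Qed.

End Scalar.

(** * Smoothing by the step law *)

(* The law of one step, given by its expectation functional [Ex] and the class
   [Ig] of integrable functions. *)
Record step_law (R : realType) := StepLaw {
  Ex : (Z2 -> R) -> R;
  Ig : (Z2 -> R) -> Prop;
  Ig_cst : forall c, Ig (fun=> c);
  Ex_cst : forall c, Ex (fun=> c) = c;
  IgD : forall f g, Ig f -> Ig g -> Ig (fun v => f v + g v);
  ExD : forall f g, Ig f -> Ig g -> Ex (fun v => f v + g v) = Ex f + Ex g;
  IgZ : forall c f, Ig f -> Ig (fun v => c * f v);
  ExZ : forall c f, Ig f -> Ex (fun v => c * f v) = c * Ex f;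
  Ig_le : forall f g, Ig g -> (forall v, `|f v| <= g v) -> Ig f;
  Ex_le : forall f g, Ig f -> Ig g -> (forall v, f v <= g v) -> Ex f <= Ex g;
  Ex_cvg : forall (u : nat -> Z2 -> R) f g, Ig g ->
    (forall n v, `|u n v| <= g v) -> (forall v, u ^~ v @ \oo --> f v) ->
    (fun n => Ex (u n)) @ \oo --> Ex f
}.

Section Operators.
Context (R : realType).
Implicit Types (L : step_law R) (f g : Z2 -> R) (h x y : Z2) (B c : R).

Definition bnd B f := forall x, `|f x| <= B.
(** The one-step transition operator of the walk. *)
Definition conv L f x : R := Ex L (fun v => f (x + v)).
Definition diff h f x : R := f (x + h) - f x.

Lemma bnd_ge0 B f : bnd B f -> 0 <= B.
Proof. by move=> /(_ 0); apply: le_trans. Qed.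

Lemma Ig_bnd L B f : bnd B f -> Ig L f.
Proof. by move=> Bf; apply: (Ig_le (Ig_cst L B)). Qed.

Lemma Ig_sh L B f x : bnd B f -> Ig L (fun v => f (x + v)).
Proof. by move=> Bf; apply: (@Ig_bnd _ B) => v. Qed.

Lemma IgB L f g : Ig L f -> Ig L g -> Ig L (fun v => f v - g v).
Proof.
move=> If Ig0; have := IgD If (IgZ (-1) Ig0).
by congr (Ig L _); apply/funext => v; rewrite mulN1r.
Qed.

Lemma ExB L f g : Ig L f -> Ig L g -> Ex L (fun v => f v - g v) = Ex L f - Ex L g.
Proof.
move=> If Ig0; have := ExD If (IgZ (-1) Ig0).
rewrite (ExZ _ Ig0) mulN1r => <-.
by congr (Ex L _); apply/funext => v; rewrite mulN1r.
Qed.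

Lemma Ex_ge0 L f : Ig L f -> (forall v, 0 <= f v) -> 0 <= Ex L f.
Proof. by move=> If f0; rewrite -(Ex_cst L 0); apply: Ex_le => //; apply: Ig_cst. Qed.

Lemma Ex_abs L f : Ig L (fun v => `|f v|) -> `|Ex L f| <= Ex L (fun v => `|f v|).
Proof.
move=> If; have If' : Ig L f by apply: (Ig_le If).
rewrite ler_norml; apply/andP; split; last first.
  by apply: Ex_le => // v; apply: ler_norm.
rewrite -mulN1r -(ExZ _ If); apply: Ex_le => //; first exact: IgZ.
by move=> v; rewrite mulN1r lerNl -normrN ler_norm.
Qed.

Lemma conv_bnd L B f : bnd B f -> bnd B (conv L f).
Proof.
move=> Bf x; rewrite /conv; apply: le_trans (Ex_abs _) _.
  by apply: (@Ig_bnd _ B) => v; rewrite normr_id.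
rewrite -[leRHS](Ex_cst L B); apply: Ex_le => //; last exact: Ig_cst.
by apply: (@Ig_bnd _ B) => v; rewrite normr_id.
Qed.

Lemma iter_conv_bnd L B f n : bnd B f -> bnd B (iter n (conv L) f).
Proof. by move=> Bf; elim: n => //= n; apply: conv_bnd. Qed.

Lemma bnd_lin B B' (a b : R) f g : bnd B f -> bnd B' g ->
  bnd (`|a| * B + `|b| * B') (fun x => a * f x + b * g x).
Proof.
move=> Bf Bg x; apply: le_trans (ler_normD _ _) _; rewrite !normrM.
by apply: lerD; apply: ler_wpM2l.
Qed.

Lemma bnd_diff B f h : bnd B f -> bnd (2 * B) (diff h f).
Proof.
move=> Bf x; rewrite /diff; apply: le_trans (ler_normB _ _) _.
by have := Bf x; have := Bf (x + h); lra.
Qed.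

Lemma conv_lin L B B' (a b : R) f g : bnd B f -> bnd B' g ->
  conv L (fun x => a * f x + b * g x) = fun x => a * conv L f x + b * conv L g x.
Proof.
move=> Bf Bg; apply/funext => x; rewrite /conv.
have If := @Ig_sh L _ _ x Bf; have I0 := @Ig_sh L _ _ x Bg.
by rewrite -(ExZ _ If) -(ExZ _ I0) -ExD //; apply: IgZ.
Qed.

Lemma iter_conv_lin L B B' (a b : R) f g n : bnd B f -> bnd B' g ->
  iter n (conv L) (fun x => a * f x + b * g x) =
  fun x => a * iter n (conv L) f x + b * iter n (conv L) g x.
Proof.
move=> Bf Bg; elim: n => //= n ->.
by rewrite (conv_lin L a b (iter_conv_bnd L n Bf) (iter_conv_bnd L n Bg)).
Qed.

Lemma conv_sh L f h : conv L (fun x => f (x + h)) = fun x => conv L f (x + h).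
Proof. by apply/funext => x; congr (Ex L _); apply/funext => v; rewrite addrAC. Qed.

Lemma iter_conv_sh L f h n :
  iter n (conv L) (fun x => f (x + h)) = fun x => iter n (conv L) f (x + h).
Proof. by elim: n => //= n ->; rewrite conv_sh. Qed.

Lemma conv_diff L B f h : bnd B f -> conv L (diff h f) = diff h (conv L f).
Proof.
move=> Bf; have -> : diff h f = (fun x => 1 * f (x + h) + (-1) * f x).
  by apply/funext => x; rewrite mul1r mulN1r.
rewrite (conv_lin L 1 (-1) (fun x => Bf (x + h) : `|f (x + h)| <= B) Bf).
by apply/funext => x; rewrite conv_sh mul1r mulN1r.
Qed.

Lemma iter_conv_diff L B f h n : bnd B f ->
  iter n (conv L) (diff h f) = diff h (iter n (conv L) f).
Proof.
move=> Bf; elim: n => //= n ->.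
by rewrite (conv_diff L h (iter_conv_bnd L n Bf)).
Qed.

Lemma conv_ge0 L B f : bnd B f -> (forall x, 0 <= f x) -> forall x, 0 <= conv L f x.
Proof. by move=> Bf f0 x; apply: Ex_ge0 => //; apply: Ig_sh Bf. Qed.

(* [binsum k phi] is [\sum_j 'C(k, j) * phi j]. *)
Fixpoint binsum k (phi : nat -> R) : R :=
  if k is k'.+1 then binsum k' phi + binsum k' (phi \o succn) else phi 0%N.

Lemma binsum_lin k (a b : R) (p q : nat -> R) :
  binsum k (fun j => a * p j + b * q j) = a * binsum k p + b * binsum k q.
Proof.
elim: k p q => //= k IH p q; rewrite IH.
have -> : (fun j => a * p j + b * q j) \o succn =
  (fun j => a * (p \o succn) j + b * (q \o succn) j) by [].
by rewrite IH; ring.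
Qed.

Lemma binsum_le k (p q : nat -> R) : (forall j, p j <= q j) -> binsum k p <= binsum k q.
Proof.
elim: k p q => //= k IH p q pq; apply: lerD; apply: IH => // j; exact: pq.
Qed.

Lemma binsum_cst k c : binsum k (fun=> c) = 2 ^+ k * c.
Proof.
elim: k => [|k IH] /=; first by rewrite mul1r.
by rewrite /comp IH exprS; ring.
Qed.

Lemma binsum_abs k (p : nat -> R) : `|binsum k p| <= binsum k (fun j => `|p j|).
Proof.
elim: k p => //= k IH p; apply: le_trans (ler_normD _ _) _.
by apply: lerD; apply: IH.
Qed.

(** Summation by parts: [(k + 1) (C(k, j - 1) - C(k, j)) = (2 j - k - 1) C(k + 1, j)], so shifting
    the argument by one produces a centred weight. *)
Lemma binsum_diff k (p : nat -> R) :
  k.+1%:R * (binsum k (p \o succn) - binsum k p) =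
  binsum k.+1 (fun j => (2 * j%:R - k.+1%:R) * p j).
Proof.
elim: k p => [|k IH] p; first by rewrite /= mulr0n mulr1n; ring.
have E q : binsum k.+2 q = binsum k.+1 q + binsum k.+1 (q \o succn) by [].
rewrite [RHS]E.
have -> : (fun j => (2 * j%:R - k.+2%:R) * p j) =
  (fun j => 1 * ((2 * j%:R - k.+1%:R) * p j) + (-1) * p j).
  by apply/funext => j; rewrite -[k.+2%:R]natr1; ring.
have -> : (fun j => 1 * ((2 * j%:R - k.+1%:R) * p j) + (-1) * p j) \o succn =
  (fun j => 1 * ((2 * j%:R - k.+1%:R) * (p \o succn) j) + 1 * (p \o succn) j).
  by apply/funext => j /=; rewrite -[j.+1%:R]natr1; ring.
rewrite !binsum_lin -!IH /= -[k.+2%:R]natr1; ring.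
Qed.

(** The shift [a] makes the induction close: the two halves of the sum have shifts [a - 1] and
    [a + 1]. At [a = 0] this is the variance of a sum of [k] signs. *)
Lemma binsum_var k (a : R) :
  binsum k (fun j => (2 * j%:R - k%:R + a) ^+ 2) = 2 ^+ k * (k%:R + a ^+ 2).
Proof.
elim: k a => [|k IH] a /=; first by rewrite expr0; ring.
have -> : (fun j => (2 * j%:R - k.+1%:R + a) ^+ 2) =
          (fun j => (2 * j%:R - k%:R + (a - 1)) ^+ 2).
  by apply/funext => j; rewrite -[k.+1%:R]natr1; ring.
have -> : (fun j => (2 * j%:R - k%:R + (a - 1)) ^+ 2) \o succn =
          (fun j => (2 * j%:R - k%:R + (a + 1)) ^+ 2).
  by apply/funext => j /=; rewrite -[j.+1%:R]natr1; ring.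
by rewrite !IH [2 ^+ k.+1]exprS -[k.+1%:R]natr1; ring.
Qed.

(** The centred weight of [binsum_diff] has standard deviation [sqrt (k + 1)] against the factor
    [k + 1]; this is the gain of one inverse square root. *)
Lemma binsum_diff_le k (p : nat -> R) B : (forall j, `|p j| <= B) ->
  `|binsum k (p \o succn) - binsum k p| <= 2 ^+ k * (2 / Num.sqrt k.+1%:R) * B.
Proof.
move=> pB; set s := Num.sqrt k.+1%:R; have s0 : 0 < s by apply: sqrtS_gt0.
have ss : s ^+ 2 = k.+1%:R by apply: sqrtSS.
have B0 : 0 <= B by apply: le_trans (pB 0%N).
suff H : k.+1%:R * `|binsum k (p \o succn) - binsum k p| <= 2 ^+ k.+1 * s * B.
  have k0 : 0 < k.+1%:R :> R by rewrite ltr0n.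
  rewrite -(ler_pM2l k0); apply: le_trans H _.
  rewrite -ss le_eqVlt; apply/orP; left; apply/eqP; rewrite exprS.
  by field; rewrite gt_eqF.
have -> : k.+1%:R * `|binsum k (p \o succn) - binsum k p| =
   `|binsum k.+1 (fun j => (2 * j%:R - k.+1%:R) * p j)|.
  by rewrite -binsum_diff normrM normr_nat.
apply: le_trans (binsum_abs _ _) _.
(* AM-GM: [2 |y| <= y^2 / s + s] *)
apply: (@le_trans _ _ (binsum k.+1 (fun j => (B / (2 * s)) *
   (2 * j%:R - k.+1%:R + 0) ^+ 2 + (B * s / 2) * 1))).
  apply: binsum_le => j; rewrite normrM addr0; set y := 2 * j%:R - _.
  apply: (@le_trans _ _ (`|y| * B)); first by rewrite ler_wpM2l.
  have -> : B / (2 * s) * y ^+ 2 + B * s / 2 * 1 = B * ((`|y| ^+ 2 + s ^+ 2) / (2 * s)).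
    by rewrite real_normK ?num_real //; field; rewrite gt_eqF.
  rewrite mulrC ler_wpM2l // ler_pdivlMr ?mulr_gt0 //.
  have := sqr_ge0 (`|y| - s); nra.
rewrite binsum_lin binsum_var binsum_cst -ss.
by rewrite le_eqVlt; apply/orP; left; apply/eqP; field; rewrite gt_eqF.
Qed.

Definition avg h f x : R := (f x + f (x + h)) / 2.

Lemma avg_bnd B f h : bnd B f -> bnd B (avg h f).
Proof.
move=> Bf x; have := Bf x; have := Bf (x + h).
by rewrite /avg !ler_norml => /andP[? ?] /andP[? ?]; apply/andP; split; lra.
Qed.

Lemma iter_avgE h f k x :
  iter k (avg h) f x = (2 ^+ k)^-1 * binsum k (fun j => f (x + h *+ j)).
Proof.
elim: k x => [|k IH] x /=; first by rewrite mulr0n addr0 invr1 mul1r.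
rewrite /avg !IH exprS.
have -> : (fun j => f (x + h *+ j)) \o succn = (fun j => f (x + h + h *+ j)).
  by apply/funext => j /=; rewrite mulrS addrA.
by field; rewrite expf_neq0.
Qed.

Lemma diff_iter_avg h f B k : bnd B f ->
  bnd (2 / Num.sqrt k.+1%:R * B) (diff h (iter k (avg h) f)).
Proof.
move=> Bf x; rewrite /diff !iter_avgE -mulrBr normrM.
have p : 0 < 2 ^+ k :> R by rewrite exprn_gt0.
rewrite (ger0_norm (_ : 0 <= (2 ^+ k)^-1)); last by rewrite invr_ge0 ltW.
rewrite mulrC ler_pdivrMr // mulrC mulrA.
have -> : (fun j => f (x + h + h *+ j)) = (fun j => f (x + h *+ j)) \o succn.
  by apply/funext => j /=; rewrite mulrS addrA.
by apply: binsum_diff_le => j; apply: Bf.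
Qed.

(* [binmix p b n k] is the mean of [b (k + N)], [N] binomial with parameters [n], [p]. *)
Fixpoint binmix (p : R) (b : nat -> R) n k : R :=
  if n is n'.+1 then p * binmix p b n' k.+1 + (1 - p) * binmix p b n' k else b k.

(** Size biasing of the binomial law, [E_{n+1}[N g(N)] = p (n + 1) E_n[g(N + 1)]], for
    [g(j) = 1 / (k + j + 1)]; the two terms then add up to the mean of [(N + k + 1) g(N) = 1]. *)
Lemma binmix_inv_eq p n k : p * n.+1%:R * binmix p (fun j => (j.+1%:R)^-1) n k.+1 +
  k.+1%:R * binmix p (fun j => (j.+1%:R)^-1) n.+1 k = 1.
Proof.
elim: n k => [|n IH] k /=.
  by field; rewrite ?addr_eq0; move: (ler0n R k) => ?; rewrite !gt_eqF //; lra.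
have := IH k; have := IH k.+1 => /=.
set b2 := binmix p _ n k.+2; set b1 := binmix p _ n k.+1; set b0 := binmix p _ n k.
rewrite -[k.+2%:R]natr1 -[n.+2%:R]natr1 => H1 H2.
have := congr2 (fun u v => p * u + (1 - p) * v) H1 H2.
rewrite !mulr1 => H; have -> : 1 = p + (1 - p) by ring.
rewrite -[RHS]H; ring.
Qed.

Lemma binmix_inv_le p n : 0 <= p <= 1 ->
  p * n.+1%:R * binmix p (fun j => (j.+1%:R)^-1) n 0 <= 1.
Proof.
move=> /andP[p0 p1]; elim: n => [|n IH] /=; first by rewrite invr1 !mulr1.
have := binmix_inv_eq p n 0; rewrite /=.
set b1 := binmix p _ n 1; set b0 := binmix p _ n 0; rewrite mul1r => H.
have -> : p * n.+2%:R * (p * b1 + (1 - p) * b0) =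
  p * (p * n.+1%:R * b1 + (p * b1 + (1 - p) * b0)) + (1 - p) * (p * n.+1%:R * b0).
  by rewrite -[n.+2%:R]natr1; ring.
rewrite H -[leRHS](subrK p 1) [leRHS]addrC mulr1 lerD2l.
by rewrite -[leRHS]mulr1 ler_wpM2l // subr_ge0.
Qed.

Lemma binmix_sqrt_le p n : 0 < p <= 1 ->
  binmix p (fun j => 2 / Num.sqrt j.+1%:R) n 0 <= (p^-1 + 1) / Num.sqrt n.+1%:R.
Proof.
move=> /andP[p0 p1]; set s := Num.sqrt n.+1%:R.
have s0 : 0 < s by apply: sqrtS_gt0.
(* The inequality [2 / t <= s / t^2 + 1 / s] linearizes the inverse square root; being pointwise, it
   passes through the mixture. *)
have H m k : binmix p (fun j => 2 / Num.sqrt j.+1%:R) m k <=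
   s * binmix p (fun j => (j.+1%:R)^-1) m k + s^-1.
  elim: m k => [|m IH] k /=.
    have t0 := sqrtS_gt0 R k; have := sqrtSS R k.
    set t := Num.sqrt k.+1%:R in t0 * => <-; rewrite -subr_ge0.
    have -> : s * (t ^+ 2)^-1 + s^-1 - 2 / t = s * (t^-1 - s^-1) ^+ 2.
      by field; rewrite !gt_eqF.
    by rewrite mulr_ge0 ?sqr_ge0 // ltW.
  apply: (@le_trans _ _ (p * (s * binmix p (fun j => (j.+1%:R)^-1) m k.+1 + s^-1)
     + (1 - p) * (s * binmix p (fun j => (j.+1%:R)^-1) m k + s^-1))).
    by apply: lerD; apply: ler_wpM2l => //; rewrite ?subr_ge0 // ltW.
  by rewrite le_eqVlt; apply/orP; left; apply/eqP; ring.
apply: le_trans (H _ _) _.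
have := @binmix_inv_le p n; rewrite p1 (ltW p0) => /(_ isT).
set b := binmix _ _ _ _; rewrite -[n.+1%:R]sqrtSS -/s => Hb.
rewrite mulrDl mul1r lerD2r ler_pdivlMr // -[leRHS]mulr1 ler_pdivlMl //.
by apply: le_trans Hb; rewrite le_eqVlt; apply/orP; left; apply/eqP; ring.
Qed.

(** The law dominates [c] times the sum of the point masses at [0] and [h]; this is tested on
    nonnegative functions because only the functional is available. *)
Definition minorized L c h := 0 < c /\
  forall f B, bnd B f -> (forall x, 0 <= f x) -> c * (f 0 + f h) <= Ex L f.

Lemma minorized_le L c h : minorized L c h -> 2 * c <= 1.
Proof.
move=> [_ /(_ (fun=> 1) 1)]; rewrite Ex_cst mulrC; apply => // x.
by rewrite normr1.
Qed.

(* [conv L = 2 c avg h + rest], the first part smoothing in direction [h]. *)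
Lemma minorized_smooth L c h f B n : minorized L c h -> bnd B f ->
  bnd (((2 * c)^-1 + 1) * B / Num.sqrt n.+1%:R) (diff h (iter n (conv L) f)).
Proof.
move=> mc Bf; have c1 := minorized_le mc; have [c0 mcE] := mc.
pose rest f x := conv L f x - c * (f x + f (x + h)).
(* The remainder is a positive functional of mass [1 - 2 c]. Since minorization speaks of
   nonnegative functions, it is applied to [B' + g] and [B' - g]. *)
have Brest g B' : bnd B' g -> bnd ((1 - 2 * c) * B') (rest g).
  move=> Bg x; have B'0 := bnd_ge0 Bg.
  have I1 := @Ig_sh L _ _ x Bg.
  have P1 := mcE (fun v => B' + g (x + v)) (2 * B').
  have P2 := mcE (fun v => B' - g (x + v)) (2 * B').
  rewrite (ExD (Ig_cst L B') I1) Ex_cst addr0 in P1.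
  rewrite (ExB (Ig_cst L B') I1) Ex_cst addr0 in P2.
  have {}P1 : c * (B' + g x + (B' + g (x + h))) <= B' + Ex L (fun v => g (x + v)).
    apply: P1 => [v|v].
      by apply: le_trans (ler_normD _ _) _; have := Bg (x + v); rewrite (ger0_norm B'0); lra.
    by have := Bg (x + v); rewrite ler_norml => /andP[]; lra.
  have {}P2 : c * (B' - g x + (B' - g (x + h))) <= B' - Ex L (fun v => g (x + v)).
    apply: P2 => [v|v].
      by apply: le_trans (ler_normB _ _) _; have := Bg (x + v); rewrite (ger0_norm B'0); lra.
    by have := Bg (x + v); rewrite ler_norml => /andP[]; lra.
  by rewrite /rest /conv ler_norml; apply/andP; split; nra.
have convE B' g : bnd B' g ->
    conv L g = fun x => (2 * c) * avg h g x + 1 * rest g x.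
  by move=> Bg; apply/funext => x; rewrite /rest /avg; field.
have iter_avg_bnd B' g k : bnd B' g -> bnd B' (iter k (avg h) g).
  by move=> Bg; elim: k => //= k; apply: avg_bnd.
have rest_avg B' g : bnd B' g -> rest (avg h g) = avg h (rest g).
  move=> Bg; apply/funext => x; rewrite /rest /avg.
  have -> : conv L (fun x => (g x + g (x + h)) / 2) x =
            (conv L g x + conv L g (x + h)) / 2.
    have -> : (fun x => (g x + g (x + h)) / 2) = (fun x => 2^-1 * g x + 2^-1 * g (x + h)).
      by apply/funext => y; field.
    rewrite (conv_lin L 2^-1 2^-1 Bg (fun x => Bg (x + h) : `|g (x + h)| <= B')).
    by rewrite conv_sh; field.
  by field.
have rest_iter B' g k : bnd B' g -> rest (iter k (avg h) g) = iter k (avg h) (rest g).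
  by move=> Bg; elim: k => //= k <-; rewrite (rest_avg _ _ (iter_avg_bnd _ _ k Bg)).
have diff_lin (a b : R) p q : diff h (fun x => a * p x + b * q x) =
   fun x => a * diff h p x + b * diff h q x.
  by apply/funext => x; rewrite /diff; ring.
(* The power is expanded into commuting parts: [k] counts the averages collected so far, and the
   number added by [m] further steps is binomial with parameter [2 c]. *)
have main m k g B' : bnd B' g ->
   bnd (binmix (2 * c) (fun j => 2 / Num.sqrt j.+1%:R) m k * B')
     (diff h (iter m (conv L) (iter k (avg h) g))).
  elim: m k g B' => [|m IH] k g B' Bg; first exact: diff_iter_avg.
  have Bk := iter_avg_bnd _ _ k Bg.
  rewrite iterSr (convE _ _ Bk) (iter_conv_lin L (2 * c) 1 m (avg_bnd h Bk) (Brest _ _ Bk)).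
  rewrite diff_lin (rest_iter _ _ k Bg) => x; apply: le_trans (ler_normD _ _) _.
  have c2 : 0 <= 2 * c by rewrite mulr_ge0 // ltW.
  rewrite mul1r [X in X + _]normrM (ger0_norm c2) /=.
  have H1 := IH k.+1 g B' Bg x; have H2 := IH k (rest g) _ (Brest _ _ Bg) x.
  rewrite [leRHS]mulrDl; apply: lerD; first by rewrite -mulrA ler_wpM2l.
  by apply: le_trans H2 _; rewrite [leRHS]mulrAC [leRHS]mulrC.
move=> x; apply: le_trans (main n 0%N f B Bf x) _.
rewrite mulrAC ler_wpM2r ?(bnd_ge0 Bf) //; apply: binmix_sqrt_le.
by rewrite mulr_gt0.
Qed.

End Operators.

(** * Discrete Taylor expansions on the square lattice *)

Definition e1 : Z2 := (1, 0).
Definition e2 : Z2 := (0, 1).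
Definition nrm1 (z : Z2) : nat := (`|z.1| + `|z.2|)%N.

Section Taylor.
Context (R : realType).
Implicit Types (f F : Z2 -> R) (x v h : Z2) (c b : R).

Lemma Z2E v : v = e1 *~ v.1 + e2 *~ v.2.
Proof.
case: v => a b.
have pE n (u : Z2) : u *+ n = (u.1 *+ n, u.2 *+ n).
  by elim: n => [|n IH]; rewrite ?mulr0n // !mulrS IH; case: u {IH}.
have zE m (u : Z2) : u *~ m = (u.1 *~ m, u.2 *~ m).
  by case: m => n /=; rewrite ?NegzE ?mulrNz -!pmulrn pE.
rewrite !zE /= !intz !mul0rz.
by congr pair; rewrite ?addr0 ?add0r.
Qed.

Lemma nrm1D x y : (nrm1 (x + y)%R <= nrm1 x + nrm1 y)%N.
Proof. by case: x => a b; case: y => c d; rewrite /nrm1 /=; lia. Qed.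

Lemma nrm1N x : nrm1 (- x) = nrm1 x.
Proof. by case: x => a b; rewrite /nrm1 /=; lia. Qed.

Lemma nrm1_0 : nrm1 0 = 0%N.
Proof. by []. Qed.

Lemma nrm1_eq0 x : (nrm1 x == 0%N) = (x == 0).
Proof.
case: x => a b; apply/idP/eqP => [|[-> ->]] //.
by rewrite /nrm1 addn_eq0 !absz_eq0 /= => /andP[/eqP-> /eqP->].
Qed.

(** Discrete integration from [0] in both directions, the factor [1 / (j + 1)] being given up.
    Iterated, it yields the one-dimensional Taylor remainders of each order. *)
Lemma int_increments (E : int -> R) c j : E 0 = 0 ->
  (forall m : int, `|E (m + 1) - E m| <= c * (`|m|%N)%:R ^+ j) ->
  forall m : int, `|E m| <= c * (`|m|%N)%:R ^+ j.+1.
Proof.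
move=> E0 H.
have c0 : 0 <= c by have := le_trans (normr_ge0 _) (H 1); rewrite expr1n mulr1.
have step n : c * n%:R ^+ j.+1 + c * n.+1%:R ^+ j <= c * n.+1%:R ^+ j.+1.
  rewrite -mulrDr ler_wpM2l // [X in _ <= X]exprS -{2}natr1 mulrDl mul1r lerD2r exprS.
  by rewrite ler_wpM2l ?ler0n // lerXn2r ?nnegrE ?ler0n // ler_nat.
have pos n : `|E n%:Z| <= c * n%:R ^+ j.+1.
  elim: n => [|n IH]; first by rewrite E0 normr0 mulr_ge0 // exprn_ge0.
  apply: le_trans (step n).
  have -> : E n.+1%:Z = E n%:Z + (E (n%:Z + 1) - E n%:Z).
    by rewrite addrC subrK -addn1 PoszD.
  apply: le_trans (ler_normD _ _) _; apply: lerD => //.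
  apply: le_trans (H n%:Z) _; rewrite absz_nat ler_wpM2l //.
  by rewrite lerXn2r ?nnegrE ?ler0n // ler_nat.
have neg n : `|E (- n%:Z)| <= c * n%:R ^+ j.+1.
  elim: n => [|n IH]; first by rewrite oppr0 E0 normr0 mulr_ge0 // exprn_ge0.
  apply: le_trans (step n).
  have -> : E (- n.+1%:Z) = E (- n%:Z) - (E (- n.+1%:Z + 1) - E (- n.+1%:Z)).
    have -> : - n.+1%:Z + 1 = - n%:Z by lia.
    by ring.
  apply: le_trans (ler_normB _ _) _; apply: lerD => //.
case => n; first exact: pos.
by rewrite NegzE abszN absz_nat; apply: neg.
Qed.

Lemma mulrzS_dir (e : Z2) (m : int) x : x + e *~ (m + 1) = x + e *~ m + e.
Proof. by rewrite mulrzDr mulr1z addrA. Qed.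

Lemma taylor1 e f c x (m : int) : bnd c (diff e f) ->
  `|f (x + e *~ m) - f x| <= c * (`|m|%N)%:R.
Proof.
move=> H; rewrite -[(`|m|%N)%:R]expr1.
apply: (@int_increments (fun m => f (x + e *~ m) - f x)) => [|k].
  by rewrite mulr0z addr0 subrr.
rewrite expr0 mulr1 mulrzS_dir.
have -> : f (x + e *~ k + e) - f x - (f (x + e *~ k) - f x) = diff e f (x + e *~ k).
  by rewrite /diff; ring.
exact: H.
Qed.

Lemma taylor2 e f c x (m : int) : bnd c (diff e (diff e f)) ->
  `|f (x + e *~ m) - f x - m%:~R * diff e f x| <= c * (`|m|%N)%:R ^+ 2.
Proof.
move=> H.
apply: (@int_increments (fun m => f (x + e *~ m) - f x - m%:~R * diff e f x)) => [|k].
  by rewrite mulr0z addr0 subrr mul0r subr0.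
rewrite expr1 mulrzS_dir intrD.
set t := (X in `|X|); have -> : t = diff e f (x + e *~ k) - diff e f x.
  by rewrite /t /diff; ring.
exact: taylor1.
Qed.

Lemma taylor3 e f c x (m : int) : bnd c (diff e (diff e (diff e f))) ->
  `|f (x + e *~ m) - f x - m%:~R * diff e f x -
    m%:~R * (m%:~R - 1) / 2 * diff e (diff e f) x| <= c * (`|m|%N)%:R ^+ 3.
Proof.
move=> H.
apply: (@int_increments (fun m => f (x + e *~ m) - f x - m%:~R * diff e f x -
    m%:~R * (m%:~R - 1) / 2 * diff e (diff e f) x)) => [|k].
  by rewrite mulr0z addr0 subrr !mul0r !subr0.
rewrite mulrzS_dir intrD.
set t := (X in `|X|); have -> : t = diff e f (x + e *~ k) - diff e f x - k%:~R * diff e (diff e f) x.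
  by rewrite /t /diff; field.
exact: taylor2.
Qed.

Lemma diffC h h' f : diff h (diff h' f) = diff h' (diff h f).
Proof. by apply/funext => x; rewrite /diff [x + h + h']addrAC; ring. Qed.

Definition udir h := h = e1 \/ h = e2.

Lemma taylor2d_1 f b v x : (forall h, udir h -> bnd b (diff h f)) ->
  `|f (x + v) - f x| <= b * (nrm1 v)%:R.
Proof.
move=> H; rewrite [in x + v](Z2E v) addrA.
rewrite -(subrK (f (x + e1 *~ v.1)) (f (x + _ + _))) -addrA natrD mulrDr addrC.
apply: le_trans (ler_normD _ _) _; apply: lerD; apply: taylor1; apply: H.
  by left. by right.
Qed.

Definition lin2 f x v : R := v.1%:~R * diff e1 f x + v.2%:~R * diff e2 f x.
(** Second-order part of Newton's forward-difference formula: the diagonal coefficients are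
    [m (m - 1) / 2], so first moments also enter its expectation. *)
Definition quad2 f x v : R :=
  v.1%:~R * (v.1%:~R - 1) / 2 * diff e1 (diff e1 f) x +
  v.1%:~R * v.2%:~R * diff e1 (diff e2 f) x +
  v.2%:~R * (v.2%:~R - 1) / 2 * diff e2 (diff e2 f) x.

Lemma absz_real (m : int) : `|m%:~R : R| = (`|m|%N)%:R.
Proof. by rewrite -intr_norm -abszE pmulrn. Qed.

Lemma quad2_le f b v x : (forall h h', udir h -> udir h' -> bnd b (diff h (diff h' f))) ->
  `|quad2 f x v| <= b * (nrm1 v)%:R ^+ 2.
Proof.
move=> H.
have u1 : udir e1 by left. have u2 : udir e2 by right.
have b0 : 0 <= b by apply: bnd_ge0 (H _ _ u1 u1).
(* Both [m (m - 1)] and [m (m + 1)] are nonnegative because [m] is an integer; for real numbers this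
   fails. *)
have half (m : int) : `|m%:~R * (m%:~R - 1) / 2 : R| <= (`|m|%N)%:R ^+ 2.
  rewrite -absz_real real_normK ?num_real // ler_norml; apply/andP; split.
    have : 0 <= (m * (m - 1))%:~R :> R by rewrite ler0z; nia.
    by rewrite intrM intrD; have := sqr_ge0 (m%:~R : R); rewrite mulrN1z; nra.
  have : 0 <= (m * (m + 1))%:~R :> R by rewrite ler0z; nia.
  by rewrite intrM intrD; nra.
have N1 := half v.1; have N2 := half v.2; rewrite /nrm1 natrD.
have D11 := H _ _ u1 u1 x; have D12 := H _ _ u1 u2 x; have D22 := H _ _ u2 u2 x.
apply: (@le_trans _ _ (((`|v.1|%N)%:R ^+ 2) * b + (`|v.1|%N)%:R * (`|v.2|%N)%:R * b +
   ((`|v.2|%N)%:R ^+ 2) * b)).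
  apply: le_trans (ler_normD _ _) _; apply: lerD; last by rewrite normrM ler_pM.
  apply: le_trans (ler_normD _ _) _; apply: lerD; first by rewrite normrM ler_pM.
  by rewrite normrM [X in X * _]normrM !absz_real ler_wpM2l ?mulr_ge0.
set a := (`|v.1|%N)%:R; set c := (`|v.2|%N)%:R.
have a0 : 0 <= a by []. have c0 : 0 <= c by [].
rewrite -subr_ge0; have -> : b * (a + c) ^+ 2 - (a ^+ 2 * b + a * c * b + c ^+ 2 * b) = a * c * b.
  by ring.
by rewrite !mulr_ge0.
Qed.

Lemma taylor2d_2 f b v x : (forall h h', udir h -> udir h' -> bnd b (diff h (diff h' f))) ->
  `|f (x + v) - f x - lin2 f x v| <= b * (nrm1 v)%:R ^+ 2.
Proof.
move=> H.
have u1 : udir e1 by left. have u2 : udir e2 by right.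
have b0 : 0 <= b by apply: bnd_ge0 (H _ _ u1 u1).
set a1 := e1 *~ v.1; set a2 := e2 *~ v.2.
(* The path runs along [e1] and then along [e2]; the increment of [g] along [e2] carries the mixed
   difference. *)
pose g y := f (y + a1) - f y.
have T1 : `|f (x + a1) - f x - v.1%:~R * diff e1 f x| <= _ := taylor2 x v.1 (H _ _ u1 u1).
have T2 : `|f (x + a2) - f x - v.2%:~R * diff e2 f x| <= _ := taylor2 x v.2 (H _ _ u2 u2).
have T3 : `|g (x + a2) - g x| <= b * (`|v.1|%N)%:R * (`|v.2|%N)%:R.
  apply: taylor1 => y.
  have -> : diff e2 g y = diff e2 f (y + a1) - diff e2 f y.
    by rewrite /g /diff [y + e2 + a1]addrAC; ring.
  by apply: taylor1; apply: H.
rewrite [in x + v](Z2E v) -/a1 -/a2 addrA /lin2 /nrm1 natrD.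
set A := (`|v.1|%N)%:R in T1 T3 *; set C := (`|v.2|%N)%:R in T2 T3 *.
have A0 : 0 <= A by []. have C0 : 0 <= C by [].
have gE : g (x + a2) - g x = f (x + a1 + a2) - f (x + a2) - f (x + a1) + f x.
  by rewrite /g [x + a2 + a1]addrAC; ring.
have -> : f (x + a1 + a2) - f x - (v.1%:~R * diff e1 f x + v.2%:~R * diff e2 f x) =
  (g (x + a2) - g x) + (f (x + a1) - f x - v.1%:~R * diff e1 f x) +
  (f (x + a2) - f x - v.2%:~R * diff e2 f x) by rewrite gE; ring.
apply: le_trans (ler_normD _ _) _; apply: le_trans (lerD (ler_normD _ _) (lexx _)) _.
apply: le_trans (lerD (lerD T3 T1) T2) _.
rewrite -subr_ge0; have -> : b * (A + C) ^+ 2 - (b * A * C + b * A ^+ 2 + b * C ^+ 2) = b * A * C by ring.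
by rewrite !mulr_ge0.
Qed.

Lemma taylor2d_3 f b v x :
  (forall h h' h'', udir h -> udir h' -> udir h'' -> bnd b (diff h (diff h' (diff h'' f)))) ->
  `|f (x + v) - f x - lin2 f x v - quad2 f x v| <= b * (nrm1 v)%:R ^+ 3.
Proof.
move=> H.
have u1 : udir e1 by left. have u2 : udir e2 by right.
have b0 : 0 <= b by apply: bnd_ge0 (H _ _ _ u1 u1 u1).
set a1 := e1 *~ v.1; set a2 := e2 *~ v.2.
set A := (`|v.1|%N)%:R : R; set C := (`|v.2|%N)%:R : R.
have A0 : 0 <= A by []. have C0 : 0 <= C by [].
(* With the linear term removed, the increment of [g] along [e2] is of third order; the mixed
   second-order term comes out of [T4]. *)
pose g y := f (y + a1) - f y - v.1%:~R * diff e1 f y.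
have T1 : `|f (x + a1) - f x - v.1%:~R * diff e1 f x - v.1%:~R * (v.1%:~R - 1) / 2 *
    diff e1 (diff e1 f) x| <= b * A ^+ 3 := taylor3 x v.1 (H _ _ _ u1 u1 u1).
have T2 : `|f (x + a2) - f x - v.2%:~R * diff e2 f x - v.2%:~R * (v.2%:~R - 1) / 2 *
    diff e2 (diff e2 f) x| <= b * C ^+ 3 := taylor3 x v.2 (H _ _ _ u2 u2 u2).
have T3 : `|g (x + a2) - g x| <= b * A ^+ 2 * C.
  apply: taylor1 => y.
  have -> : diff e2 g y = diff e2 f (y + a1) - diff e2 f y - v.1%:~R * diff e1 (diff e2 f) y.
    by rewrite /g /diff ![y + e2 + _]addrAC; ring.
  by apply: taylor2; apply: H.
have T4 : `|diff e1 f (x + a2) - diff e1 f x - v.2%:~R * diff e2 (diff e1 f) x| <= b * C ^+ 2.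
  by apply: taylor2; apply: H.
rewrite [in x + v](Z2E v) -/a1 -/a2 addrA /lin2 /quad2 /nrm1 natrD -/A -/C (diffC e1 e2).
have gE : g (x + a2) - g x = f (x + a1 + a2) - f (x + a2) - f (x + a1) + f x
   - v.1%:~R * (diff e1 f (x + a2) - diff e1 f x).
  by rewrite /g [x + a2 + a1]addrAC; ring.
set t := (X in `|X|).
have -> : t = (g (x + a2) - g x) +
  v.1%:~R * (diff e1 f (x + a2) - diff e1 f x - v.2%:~R * diff e2 (diff e1 f) x) +
  (f (x + a1) - f x - v.1%:~R * diff e1 f x - v.1%:~R * (v.1%:~R - 1) / 2 *
    diff e1 (diff e1 f) x) +
  (f (x + a2) - f x - v.2%:~R * diff e2 f x - v.2%:~R * (v.2%:~R - 1) / 2 *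
    diff e2 (diff e2 f) x) by rewrite gE /t; ring.
have T4' : `|v.1%:~R * (diff e1 f (x + a2) - diff e1 f x - v.2%:~R * diff e2 (diff e1 f) x)|
   <= A * (b * C ^+ 2).
  by rewrite normrM absz_real ler_wpM2l.
apply: le_trans (ler_normD _ _) _; apply: le_trans (lerD (ler_normD _ _) (lexx _)) _.
apply: le_trans (lerD (lerD (ler_normD _ _) (lexx _)) (lexx _)) _.
apply: le_trans (lerD (lerD (lerD T3 T4') T1) T2) _.
rewrite -subr_ge0.
have -> : b * (A + C) ^+ 3 - (b * A ^+ 2 * C + A * (b * C ^+ 2) + b * A ^+ 3 + b * C ^+ 3)
   = 2 * (b * (A * A * C)) + 2 * (b * (A * C * C)) by ring.
by rewrite addr_ge0 // !mulr_ge0.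
Qed.

End Taylor.

(** * Decay of finite differences of transition probabilities *)

Section Smooth.
Context (R : realType).
Implicit Types (L : step_law R) (f F : Z2 -> R) (x v h : Z2) (B C c b : R).

Definition smooth_dir L C h := forall n f B, bnd B f ->
  bnd (C * B / Num.sqrt n.+1%:R) (diff h (iter n (conv L) f)).

Definition smooth L C := 0 <= C /\ forall h, udir h -> smooth_dir L C h.

(** A difference along [h + h'] telescopes. This turns smoothness along the support into smoothness
    along every reachable vector. *)
Lemma smooth_dirD L C C' h h' : smooth_dir L C h -> smooth_dir L C' h' ->
  smooth_dir L (C + C') (h + h').
Proof.
move=> S S' n f B Bf x; set F := iter n _ f.
have -> : diff (h + h') F x = diff h' F (x + h) + diff h F x.
  by rewrite /diff addrA; ring.
apply: le_trans (ler_normD _ _) _.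
have := S n f B Bf x; have := S' n f B Bf (x + h); rewrite -/F !mulrDl => H1 H2.
by rewrite addrC lerD.
Qed.

Lemma smooth_dir0 L : smooth_dir L 0 0.
Proof. by move=> n f B Bf x; rewrite /diff addr0 subrr normr0 !mul0r. Qed.

Definition ddiff (ds : seq Z2) f := foldr (@diff R) f ds.
Definition udirs (ds : seq Z2) := forall h, h \in ds -> udir h.

Lemma udirs_cons h ds : udirs (h :: ds) -> udir h /\ udirs ds.
Proof.
by move=> H; split=> [|k kd]; apply: H; rewrite inE ?eqxx ?kd ?orbT.
Qed.

Lemma ddiff_bnd ds f B : bnd B f -> bnd (2 ^+ size ds * B) (ddiff ds f).
Proof.
move=> Bf; elim: ds => [|h ds IH] /=; first by rewrite mul1r.
by rewrite exprS -mulrA; apply: bnd_diff.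
Qed.

Lemma iter_conv_ddiff L B f ds n : bnd B f ->
  iter n (conv L) (ddiff ds f) = ddiff ds (iter n (conv L) f).
Proof.
move=> Bf; elim: ds => //= h ds IH.
by rewrite (iter_conv_diff L h n (ddiff_bnd ds Bf)) IH.
Qed.

(** Each difference is charged to its own block of [m] steps, which is possible because differences
    commute with [conv]. *)
Lemma smooth_ddiff L C ds m f B : smooth L C -> udirs ds -> bnd B f ->
  bnd ((C / Num.sqrt m.+1%:R) ^+ size ds * B)
    (ddiff ds (iter (size ds * m) (conv L) f)).
Proof.
move=> [C0 S]; elim: ds => [|h ds IH] /= ud Bf; first by rewrite mul1r.
have [uh uds] := udirs_cons ud.
rewrite mulSn iterD -(iter_conv_ddiff L ds m (iter_conv_bnd L _ Bf)).
have := S _ uh m _ _ (IH uds Bf); rewrite exprS => H x; apply: le_trans (H x) _.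
by rewrite le_eqVlt; apply/orP; left; apply/eqP; ring.
Qed.

Lemma smooth_bound L C ds n f B : smooth L C -> udirs ds -> bnd B f ->
  bnd ((C * Num.sqrt (size ds)%:R / Num.sqrt n.+1%:R) ^+ size ds * B)
    (ddiff ds (iter n (conv L) f)).
Proof.
move=> SL ud Bf; set k := size ds; have [C0 _] := SL.
have [k0|k0] := posnP k.
  rewrite k0 mul1r; move: k0 => /size0nil -> /=; exact: iter_conv_bnd.
(* Each of the [k] differences receives [m] steps; the remaining [n %% k] steps are contractions. *)
set m := (n %/ k)%N.
rewrite {2}(divn_eq n k) -/m addnC iterD mulnC.
have H := smooth_ddiff m SL ud Bf.
rewrite -(iter_conv_ddiff L ds _ (iter_conv_bnd L _ Bf)) => x.
apply: le_trans (iter_conv_bnd L (n %% k) H x) _.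
rewrite ler_wpM2r ?(bnd_ge0 Bf) //.
rewrite lerXn2r ?nnegrE ?divr_ge0 ?mulr_ge0 ?sqrtr_ge0 //.
have s1 := sqrtS_gt0 R m; have s2 := sqrtS_gt0 R n.
rewrite -mulrA ler_wpM2l // ler_pdivlMr // mulrC ler_pdivrMr //.
rewrite -sqrtrM ?ler0n // ler_wsqrtr // -natrM ler_nat.
by rewrite /m mulnC; exact: ltn_ceil.
Qed.

(* Whichever of the two factors has more steps provides the smoothness. *)
Lemma smooth_bound2 L L' C ds i j f B : smooth L C -> smooth L' C ->
  udirs ds -> bnd B f ->
  bnd ((C * Num.sqrt (2 * size ds)%:R / Num.sqrt (i + j).+1%:R) ^+ size ds * B)
    (ddiff ds (iter i (conv L) (iter j (conv L') f))).
Proof.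
move=> S S' ud Bf; set k := size ds; have [C0 _] := S; have B0 := bnd_ge0 Bf.
have key n : (i + j < 2 * n.+1)%N ->
  (C * Num.sqrt k%:R / Num.sqrt n.+1%:R) ^+ k * B <=
  (C * Num.sqrt (2 * k)%:R / Num.sqrt (i + j).+1%:R) ^+ k * B.
  move=> ijn; rewrite ler_wpM2r // lerXn2r ?nnegrE ?divr_ge0 ?mulr_ge0 ?sqrtr_ge0 //.
  have s1 := sqrtS_gt0 R n; have s2 := sqrtS_gt0 R (i + j).
  rewrite -!mulrA ler_wpM2l // ler_pdivlMr // mulrAC ler_pdivrMr //.
  by rewrite -!sqrtrM ?ler0n // ler_wsqrtr // -!natrM ler_nat [(2 * k)%N]mulnC -mulnA leq_mul2l ijn orbT.
have [ji|ij] := leqP j i.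
  move=> x; apply: le_trans (smooth_bound i S ud (iter_conv_bnd L' j Bf) x) _.
  by apply: key; lia.
rewrite -(iter_conv_ddiff L ds i (iter_conv_bnd L' j Bf)) => x.
apply: le_trans (iter_conv_bnd L i (smooth_bound j S' ud Bf) x) _.
by apply: key; lia.
Qed.

Definition dirac x : R := (x == 0)%:R.
Definition quadrant x : R := ((0 < x.1) && (0 < x.2))%:R.

Lemma quadrant_bnd : bnd 1 quadrant.
Proof. by move=> x; rewrite /quadrant normr_nat; case: (_ && _). Qed.

Lemma dirac_bnd : bnd 1 dirac.
Proof. by move=> x; rewrite /dirac normr_nat; case: (_ == _). Qed.

Lemma dirac_ge0 x : 0 <= dirac x. Proof. exact: ler0n. Qed.

(* The point mass is a mixed second difference of a bounded function: this is
   what turns smoothing estimates into decay of the transition probabilities. *)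
Lemma diracE : dirac = ddiff [:: e1; e2] quadrant.
Proof.
apply/funext => -[a b]; rewrite /dirac /ddiff /= /diff /quadrant /=.
have -> : ((a, b) == (0 : Z2)) = (a == 0) && (b == 0) by [].
have -> : (0 < a + 1) = (a == 0) || (0 < a) by lia.
have -> : (0 < a + 1 + 0) = (a == 0) || (0 < a) by lia.
have -> : (0 < b + 0 + 1) = (b == 0) || (0 < b) by lia.
have -> : (0 < b + 1) = (b == 0) || (0 < b) by lia.
rewrite !addr0.
have [->|a0] := eqVneq a 0; have [->|b0] := eqVneq b 0;
  rewrite ?ltxx //=; case: (0 < a); case: (0 < b); rewrite /= ?subrr ?subr0 //.
Qed.

(* [retn L n x] is the probability that the walk with steps [L] started at [x]
   is at the origin at time [n]. *)
Definition retn L n := iter n (conv L) dirac.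

Definition decay_cst C (k : nat) := (C * Num.sqrt (2 * k)%:R) ^+ k.

Lemma decay_cst_ge0 C k : 0 <= C -> 0 <= decay_cst C k.
Proof. by move=> C0; rewrite exprn_ge0 // mulr_ge0. Qed.

(** The point mass contributes two further differences, so a difference of order [k] of an n-step
    probability is [O(n^(-1 - k/2))]. *)
Lemma mixed_decay L L' C ds i j : smooth L C -> smooth L' C -> udirs ds ->
  bnd (decay_cst C (size ds).+2 / Num.sqrt (i + j).+1%:R ^+ (size ds).+2)
    (ddiff ds (iter i (conv L) (retn L' j))).
Proof.
move=> S S' ud; rewrite /retn diracE (iter_conv_ddiff L' _ j quadrant_bnd).
rewrite (iter_conv_ddiff L _ i (iter_conv_bnd L' j quadrant_bnd)).
have -> g : ddiff ds (ddiff [:: e1; e2] g) = ddiff (ds ++ [:: e1; e2]) g.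
  by rewrite /ddiff foldr_cat.
have ud' : udirs (ds ++ [:: e1; e2]).
  move=> h; rewrite mem_cat => /orP[/ud //|]; rewrite !inE.
  by case/orP => /eqP->; [left|right].
have := smooth_bound2 i j S S' ud' quadrant_bnd.
by rewrite size_cat addn2 mulr1 expr_div_n.
Qed.

Lemma retn_decay L C ds n : smooth L C -> udirs ds ->
  bnd (decay_cst C (size ds).+2 / Num.sqrt n.+1%:R ^+ (size ds).+2)
    (ddiff ds (retn L n)).
Proof. by move=> S ud; have := mixed_decay n 0 S S ud; rewrite addn0. Qed.

Lemma retn_bnd1 L n : bnd 1 (retn L n).
Proof. exact: iter_conv_bnd dirac_bnd. Qed.

Lemma retn_ge0 L n x : 0 <= retn L n x.
Proof.
elim: n x => [|n IH] x; first exact: dirac_ge0.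
by apply: conv_ge0 IH x; exact: retn_bnd1.
Qed.

End Smooth.

(** * Existence of the potential kernel *)

Section PotentialKernel.
Context (R : realType) (L : step_law R) (C : R) (SL : smooth L C).
Implicit Types (f F : Z2 -> R) (x v h : Z2) (n N : nat).

Let q := retn L.

(* [1 / (n + 1)] decay for distant points, gradient decay for close ones. *)
Definition kcst := 2 * decay_cst C 2 + decay_cst C 3.

Lemma kcst_ge0 : 0 <= kcst.
Proof. by have [C0 _] := SL; rewrite addr_ge0 ?mulr_ge0 ?decay_cst_ge0. Qed.

Lemma udirs_nil : udirs [::]. Proof. by []. Qed.

Lemma retn_le n x : q n x <= kcst / n.+1%:R.
Proof.
have [C0 _] := SL.
apply: le_trans (ler_norm _) _; apply: le_trans (retn_decay n SL udirs_nil x) _.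
rewrite /= sqrtSS ler_wpM2r // /kcst.
have := @decay_cst_ge0 _ C 2 C0; have := @decay_cst_ge0 _ C 3 C0; lra.
Qed.

Lemma retn_incr n x v : `|q n (x + v) - q n x| <=
  kcst * Num.min (n.+1%:R)^-1 ((nrm1 v)%:R / Num.sqrt n.+1%:R ^+ 3).
Proof.
have [C0 _] := SL; have k2 := @decay_cst_ge0 _ C 2 C0; have k3 := @decay_cst_ge0 _ C 3 C0.
rewrite minr_pMr ?kcst_ge0 // le_min; apply/andP; split.
  have := retn_decay n SL udirs_nil x; have := retn_decay n SL udirs_nil (x + v).
  rewrite /= sqrtSS -/(q n) => H1 H2; apply: le_trans (ler_normB _ _) _.
  apply: le_trans (lerD H1 H2) _; rewrite -mulrDl ler_wpM2r // /kcst; lra.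
have T := @taylor2d_1 _ (q n) (decay_cst C 3 / Num.sqrt n.+1%:R ^+ 3) v x.
apply: le_trans (T _) _.
  move=> h uh; have ud : udirs [:: h] by move=> k; rewrite inE => /eqP->.
  exact: (retn_decay n SL ud).
rewrite mulrAC -mulrA ler_wpM2r ?divr_ge0 ?exprn_ge0 //; rewrite /kcst; lra.
Qed.

(** The series defining the potential kernel, cut at time [N]. The two return probabilities are
    subtracted termwise because neither sum need converge alone. *)
Definition apart N x : R := \sum_(n < N) (q n 0 - q n x).

Definition pk x : R := lim (apart ^~ x @ \oo).

Lemma sum_retn_incr N x v : \sum_(n < N) `|q n (x + v) - q n x| <=
  kcst * (1 + 4 * ln (1 + (nrm1 v)%:R)).
Proof.
apply: (@le_trans _ _ (kcst * \sum_(n < N) Num.min (n.+1%:R)^-1 ((nrm1 v)%:R / Num.sqrt n.+1%:R ^+ 3))).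
  by rewrite mulr_sumr; apply: ler_sum => n _; exact: retn_incr.
by rewrite ler_wpM2l ?kcst_ge0 // sum_min_le.
Qed.

Lemma apart_incr N x v : `|apart N (x + v) - apart N x| <=
  kcst * (1 + 4 * ln (1 + (nrm1 v)%:R)).
Proof.
apply: le_trans (sum_retn_incr N x v); rewrite /apart -sumrB.
apply: le_trans (ler_norm_sum _ _ _) _; apply: ler_sum => n _.
by rewrite -normrN; apply: eq_ler; congr `|_|; ring.
Qed.

Lemma sum_retn_tail N M x v : (0 < N)%N ->
  \sum_(N <= n < M) `|q n (x + v) - q n x| <= 2 * kcst * (nrm1 v)%:R / Num.sqrt N%:R.
Proof.
move=> N0.
apply: (@le_trans _ _ (kcst * (nrm1 v)%:R * \sum_(N <= n < M) (Num.sqrt n.+1%:R ^+ 3)^-1)).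
  rewrite mulr_sumr; apply: ler_sum => n _; apply: le_trans (retn_incr _ _ _) _.
  by rewrite -mulrA ler_wpM2l ?kcst_ge0 // ge_min lexx orbT.
apply: le_trans (ler_wpM2l _ (sum_inv_sqrt3_le R M N0)) _; first by rewrite mulr_ge0 ?kcst_ge0.
by apply: eq_ler; ring.
Qed.

Lemma apart_cvg x : apart ^~ x @ \oo --> pk x.
Proof.
have E : apart ^~ x = series (fun n => q n 0 - q n x).
  by rewrite seriesEord.
rewrite /pk E.
apply: normed_cvg; apply: nondecreasing_is_cvgn.
  by apply: nondecreasing_series => n _ _ /=.
exists (kcst * (1 + 4 * ln (1 + (nrm1 x)%:R))) => _ [N _ <-].
rewrite /normed_series_of seriesEord /=; apply: le_trans (sum_retn_incr N 0 x).
by apply: ler_sum => n _; rewrite add0r distrC.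
Qed.

Lemma pk_incr x v : `|pk (x + v) - pk x| <= kcst * (1 + 4 * ln (1 + (nrm1 v)%:R)).
Proof.
have H : (fun N => `|apart N (x + v) - apart N x|) @ \oo --> `|pk (x + v) - pk x|.
  by apply: cvg_norm; apply: cvgB; exact: apart_cvg.
by apply: (cvgr_to_le H); apply: nearW => N; exact: apart_incr.
Qed.

End PotentialKernel.

(** * Potential kernel *)

Section Vanish.
Context (R : realType).
Implicit Types (L : step_law R) (f g : Z2 -> R) (x v : Z2).

Definition vanish f := forall e, 0 < e ->
  exists M, forall x, (M <= nrm1 x)%N -> `|f x| <= e.

Lemma vanishD f g : vanish f -> vanish g -> vanish (fun x => f x + g x).
Proof.
move=> Vf Vg e e0; have e2 : 0 < e / 2 by rewrite divr_gt0.
have [M HM] := Vf _ e2; have [N HN] := Vg _ e2.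
exists (maxn M N) => x; rewrite geq_max => /andP[/HM H1 /HN H2].
by apply: le_trans (ler_normD _ _) _; lra.
Qed.

Lemma vanish_le f g : vanish g -> (forall x, `|f x| <= `|g x|) -> vanish f.
Proof.
by move=> Vg fg e /Vg[M HM]; exists M => x /HM; apply: le_trans.
Qed.

Lemma vanishZ (c : R) f : vanish f -> vanish (fun x => c * f x).
Proof.
move=> Vf e e0; have c0 : 0 < `|c| + 1 by rewrite ltr_wpDl.
have [M HM] := Vf (e / (`|c| + 1)) (divr_gt0 e0 c0); exists M => x /HM.
rewrite normrM ler_pdivlMr // mulrC => H; apply: le_trans H.
by rewrite ler_wpM2r // lerDl.
Qed.

Lemma vanish_sh f v : vanish f -> vanish (fun x => f (x + v)).
Proof.
move=> Vf e /Vf[M HM]; exists (M + nrm1 v)%N => x Mx; apply: HM.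
have := nrm1D (x + v) (- v); rewrite addrK nrm1N; lia.
Qed.

Lemma vanish_sum n (F : nat -> Z2 -> R) : (forall i, vanish (F i)) ->
  vanish (fun x => \sum_(i < n) F i x).
Proof.
move=> VF; elim: n => [|n IH].
  by move=> e e0; exists 0%N => x _; rewrite big_ord0 normr0 ltW.
by apply: vanish_le (vanishD IH (VF n)) _ => x; rewrite big_ord_recr.
Qed.

Lemma vanish_oppn f : vanish f -> vanish (fun x => f (- x)).
Proof. by move=> Vf e /Vf[M HM]; exists M => x Mx; apply: HM; rewrite nrm1N. Qed.

Lemma Ex_tail L e : 0 < e -> exists n, Ex L (fun v => (n <= nrm1 v)%N%:R) <= e.
Proof.
move=> e0.
have : (fun n => Ex L (fun v => (n <= nrm1 v)%N%:R)) @ \oo --> Ex L (fun=> 0).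
  apply: (@Ex_cvg _ L _ _ (fun=> 1) (Ig_cst L 1)) => [n v|v].
    by rewrite normr_nat; case: (_ <= _)%N.
  apply/seq_cvgP => d d0; exists (nrm1 v).+1 => n vn.
  by rewrite leqNgt vn subr0 normr0 ltW.
rewrite Ex_cst => /seq_cvgP /(_ e e0)[n /(_ n (leqnn n))].
by rewrite subr0 => H; exists n; apply: le_trans H; exact: ler_norm.
Qed.

(** A step longer than [n] has small probability, and a shorter one keeps [x + v] far away. *)
Lemma conv_vanish L B f : bnd B f -> vanish f -> vanish (conv L f).
Proof.
move=> Bf Vf e e0; have B0 := bnd_ge0 Bf.
have d0 : 0 < e / 2 / (B + 1) by rewrite !divr_gt0 // ltr_wpDl.
have [n Hn] := Ex_tail L d0.
have [M HM] := Vf (e / 2) (divr_gt0 e0 (ltr0n _ 2)).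
exists (M + n)%N => x Mx; rewrite /conv.
have tb : bnd 1 (fun v : Z2 => (n <= nrm1 v)%N%:R : R).
  by move=> v; rewrite normr_nat; case: (_ <= _)%N.
have Ia : Ig L (fun v => `|f (x + v)|).
  by apply: (@Ig_bnd _ L B) => v; rewrite normr_id.
apply: le_trans (Ex_abs Ia) _.
have I2 : Ig L (fun v => e / 2 + B * (n <= nrm1 v)%N%:R).
  by apply: IgD; [exact: Ig_cst|apply: IgZ; exact: Ig_bnd tb].
apply: le_trans (Ex_le Ia I2 _) _ => [v|].
  have [nv|vn] := leqP n (nrm1 v).
    by rewrite mulr1; apply: le_trans (Bf _) _; rewrite lerDr ltW // divr_gt0.
  rewrite mulr0 addr0; apply: HM.
  have := nrm1D (x + v) (- v); rewrite addrK nrm1N; lia.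
rewrite ExD ?Ex_cst; [|exact: Ig_cst|by apply: IgZ; exact: Ig_bnd tb].
rewrite ExZ; last exact: Ig_bnd tb.
have H1 : B * Ex L (fun v => (n <= nrm1 v)%N%:R) <= B * (e / 2 / (B + 1)) by rewrite ler_wpM2l.
have H2 : B * (e / 2 / (B + 1)) <= e / 2.
  rewrite mulrCA ger_pMr ?divr_gt0 // ler_pdivrMr ?ltr_wpDl //; lra.
lra.
Qed.

Lemma dirac_vanish : vanish (@dirac R).
Proof.
move=> e e0; exists 1%N => x; rewrite lt0n nrm1_eq0 /dirac => /negbTE ->.
by rewrite normr0 ltW.
Qed.

Lemma retn_vanish L n : vanish (retn L n).
Proof.
elim: n => [|n IH]; first exact: dirac_vanish.
by apply: conv_vanish IH; exact: retn_bnd1.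
Qed.

(** The [1] inside makes this logarithm nonnegative and subadditive. *)
Definition lg x : R := ln (1 + (nrm1 x)%:R).

Lemma lg_ge0 x : 0 <= lg x.
Proof. by rewrite ln_ge0 // lerDl. Qed.

Lemma lgD x y : lg (x + y) <= lg x + lg y.
Proof.
rewrite /lg -lnM ?posrE ?ltr_pwDl // ler_ln ?posrE ?mulr_gt0 ?ltr_pwDl //.
have := nrm1D x y; rewrite -(ler_nat R) natrD.
have : 0 <= (nrm1 x)%:R * (nrm1 y)%:R :> R by rewrite mulr_ge0.
lra.
Qed.

Lemma lgN x : lg (- x) = lg x.
Proof. by rewrite /lg nrm1N. Qed.

End Vanish.

Section PotentialKernel2.
Context (R : realType) (L : step_law R) (C : R) (SL : smooth L C).
Implicit Types (x v : Z2) (n N : nat).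

Let q := retn L.
Let K := kcst C.

Lemma sum_retn_split N M x v : (0 < N <= M)%N ->
  `|apart L M (x + v) - apart L M x| <=
  \sum_(n < N) `|q n (x + v) - q n x| + 2 * K * (nrm1 v)%:R / Num.sqrt N%:R.
Proof.
move=> /andP[N0 NM]; apply: le_trans (lerD (lexx _) (sum_retn_tail SL M x v N0)).
rewrite -!(big_mkord xpredT (fun n => `|q n (x + v) - q n x|)) -big_cat_nat //=.
rewrite /apart -sumrB big_mkord; apply: le_trans (ler_norm_sum _ _ _) _.
by apply: ler_sum => n _; rewrite -normrN; apply: eq_ler; congr `|_|; rewrite /q; ring.
Qed.

Lemma pk_incr_split N x v : (0 < N)%N ->
  `|pk L (x + v) - pk L x| <=
  \sum_(n < N) `|q n (x + v) - q n x| + 2 * K * (nrm1 v)%:R / Num.sqrt N%:R.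
Proof.
move=> N0.
have H : (fun N => `|apart L N (x + v) - apart L N x|) @ \oo --> `|pk L (x + v) - pk L x|.
  by apply: cvg_norm; apply: cvgB; exact: apart_cvg SL _.
apply: (cvgr_to_le H); exists N => // M /= NM.
by apply: (@sum_retn_split N M x v); rewrite N0.
Qed.

(** The times beyond [N] contribute [O(|v| / sqrt N)] uniformly in [x]; finitely many times remain,
    and each of them vanishes at infinity. *)
Lemma pk_incr_vanish v : vanish (fun x => pk L (x + v) - pk L x).
Proof.
move=> e e0; have K0 : 0 <= K by exact: kcst_ge0 SL.
have d0 : 0 < e / 2 / (2 * K * (nrm1 v)%:R + 1).
  by rewrite !divr_gt0 // ltr_wpDl // !mulr_ge0.
have [N [N0 HN]] := inv_sqrt_small d0.
have V : vanish (fun x => \sum_(n < N) `|q n (x + v) - q n x|).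
  apply: (@vanish_sum _ N (fun n x => `|q n (x + v) - q n x|)) => n; apply: vanish_le (vanishD (vanish_sh v (retn_vanish L n))
    (vanishZ (-1) (retn_vanish L n))) _ => x.
  by rewrite normr_id mulN1r.
have [M HM] := V (e / 2) (divr_gt0 e0 (ltr0n _ 2)).
exists M => x /HM; rewrite ger0_norm ?sumr_ge0 // => H.
apply: le_trans (pk_incr_split x v N0) _.
have {}HN := HN N (leqnn N).
have H1 : 2 * K * (nrm1 v)%:R / Num.sqrt N%:R <= e / 2.
  apply: le_trans (ler_wpM2l _ HN) _; first by rewrite !mulr_ge0.
  rewrite mulrCA ger_pMr ?divr_gt0 // ler_pdivrMr ?mul1r ?lerDl //.
  by rewrite ltr_wpDl // !mulr_ge0.
lra.
Qed.

Lemma apart0 N : apart L N 0 = 0.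
Proof. by rewrite /apart big1 // => n _; rewrite subrr. Qed.

Lemma pk0 : pk L 0 = 0.
Proof.
have := @apart_cvg _ _ _ SL 0; have -> : apart L ^~ 0 = fun=> 0.
  by apply/funext => N; exact: apart0.
by move=> /cvg_lim <- //; rewrite lim_cst.
Qed.

Lemma apart_le N x : `|apart L N x| <= K * (1 + 4 * lg R x).
Proof.
have := apart_incr SL N 0 x; rewrite add0r apart0 subr0; exact.
Qed.

Lemma pk_le x : `|pk L x| <= K * (1 + 4 * lg R x).
Proof. by have := pk_incr SL 0 x; rewrite add0r pk0 subr0. Qed.

(** At the diffusive time [N = |x|^2] the error is a constant; this is the choice made when two
    kernels are compared. *)
Lemma pk_approx N x : (0 < N)%N ->
  `|pk L x - apart L N x| <= 2 * K * (nrm1 x)%:R / Num.sqrt N%:R.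
Proof.
move=> N0.
have H : (fun M => `|apart L M x - apart L N x|) @ \oo --> `|pk L x - apart L N x|.
  by apply: cvg_norm; apply: cvgB; [exact: apart_cvg SL _|exact: cvg_cst].
apply: (cvgr_to_le H); exists N => // M /= NM.
apply: le_trans (sum_retn_tail SL M 0 x N0).
rewrite /apart -!(big_mkord xpredT (fun n => retn L n 0 - retn L n x)) (big_cat_nat _ NM) //=.
rewrite addrAC subrr add0r; apply: le_trans (ler_norm_sum _ _ _) _.
by apply: ler_sum => n _; rewrite add0r distrC.
Qed.

Lemma apart_bnd N : bnd (2 * N%:R) (apart L N).
Proof.
move=> x; apply: le_trans (ler_norm_sum _ _ _) _.
have -> : 2 * N%:R = \sum_(n < N) (2 : R) by rewrite sumr_const card_ord mulr_natr.
apply: ler_sum => n _; apply: le_trans (ler_normB _ _) _.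
by have := @retn_bnd1 _ L n x; have := @retn_bnd1 _ L n 0; lra.
Qed.

(** The transition operator advances the time index by one, so the truncated series telescopes. *)
Lemma conv_apart N x : conv L (apart L N) x = apart L N x + dirac R x - retn L N x.
Proof.
elim: N x => [|N IH] x.
  rewrite /apart big_ord0 add0r subrr /conv.
  under eq_fun do rewrite big_ord0.
  exact: Ex_cst.
have E y : apart L N.+1 y = apart L N y + (retn L N 0 - retn L N y).
  by rewrite /apart big_ord_recr.
have -> : conv L (apart L N.+1) x = conv L (apart L N) x + (retn L N 0 - retn L N.+1 x).
  have I1 := @Ig_sh _ L _ _ x (@apart_bnd N); have I2 := @Ig_sh _ L _ _ x (@retn_bnd1 _ L N).
  have I0 := Ig_cst L (retn L N 0).
  have -> : retn L N 0 - retn L N.+1 x = Ex L (fun v => retn L N 0 - retn L N (x + v)).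
    by rewrite ExB // Ex_cst.
  rewrite /conv -ExD //; last exact: IgB.
  by congr (Ex L _); apply/funext => v; rewrite E.
by rewrite IH E /=; ring.
Qed.

Lemma Ig_pk (IL : Ig L (lg R)) x : Ig L (fun v => pk L (x + v)).
Proof.
apply: (@Ig_le _ L _ (fun v => K * (1 + 4 * lg R x) + K * 4 * lg R v)).
  by apply: IgD; [exact: Ig_cst|apply: IgZ].
move=> v; apply: le_trans (pk_le _) _.
have K0 : 0 <= K by exact: kcst_ge0 SL.
rewrite -mulrA -mulrDr ler_wpM2l //; have := lgD R x v; lra.
Qed.

(** The last term [retn L N x] of [conv_apart] is [O(1/N)], and the logarithmic bound on [apart],
    uniform in [N], dominates the passage to the limit. *)
Lemma conv_pk (IL : Ig L (lg R)) x : conv L (pk L) x = pk L x + dirac R x.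
Proof.
have K0 : 0 <= K by exact: kcst_ge0 SL.
have H1 : (fun N => conv L (apart L N) x) @ \oo --> conv L (pk L) x.
  apply: (@Ex_cvg _ L _ _ (fun v => K * (1 + 4 * lg R x) + K * 4 * lg R v)).
  - by apply: IgD; [exact: Ig_cst|apply: IgZ].
  - move=> n v; apply: le_trans (apart_le _ _) _.
    rewrite -mulrA -mulrDr ler_wpM2l //; have := lgD R x v; lra.
  - by move=> v; exact: apart_cvg SL _.
have H2 : (fun N => conv L (apart L N) x) @ \oo --> pk L x + dirac R x - 0.
  under eq_fun do rewrite conv_apart.
  apply: cvgB; first by apply: cvgD; [exact: apart_cvg SL _|exact: cvg_cst].
  apply/seq_cvgP => e e0; have [N HN] := nat_gt (K / e).
  exists N => n Nn; rewrite subr0 ger0_norm ?retn_ge0 //.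
  apply: le_trans (retn_le SL n x) _; rewrite ler_pdivrMr // mulrC -ler_pdivrMr //.
  by apply: le_trans (ltW HN) _; rewrite ler_nat (leq_trans Nn).
by rewrite (cvg_unique _ H1 H2) // subr0.
Qed.

End PotentialKernel2.

(** * Comparison of two walks with the same second moments *)

Section Comparison.
Context (R : realType).
Implicit Types (f F : Z2 -> R) (x v : Z2) (n N : nat).

Definition nsq v : R := (nrm1 v)%:R ^+ 2.

(** Lindeberg error of exchanging all the steps up to time [n + 1]: long jumps are measured by
    [|v|^2 / n], short ones by [|v|^3 / n^(3/2)]. *)
Definition omega (L : step_law R) n : R :=
  Ex L (fun v => nsq v * Num.min (n.+1%:R)^-1 ((nrm1 v)%:R / Num.sqrt n.+1%:R ^+ 3)).

Definition same_moments (L G : step_law R) :=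
  [/\ Ex L (fun v => v.1%:~R) = Ex G (fun v => v.1%:~R),
      Ex L (fun v => v.2%:~R) = Ex G (fun v => v.2%:~R),
      Ex L (fun v => v.1%:~R * v.1%:~R) = Ex G (fun v => v.1%:~R * v.1%:~R),
      Ex L (fun v => v.1%:~R * v.2%:~R) = Ex G (fun v => v.1%:~R * v.2%:~R) &
      Ex L (fun v => v.2%:~R * v.2%:~R) = Ex G (fun v => v.2%:~R * v.2%:~R)].

Lemma nsq_ge0 v : 0 <= nsq v.
Proof. exact: sqr_ge0. Qed.

Section Integrability.
Context (L : step_law R) (IL : Ig L nsq).

Lemma coord1_le v : `|v.1%:~R : R| <= (nrm1 v)%:R.
Proof. by rewrite absz_real /nrm1 ler_nat leq_addr. Qed.

Lemma coord2_le v : `|v.2%:~R : R| <= (nrm1 v)%:R.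
Proof. by rewrite absz_real /nrm1 ler_nat leq_addl. Qed.

Lemma nrm1_le_sq v : (nrm1 v)%:R <= nsq v.
Proof. by rewrite /nsq -natrX ler_nat; nia. Qed.

Lemma Ig_v1 : Ig L (fun v => v.1%:~R).
Proof. by apply: (Ig_le IL) => v; apply: le_trans (coord1_le v) (nrm1_le_sq v). Qed.
Lemma Ig_v2 : Ig L (fun v => v.2%:~R).
Proof. by apply: (Ig_le IL) => v; apply: le_trans (coord2_le v) (nrm1_le_sq v). Qed.
Lemma Ig_v11 : Ig L (fun v => v.1%:~R * v.1%:~R).
Proof. by apply: (Ig_le IL) => v; rewrite normrM /nsq expr2 ler_pM // coord1_le. Qed.
Lemma Ig_v12 : Ig L (fun v => v.1%:~R * v.2%:~R).
Proof. by apply: (Ig_le IL) => v; rewrite normrM /nsq expr2 ler_pM // ?coord1_le ?coord2_le. Qed.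
Lemma Ig_v22 : Ig L (fun v => v.2%:~R * v.2%:~R).
Proof. by apply: (Ig_le IL) => v; rewrite normrM /nsq expr2 ler_pM // coord2_le. Qed.

Lemma Ex_taylor f x : Ex L (fun v => lin2 f x v + quad2 f x v) =
  (diff e1 f x - diff e1 (diff e1 f) x / 2) * Ex L (fun v => v.1%:~R) +
  (diff e2 f x - diff e2 (diff e2 f) x / 2) * Ex L (fun v => v.2%:~R) +
  diff e1 (diff e1 f) x / 2 * Ex L (fun v => v.1%:~R * v.1%:~R) +
  diff e1 (diff e2 f) x * Ex L (fun v => v.1%:~R * v.2%:~R) +
  diff e2 (diff e2 f) x / 2 * Ex L (fun v => v.2%:~R * v.2%:~R)
  /\ Ig L (fun v => lin2 f x v + quad2 f x v).
Proof.
have I1 := Ig_v1; have I2 := Ig_v2; have I11 := Ig_v11; have I12 := Ig_v12; have I22 := Ig_v22.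
have -> : (fun v => lin2 f x v + quad2 f x v) = (fun v =>
  (diff e1 f x - diff e1 (diff e1 f) x / 2) * v.1%:~R +
  (diff e2 f x - diff e2 (diff e2 f) x / 2) * v.2%:~R +
  diff e1 (diff e1 f) x / 2 * (v.1%:~R * v.1%:~R) +
  diff e1 (diff e2 f) x * (v.1%:~R * v.2%:~R) +
  diff e2 (diff e2 f) x / 2 * (v.2%:~R * v.2%:~R)).
  by apply/funext => v; rewrite /lin2 /quad2; field.
set a1 := _ - _; set a2 := _ - _; set a3 := _ / 2; set a4 := diff _ _ _; set a5 := _ / 2.
have J1 := IgZ a1 I1; have J2 := IgZ a2 I2; have J3 := IgZ a3 I11.
have J4 := IgZ a4 I12; have J5 := IgZ a5 I22.
have K2 := IgD J1 J2; have K3 := IgD K2 J3; have K4 := IgD K3 J4.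
split; last exact: (IgD K4 J5).
by rewrite (ExD K4 J5) (ExD K3 J4) (ExD K2 J3) (ExD J1 J2) !ExZ.
Qed.

Lemma Ig_min (a b : R) : 0 <= a -> 0 <= b ->
  Ig L (fun v => Num.min (a * nsq v) (b * (nrm1 v)%:R ^+ 3)).
Proof.
move=> a0 b0; apply: (Ig_le (IgZ a IL)) => v.
by rewrite ger0_norm ?ge_min ?lexx // le_min !mulr_ge0 ?nsq_ge0 // exprn_ge0.
Qed.

Lemma Ig_omega n :
  Ig L (fun v => nsq v * Num.min (n.+1%:R)^-1 ((nrm1 v)%:R / Num.sqrt n.+1%:R ^+ 3)).
Proof.
apply: (Ig_le (IgZ (n.+1%:R)^-1 IL)) => v.
rewrite ger0_norm; last by rewrite mulr_ge0 ?nsq_ge0 // le_min invr_ge0 ler0n divr_ge0 // exprn_ge0.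
by rewrite mulrC ler_wpM2r ?nsq_ge0 // ge_min lexx.
Qed.

Lemma omega_ge0 n : 0 <= omega L n.
Proof.
apply: Ex_ge0; first exact: Ig_omega.
by move=> v; rewrite mulr_ge0 ?nsq_ge0 // le_min invr_ge0 ler0n divr_ge0 // exprn_ge0.
Qed.

Lemma sum_Ex N (g : nat -> Z2 -> R) : (forall n, Ig L (g n)) ->
  \sum_(n < N) Ex L (g n) = Ex L (fun v => \sum_(n < N) g n v) /\
  Ig L (fun v => \sum_(n < N) g n v).
Proof.
move=> Hg; elim: N => [|N [IH1 IH2]].
  rewrite big_ord0; under eq_fun do rewrite big_ord0.
  by rewrite Ex_cst; split=> //; exact: Ig_cst.
rewrite big_ord_recr IH1 /= -ExD //; under [in X in _ = X /\ _]eq_fun do rewrite big_ord_recr.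
split=> //; under eq_fun do rewrite big_ord_recr; exact: IgD.
Qed.

Lemma sum_omega_log N : Ig L (fun v => nsq v * lg R v) ->
  \sum_(n < N) omega L n <= Ex L (fun v => nsq v + 4 * (nsq v * lg R v)).
Proof.
move=> Il; have [-> I] := @sum_Ex N _ Ig_omega.
apply: Ex_le => //; first by apply: IgD => //; exact: IgZ.
move=> v; rewrite -mulr_sumr.
have -> : nsq v + 4 * (nsq v * lg R v) = nsq v * (1 + 4 * lg R v) by ring.
by rewrite ler_wpM2l ?nsq_ge0 // sum_min_le.
Qed.

(** After multiplication by [n + 1] the integrand is dominated by [nsq], while its third-order
    branch tends to [0] pointwise. *)
Lemma omega_small e : 0 < e -> exists n0, forall n, (n0 <= n)%N -> omega L n <= e / n.+1%:R.
Proof.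
move=> e0.
have : (fun n => Ex L (fun v => n.+1%:R *
   (nsq v * Num.min (n.+1%:R)^-1 ((nrm1 v)%:R / Num.sqrt n.+1%:R ^+ 3)))) @ \oo --> Ex L (fun=> 0).
  apply: (@Ex_cvg _ L _ _ nsq IL) => [n v|v].
    rewrite ger0_norm; last by rewrite !mulr_ge0 ?nsq_ge0 // le_min invr_ge0 ler0n divr_ge0 // exprn_ge0.
    rewrite mulrCA -[leRHS]mulr1 ler_wpM2l ?nsq_ge0 //.
    apply: (@le_trans _ _ (n.+1%:R * (n.+1%:R)^-1)); last by rewrite divff.
    by rewrite ler_wpM2l // ge_min lexx.
  apply/seq_cvgP => d d0; set A := nsq v * (nrm1 v)%:R.
  have A0 : 0 <= A by rewrite mulr_ge0 ?nsq_ge0.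
  have d1 : 0 < d / (A + 1) by rewrite divr_gt0 // ltr_wpDl.
  have [N [N0 HN]] := inv_sqrt_small d1.
  exists N => n Nn; rewrite subr0 ger0_norm; last first.
    by rewrite !mulr_ge0 ?nsq_ge0 // le_min invr_ge0 ler0n divr_ge0 // exprn_ge0.
  apply: (@le_trans _ _ (A * (Num.sqrt n.+1%:R)^-1)).
    have s := sqrtS_gt0 R n.
    apply: (@le_trans _ _ (n.+1%:R * (nsq v * ((nrm1 v)%:R / Num.sqrt n.+1%:R ^+ 3)))).
      by rewrite ler_wpM2l // ler_wpM2l ?nsq_ge0 // ge_min lexx orbT.
    rewrite -[X in X * _](@sqrtSS R n); apply: eq_ler; rewrite /A; field.
    by rewrite gt_eqF.
  apply: le_trans (ler_wpM2l A0 (HN n.+1 (leqW Nn))) _.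
  rewrite mulrCA ger_pMr // ler_pdivrMr ?mul1r ?lerDl // ltr_wpDl //.
rewrite Ex_cst => /seq_cvgP /(_ e e0)[N HN]; exists N => n /HN.
rewrite subr0 (ExZ _ (Ig_omega n)) -/(omega L n) ger0_norm ?mulr_ge0 ?omega_ge0 //.
by rewrite ler_pdivlMr // mulrC.
Qed.

(** By [omega_small], all but finitely many terms are below a small multiple of the harmonic
    series. *)
Lemma sum_omega_small e : 0 < e -> exists B, forall N,
  \sum_(n < N) omega L n <= B + e * ln (1 + Num.sqrt N%:R).
Proof.
move=> e0; have e4 : 0 < e / 4 by rewrite divr_gt0.
have [n0 Hn0] := omega_small e4.
exists (\sum_(n < n0) omega L n + e / 4) => N.
apply: (@le_trans _ _ (\sum_(n < n0) omega L n + e / 4 * \sum_(n < N) (n.+1%:R)^-1)); last first.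
  rewrite -addrA lerD2l; apply: le_trans (ler_wpM2l (ltW e4) (harmonic_le R N)) _.
  by apply: eq_ler; field.
rewrite mulr_sumr -!(big_mkord xpredT (omega L)) -(big_mkord xpredT (fun n => e / 4 * (n.+1%:R)^-1)).
have [Nn|nN] := leqP N n0.
  rewrite [X in _ <= X + _](big_cat_nat _ Nn) //= -addrA lerDl addr_ge0 // sumr_ge0 // => n _.
    exact: omega_ge0.
  by rewrite mulr_ge0 ?ltW // invr_gt0.
rewrite [X in X <= _](big_cat_nat _ (ltnW nN)) //= lerD2l.
rewrite [X in _ <= X](big_cat_nat _ (ltnW nN)) //= ler_wpDl //.
  by rewrite sumr_ge0 // => n _; rewrite mulr_ge0 ?ltW // invr_gt0.
by rewrite !big_nat; apply: ler_sum => n /andP[n0n _]; exact: Hn0.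
Qed.

End Integrability.

(** The bound by second differences serves large [v], the bound by third differences serves small
    [v]. *)
Lemma taylor_remainder f b b' x v :
  (forall h h', udir h -> udir h' -> bnd b (diff h (diff h' f))) ->
  (forall h h' h'', udir h -> udir h' -> udir h'' -> bnd b' (diff h (diff h' (diff h'' f)))) ->
  `|f (x + v) - f x - (lin2 f x v + quad2 f x v)| <=
  Num.min (2 * b * nsq v) (b' * (nrm1 v)%:R ^+ 3).
Proof.
move=> H2 H3; rewrite opprD addrA le_min; apply/andP; split; last exact: taylor2d_3.
apply: le_trans (ler_normB _ _) _.
have := taylor2d_2 v x H2; have := quad2_le v x H2; rewrite -/(nsq v); lra.
Qed.

Section TwoLaws.
Context (L G : step_law R) (C : R) (SL : smooth L C) (SG : smooth G C).
Context (IL : Ig L nsq) (IG : Ig G nsq) (LG : same_moments L G).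
Hypothesis LGC : forall f B, bnd B f -> conv L (conv G f) = conv G (conv L f).

(** Equal first and second moments cancel the expansions up to second order, leaving only the two
    remainders. *)
Lemma one_step f B b b' x : bnd B f ->
  (forall h h', udir h -> udir h' -> bnd b (diff h (diff h' f))) ->
  (forall h h' h'', udir h -> udir h' -> udir h'' -> bnd b' (diff h (diff h' (diff h'' f)))) ->
  `|conv L f x - conv G f x| <=
  Ex L (fun v => Num.min (2 * b * nsq v) (b' * (nrm1 v)%:R ^+ 3)) +
  Ex G (fun v => Num.min (2 * b * nsq v) (b' * (nrm1 v)%:R ^+ 3)).
Proof.
move=> Bf H2 H3.
have u1 : udir e1 by left.
have b0 : 0 <= 2 * b by rewrite mulr_ge0 // (bnd_ge0 (H2 _ _ u1 u1)).
have b'0 : 0 <= b' by exact: (bnd_ge0 (H3 _ _ _ u1 u1 u1)).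
pose t := fun v => lin2 f x v + quad2 f x v.
have key M : Ig M nsq -> `|conv M f x - f x - Ex M t| <=
    Ex M (fun v => Num.min (2 * b * nsq v) (b' * (nrm1 v)%:R ^+ 3)).
  move=> IM; have [_ It] := Ex_taylor IM f x.
  have I1 := @Ig_sh _ M _ _ x Bf; have I0 := Ig_cst M (f x).
  have -> : conv M f x - f x - Ex M t = Ex M (fun v => f (x + v) - f x - t v).
    by rewrite (ExB (IgB I1 I0) It) (ExB I1 I0) Ex_cst.
  have Im := Ig_min IM b0 b'0.
  have I2 : Ig M (fun v => `|f (x + v) - f x - t v|).
    by apply: (Ig_le Im) => v; rewrite normr_id; exact: taylor_remainder.
  by apply: le_trans (Ex_abs I2) _; apply: Ex_le => // v; exact: taylor_remainder.
have E : Ex L t = Ex G t.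
  have [-> _] := Ex_taylor IL f x; have [-> _] := Ex_taylor IG f x.
  by case: LG => -> -> -> -> ->.
have -> : conv L f x - conv G f x =
  (conv L f x - f x - Ex L t) - (conv G f x - f x - Ex G t) by rewrite E; ring.
by apply: le_trans (ler_normB _ _) _; apply: lerD; exact: key.
Qed.

Definition cmp_cst := 2 * decay_cst C 4 + decay_cst C 5.

Lemma cmp_cst_ge0 : 0 <= cmp_cst.
Proof. by have [C0 _] := SL; rewrite addr_ge0 ?mulr_ge0 ?decay_cst_ge0. Qed.

Lemma Ex_min_omega M i (IM : Ig M nsq) :
  Ex M (fun v => Num.min (2 * (decay_cst C 4 / Num.sqrt i.+1%:R ^+ 4) * nsq v)
     (decay_cst C 5 / Num.sqrt i.+1%:R ^+ 5 * (nrm1 v)%:R ^+ 3)) <=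
  cmp_cst / i.+1%:R * omega M i.
Proof.
have [C0 _] := SL.
have c4 := @decay_cst_ge0 _ C 4 C0; have c5 := @decay_cst_ge0 _ C 5 C0.
rewrite -(ExZ _ (Ig_omega IM i)); apply: Ex_le.
- by apply: Ig_min; rewrite // ?mulr_ge0 ?divr_ge0 ?exprn_ge0.
- by apply: IgZ; exact: Ig_omega.
move=> v; rewrite [leRHS]mulrA minr_pMr; last by rewrite !mulr_ge0 ?cmp_cst_ge0 ?nsq_ge0.
have := sqrtS_gt0 R i; have := sqrtSS R i; have n0 := nsq_ge0 v.
set s := Num.sqrt i.+1%:R => sE s0; rewrite -sE.
rewrite le_min; apply/andP; split.
- apply: (@le_trans _ _ (2 * (decay_cst C 4 / s ^+ 4) * nsq v)).
    by rewrite ge_min lexx.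
  have -> : 2 * (decay_cst C 4 / s ^+ 4) * nsq v =
    2 * decay_cst C 4 * (nsq v / s ^+ 4) by ring.
  have -> : cmp_cst / s ^+ 2 * nsq v / s ^+ 2 =
    cmp_cst * (nsq v / s ^+ 4) by field; rewrite gt_eqF.
  apply: ler_wpM2r; first by rewrite divr_ge0 // exprn_ge0 // ltW.
  by rewrite /cmp_cst lerDl.
- apply: (@le_trans _ _ (decay_cst C 5 / s ^+ 5 * (nrm1 v)%:R ^+ 3)).
    by rewrite ge_min lexx orbT.
  have -> : decay_cst C 5 / s ^+ 5 * (nrm1 v)%:R ^+ 3 =
    decay_cst C 5 * ((nrm1 v)%:R ^+ 3 / s ^+ 5) by ring.
  have -> : cmp_cst / s ^+ 2 * nsq v * ((nrm1 v)%:R / s ^+ 3) =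
    cmp_cst * ((nrm1 v)%:R ^+ 3 / s ^+ 5).
    by rewrite /nsq; field; rewrite gt_eqF.
  apply: ler_wpM2r; first by rewrite divr_ge0 ?exprn_ge0 // ltW.
  by rewrite /cmp_cst lerDr mulr_ge0.
Qed.

Lemma retn_compare n x : `|retn L n.+1 x - retn G n.+1 x| <=
  cmp_cst * (omega L n + omega G n).
Proof.
(* Hybrid walk with [k] steps of [L] and the others of [G]. Exchanging one step leaves [n] others,
   of either law, to smooth the difference. *)
pose mix k := iter k (conv L) (retn G (n.+1 - k)).
have step k : (k <= n)%N -> `|mix k.+1 x - mix k x| <=
   cmp_cst / n.+1%:R * (omega L n + omega G n).
  move=> kn; pose F := iter k (conv L) (retn G (n - k)).
  have BF : bnd 1 F by apply: iter_conv_bnd; exact: retn_bnd1.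
  have -> : mix k.+1 = conv L F by rewrite /mix subSS.
  have -> : mix k = conv G F.
    rewrite /mix subSn //= /F; elim: k {kn F BF} (retn G (n - k)) (@retn_bnd1 _ G (n - k)) => // k IH g Bg /=.
    by rewrite (IH _ Bg) (LGC (iter_conv_bnd L k Bg)).
  have kk : (k + (n - k))%N = n by rewrite subnKC.
  apply: le_trans (@one_step F 1 (decay_cst C 4 / Num.sqrt n.+1%:R ^+ 4)
    (decay_cst C 5 / Num.sqrt n.+1%:R ^+ 5) x BF _ _) _.
  - move=> h h' uh uh'; have ud : udirs [:: h; h'].
      by move=> z; rewrite !inE => /orP[] /eqP->.
    by have := mixed_decay k (n - k) SL SG ud; rewrite kk.
  - move=> h h' h'' uh uh' uh''; have ud : udirs [:: h; h'; h''].
      by move=> z; rewrite !inE => /or3P[] /eqP->.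
    by have := mixed_decay k (n - k) SL SG ud; rewrite kk.
  by rewrite mulrDr lerD // Ex_min_omega.
have tele m : (m <= n.+1)%N -> `|mix m x - mix 0%N x| <=
    m%:R * (cmp_cst / n.+1%:R * (omega L n + omega G n)).
  elim: m => [|m IH] mn; first by rewrite subrr normr0 mul0r.
  have -> : mix m.+1 x - mix 0%N x = (mix m.+1 x - mix m x) + (mix m x - mix 0%N x) by ring.
  apply: le_trans (ler_normD _ _) _; rewrite -natr1 mulrDl mul1r addrC.
  by apply: lerD; [exact: IH (ltnW mn)|exact: step].
have := tele n.+1 (leqnn _).
have -> : mix n.+1 = retn L n.+1 by rewrite /mix subnn.
have -> : mix 0%N = retn G n.+1 by rewrite /mix subn0.
by move/le_trans; apply; apply: eq_ler; field.
Qed.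

Lemma apart_compare N x : `|apart L N x - apart G N x| <=
  2 * cmp_cst * \sum_(n < N) (omega L n + omega G n).
Proof.
have c0 := cmp_cst_ge0.
have w0 n : 0 <= omega L n + omega G n by rewrite addr_ge0 ?omega_ge0.
case: N => [|N]; first by rewrite /apart !big_ord0 subrr normr0 mulr0.
apply: (@le_trans _ _ (2 * cmp_cst * \sum_(n < N) (omega L n + omega G n))); last first.
  by rewrite ler_wpM2l ?mulr_ge0 // [leRHS]big_ord_recr /= lerDl.
(* Time [0] contributes nothing, both terms being the same point mass; time [n + 1] is compared
   through the index [n]. *)
rewrite /apart -sumrB big_ord_recl /= subrr add0r mulr_sumr.
apply: le_trans (ler_norm_sum _ _ _) _; apply: ler_sum => n _;  rewrite /bump /=.
have := retn_compare n 0; have := retn_compare n x => H1 H2.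
set a := retn L _ 0 in H2 *; set b := retn L _ x in H1 *.
set c := retn G _ 0 in H2 *; set d := retn G _ x in H1 *.
have -> : a - b - (c - d) = (a - c) - (b - d) by ring.
by apply: le_trans (ler_normB _ _) _; lra.
Qed.

(** Up to the diffusive time the truncated kernels are compared step by step; from then on each
    kernel is within [2 * kcst C] of its truncation. *)
Lemma pk_compare x (N := (nrm1 x ^ 2)%N) : `|pk L x - pk G x| <=
  2 * cmp_cst * \sum_(n < N) (omega L n + omega G n) + 4 * kcst C.
Proof.
have c0 := cmp_cst_ge0; have K0 := kcst_ge0 SL.
have w0 n : 0 <= omega L n + omega G n by rewrite addr_ge0 ?omega_ge0.
have [/eqP n0|n0] := eqVneq (nrm1 x) 0%N.
  move: n0; rewrite nrm1_eq0 => /eqP ->; rewrite (pk0 SL) (pk0 SG) subrr normr0.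
  by rewrite addr_ge0 ?mulr_ge0 // sumr_ge0.
have N0 : (0 < N)%N by rewrite expn_gt0 lt0n n0.
have P1 := pk_approx SL x N0; have P2 := pk_approx SG x N0.
have sN : Num.sqrt N%:R = (nrm1 x)%:R :> R.
  by rewrite natrX sqrtr_sqr ger0_norm.
have nx : (nrm1 x)%:R != 0 :> R by rewrite pnatr_eq0.
rewrite sN mulfK // in P1 P2; have P3 := apart_compare N x.
have -> : pk L x - pk G x = (pk L x - apart L N x) + (apart L N x - apart G N x)
  - (pk G x - apart G N x) by ring.
apply: le_trans (ler_normB _ _) _; apply: le_trans (lerD (ler_normD _ _) (lexx _)) _.
lra.
Qed.

Lemma pk_compare_log : Ig L (fun v => nsq v * lg R v) -> Ig G (fun v => nsq v * lg R v) ->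
  exists B, forall x, `|pk L x - pk G x| <= B.
Proof.
move=> I1 I2.
exists (2 * cmp_cst * (Ex L (fun v => nsq v + 4 * (nsq v * lg R v)) +
   Ex G (fun v => nsq v + 4 * (nsq v * lg R v))) + 4 * kcst C) => x.
apply: le_trans (pk_compare x) _; rewrite lerD2r ler_wpM2l ?mulr_ge0 ?cmp_cst_ge0 //.
by rewrite big_split /= lerD // sum_omega_log.
Qed.

Lemma pk_compare_small e : 0 < e ->
  exists B, forall x, `|pk L x - pk G x| <= B + e * lg R x.
Proof.
move=> e0; have c0 := cmp_cst_ge0.
have d0 : 0 < e / (4 * (cmp_cst + 1)) by rewrite divr_gt0 // mulr_gt0 // ltr_wpDl.
have [B1 H1] := sum_omega_small IL d0; have [B2 H2] := sum_omega_small IG d0.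
exists (2 * cmp_cst * (B1 + B2) + 4 * kcst C) => x; apply: le_trans (pk_compare x) _.
set N := (nrm1 x ^ 2)%N.
have sN : Num.sqrt N%:R = (nrm1 x)%:R :> R.
  by rewrite natrX sqrtr_sqr ger0_norm.
have := H1 N; have := H2 N; rewrite big_split /= sN -/(lg R x).
set S1 := \sum_(n < N) omega L n; set S2 := \sum_(n < N) omega G n => h2 h1.
have l0 := lg_ge0 R x.
have h3 : 2 * cmp_cst * (S1 + S2) <=
   2 * cmp_cst * (B1 + B2 + 2 * (e / (4 * (cmp_cst + 1)) * lg R x)).
  by rewrite ler_wpM2l ?mulr_ge0 //; lra.
have h4 : 2 * cmp_cst * (2 * (e / (4 * (cmp_cst + 1)) * lg R x)) <= e * lg R x.
  have -> : 2 * cmp_cst * (2 * (e / (4 * (cmp_cst + 1)) * lg R x)) =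
    e * lg R x * (cmp_cst / (cmp_cst + 1)) by field; rewrite gt_eqF // ltr_wpDl.
  rewrite ler_piMr //; first by rewrite mulr_ge0 // ltW.
  by rewrite ler_pdivrMr ?ltr_wpDl // mul1r lerDl.
lra.
Qed.

End TwoLaws.
End Comparison.

(** * A reference walk with finite range *)

Section RiemannSums.
Context (R : realType).
Implicit Types (Phi Psi V : R -> R) (r t u x l e : R).

(** An even function [Phi], decreasing from [1] on the half-line, with an odd antiderivative [Psi]
    tending to [l]: its integral over the line is [2 * l], expressed without improper integrals. *)
Definition bump_fun Phi Psi l :=
  [/\ (forall x : R, is_derive x 1 Psi (Phi x)),
      (forall x, 0 <= Phi x) /\ (forall x, Phi (- x) = Phi x),
      (forall t u, 0 <= t -> t <= u -> Phi u <= Phi t) /\ Phi 0 = 1,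
      (forall x, Psi (- x) = - Psi x) /\ (forall x, Psi x <= l) &
      forall e, 0 < e -> exists X, forall x, X <= x -> l - e <= Psi x].

Lemma derive_incr Phi Psi : (forall x : R, is_derive x 1 Psi (Phi x)) ->
  forall t u, t <= u -> exists2 c, t <= c <= u & Psi u - Psi t = Phi c * (u - t).
Proof.
move=> D t u tu.
have [|c] := @MVT_segment R Psi Phi t u tu (fun x _ => D x).
  apply: derivable_within_continuous => x _; exact: ex_derive.
by rewrite in_itv /= => ctu E; exists c.
Qed.

(* [V] is the total variation of [Phi] on [(-oo, x]], so that the error of each
   Riemann cell is an increment of [V]. *)
Lemma riemann_cell Phi Psi l r t n : bump_fun Phi Psi l -> 0 < r ->
  `|r * (\sum_(k < n) Phi (r * (t + k%:R))) - (Psi (r * (t + n%:R)) - Psi (r * t))|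
    <= 2 * r.
Proof.
move=> [D [P0 Pe] [Pd P1] _ _] r0.
pose V x := if x <= 0 then Phi x else 2 - Phi x.
have P1' x : Phi x <= 1.
  rewrite -P1; have [x0|x0] := leP 0 x; first exact: Pd.
  by rewrite -Pe; apply: Pd => //; rewrite oppr_ge0 ltW.
have VP x y : x <= y -> `|Phi x - Phi y| <= V y - V x.
  move=> xy; rewrite /V; case: (leP x 0) => x0; case: (leP y 0) => y0.
  - have H : Phi x <= Phi y.
      by rewrite -Pe -[leRHS]Pe; apply: Pd; rewrite ?oppr_ge0 ?lerN2.
    by rewrite ler0_norm ?subr_le0 // opprB.
  - by have := P1' x; have := P1' y; rewrite ler_norml => h1 h2; apply/andP; split; lra.
  - by exfalso; lra.
  - have H : Phi y <= Phi x by apply: Pd => //; exact: ltW.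
    by rewrite ger0_norm ?subr_ge0 //; lra.
have Vmono x y : x <= y -> V x <= V y.
  by move=> /VP H; rewrite -subr_ge0; apply: le_trans H.
have V01 x : 0 <= V x <= 2.
  by have := P1' x; have := P0 x; rewrite /V; case: ifP => _ h1 h2; apply/andP; split; lra.
suff H : `|r * (\sum_(k < n) Phi (r * (t + k%:R))) - (Psi (r * (t + n%:R)) - Psi (r * t))|
    <= r * (V (r * (t + n%:R)) - V (r * t)).
  apply: le_trans H _; rewrite mulrC ler_pM2r //.
  have := V01 (r * (t + n%:R)); have := V01 (r * t) => /andP[h1 h2] /andP[h3 h4]; lra.
elim: n => [|n IH].
  by rewrite big_ord0 mulr0 addr0 !subrr normr0 mulr0.
rewrite big_ord_recr /=; set a := r * (t + n%:R) in IH *; set b := r * (t + n.+1%:R).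
have ab : b - a = r by rewrite /a /b -natr1; ring.
have ab' : a <= b by rewrite -subr_ge0 ab ltW.
have [c /andP[ac cb] E] := derive_incr D ab'.
set S := \sum_(k < n) _ in IH *; set p := Psi (r * t) in IH *.
have -> : r * (S + Phi a) - (Psi b - p) = (r * S - (Psi a - p)) + r * (Phi a - Phi c).
  have -> : Psi b = Psi a + Phi c * r by rewrite -ab -E; ring.
  ring.
apply: le_trans (ler_normD _ _) _.
have -> : r * (V b - V (r * t)) = r * (V a - V (r * t)) + r * (V b - V a) by ring.
apply: lerD => //; rewrite normrM gtr0_norm // ler_pM2l //.
by apply: le_trans (VP _ _ ac) _; rewrite lerD2r; exact: Vmono.
Qed.

Lemma riemann_upper Phi Psi l r t n : bump_fun Phi Psi l -> 0 < r ->
  r * (\sum_(k < n) Phi (r * (t + k%:R))) <= 2 * l + 2 * r.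
Proof.
move=> H r0; have := riemann_cell t n H r0.
have [_ _ _ [Po Pl] _] := H.
have h1 := Pl (r * (t + n%:R)); have := Pl (- (r * t)); rewrite Po => h2.
by rewrite ler_norml => /andP[_ h3]; lra.
Qed.

Lemma riemann_lower Phi Psi l r s e : bump_fun Phi Psi l -> 0 < r -> 0 < e ->
  exists N, forall n, (N <= n)%N ->
  2 * l - 2 * r - e <= r * (\sum_(k < (2 * n).+1) Phi (r * (s - n%:R + k%:R))).
Proof.
move=> H r0 e0; have [_ _ _ [Po Pl] Plim] := H.
have e2 : 0 < e / 2 by rewrite divr_gt0.
have [X HX] := Plim _ e2.
have [N HN] := nat_gt (`|s| + `|X| / r); exists N => n Nn.
have nN : `|s| + `|X| / r <= n%:R.
  by apply: le_trans (ltW HN) _; rewrite ler_nat.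
have sn : `|s| <= `|s| by []; move: sn; rewrite {1}ler_norml => /andP[s1 s2].
have nr : `|X| <= r * (n%:R - `|s|).
  by rewrite mulrC -ler_pdivrMr //; lra.
have XX := ler_norm X.
have b1 : X <= r * (s - n%:R + (2 * n).+1%:R).
  apply: le_trans XX _; apply: le_trans nr _; rewrite ler_pM2l //.
  by rewrite -natr1 natrM; lra.
have b2 : X <= - (r * (s - n%:R)).
  by apply: le_trans XX _; apply: le_trans nr _; rewrite -mulrN ler_pM2l //; lra.
have := HX _ b1; have := HX _ b2; rewrite Po => h1 h2.
have := riemann_cell (s - n%:R) (2 * n).+1 H r0.
by rewrite ler_norml => /andP[h3 _]; lra.
Qed.

Lemma onesq_gt0 x : 0 < 1 + x ^+ 2.
Proof. by rewrite ltr_pwDl // sqr_ge0. Qed.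

Lemma onesq_mono t u : 0 <= t -> t <= u -> 1 + t ^+ 2 <= 1 + u ^+ 2.
Proof. by move=> t0 tu; rewrite lerD2l lerXn2r ?nnegrE // (le_trans t0). Qed.

Lemma cvgy_near (f : R -> R) l : f x @[x --> +oo] --> l ->
  forall e, 0 < e -> exists X, forall x, X <= x -> `|f x - l| <= e.
Proof.
move=> /cvgrPdist_le H e /H [M [_ HM]]; exists (M + 1) => x Mx.
by rewrite distrC; apply: HM; apply: lt_le_trans Mx; rewrite ltrDl.
Qed.

Lemma bump_atan : bump_fun (fun x => (1 + x ^+ 2)^-1) (@atan R) (pi / 2).
Proof.
split.
- by move=> x; exact: is_derive1_atan.
- by split=> x; [rewrite invr_ge0 ltW // onesq_gt0|rewrite sqrrN].
- split; last by rewrite expr0n addr0 invr1.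
  by move=> t u t0 tu; rewrite lef_pV2 ?posrE ?onesq_gt0 // onesq_mono.
- by split=> x; [exact: atanN|exact/ltW/atan_ltpi2].
- move=> e e0; have [X HX] := cvgy_near (@cvgy_atan R) e0.
  by exists X => x /HX; rewrite ler_norml => /andP[]; lra.
Qed.

Lemma bump_limit_bound Phi Psi l : (forall x : R, is_derive x 1 Psi (Phi x)) ->
  (forall x, 0 <= Phi x) ->
  (forall e, 0 < e -> exists X, forall x, X <= x -> `|Psi x - l| <= e) ->
  forall x, Psi x <= l.
Proof.
move=> D P0 Pl x; apply/ler_addgt0Pr => e /Pl [X HX].
have [c _ E] : exists2 c, x <= c <= Num.max x X &
   Psi (Num.max x X) - Psi x = Phi c * (Num.max x X - x).
  by apply: derive_incr => //; rewrite le_max lexx.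
have h1 : 0 <= Psi (Num.max x X) - Psi x.
  by rewrite E mulr_ge0 // subr_ge0 le_max lexx.
have : `|Psi (Num.max x X) - l| <= e by apply: HX; rewrite le_max lexx orbT.
by rewrite ler_norml => /andP[_]; lra.
Qed.

(** Profile of [(M^2 + Q^-1)^(-2)] along one lattice row; its integral is [pi / 2]. *)
Lemma bump_sq : bump_fun (fun x => ((1 + x ^+ 2) ^+ 2)^-1)
  (fun x => (atan x + x / (1 + x ^+ 2)) / 2) (pi / 4).
Proof.
have D (x : R) : is_derive x 1 (fun x : R => (atan x + x / (1 + x ^+ 2)) / 2) ((1 + x ^+ 2) ^+ 2)^-1.
  have w0 := onesq_gt0 x.
  have D1 : is_derive x 1 (fun x : R => 1 + x ^+ 2) (2 * x).
    by apply: is_derive_eq; rewrite /GRing.scale /=; ring.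
  have D2 : is_derive x 1 (fun x : R => (1 + x ^+ 2)^-1) (- ((1 + x ^+ 2) ^- 2) * (2 * x)).
    by apply: is_deriveV => //; rewrite gt_eqF.
  have D3 := is_deriveZ 2^-1 (is_deriveD (is_derive1_atan x) (is_deriveM (is_derive_id x 1) D2)).
  have -> : (fun x : R => (atan x + x / (1 + x ^+ 2)) / 2) =
    2^-1 \*: (@atan R + id * (fun x : R => (1 + x ^+ 2)^-1)).
    by apply/funext => y; rewrite mulrC.
  refine (is_derive_eq D3 _).
  rewrite /GRing.scale /=; field; rewrite gt_eqF //.
have P0 x : 0 <= ((1 + x ^+ 2) ^+ 2)^-1.
  by rewrite invr_ge0 exprn_ge0 // ltW // onesq_gt0.
have lim0 e : 0 < e -> exists X, forall x, X <= x -> `|(atan x + x / (1 + x ^+ 2)) / 2 - pi / 4| <= e.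
  move=> e0; have [X HX] := cvgy_near (@cvgy_atan R) e0.
  exists (Num.max X (Num.max 1 e^-1)) => x; rewrite !ge_max => /and3P[/HX + x1 xe].
  have x0 : 0 < x by lra.
  have h1 : x / (1 + x ^+ 2) <= e.
    rewrite ler_pdivrMr ?onesq_gt0 //.
    have : 1 <= e * x by rewrite mulrC -ler_pdivrMr // div1r.
    nra.
  have h2 : 0 <= x / (1 + x ^+ 2) by rewrite divr_ge0 // ltW // onesq_gt0.
  by rewrite !ler_norml => /andP[h3 h4]; apply/andP; split; lra.
split => //.
- by split=> // x; rewrite sqrrN.
- split; last by rewrite expr0n addr0 expr1n invr1.
  move=> t u t0 tu; rewrite lef_pV2 ?posrE ?exprn_gt0 ?onesq_gt0 //.
  by rewrite lerXn2r ?nnegrE ?onesq_mono // ltW // onesq_gt0.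
- split; first by move=> x; rewrite atanN sqrrN; ring.
  exact: bump_limit_bound D P0 lim0.
- move=> e /lim0 [X HX]; exists X => x /HX; rewrite ler_norml => /andP[]; lra.
Qed.

(** Profile across the rows once each row is summed, since integrating [(alpha^2 + t^2)^(-2)] in [t]
    yields a multiple of [alpha^(-3)]. Its integral is [2]. *)
Lemma bump_32 : bump_fun (fun x => (Num.sqrt (1 + x ^+ 2) ^+ 3)^-1)
  (fun x => x / Num.sqrt (1 + x ^+ 2)) 1.
Proof.
have s0 (x : R) : 0 < Num.sqrt (1 + x ^+ 2) by rewrite sqrtr_gt0 onesq_gt0.
have D (x : R) : is_derive x 1 (fun x : R => x / Num.sqrt (1 + x ^+ 2))
    (Num.sqrt (1 + x ^+ 2) ^+ 3)^-1.
  have w0 := onesq_gt0 x.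
  have D1 : is_derive x 1 (fun x : R => 1 + x ^+ 2) (2 * x).
    by apply: is_derive_eq; rewrite /GRing.scale /=; ring.
  have D1' := @is_derive1_comp R Num.sqrt (fun x : R => 1 + x ^+ 2) x _ _ (is_derive1_sqrt w0) D1.
  have D2 := @is_deriveV R (Num.sqrt \o (fun x : R => 1 + x ^+ 2)) x _ _ (lt0r_neq0 (s0 x)) D1'.
  have D3 := is_deriveM (is_derive_id x 1) D2.
  refine (is_derive_eq D3 _).
  have := sqr_sqrtr (ltW w0); have := s0 x; rewrite /GRing.scale /=.
  set s := Num.sqrt _ => sp sE.
  have -> : (s ^+ 3)^-1 = (s ^+ 2 - x ^+ 2) / s ^+ 3 by rewrite sE addrK mul1r.
  by field; rewrite gt_eqF.
have P0 x : 0 <= (Num.sqrt (1 + x ^+ 2) ^+ 3)^-1 by rewrite invr_ge0 exprn_ge0.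
have xs (x : R) : x <= Num.sqrt (1 + x ^+ 2).
  apply: le_trans (ler_norm _) _; rewrite -sqrtr_sqr ler_wsqrtr // lerDr //.
split => //.
- by split=> // x; rewrite sqrrN.
- split; last by rewrite expr0n addr0 sqrtr1 expr1n invr1.
  move=> t u t0 tu; rewrite lef_pV2 ?posrE ?exprn_gt0 //.
  by rewrite lerXn2r ?nnegrE // ler_wsqrtr // onesq_mono.
- split; first by move=> x; rewrite sqrrN mulNr.
  by move=> x; rewrite ler_pdivrMr // mul1r.
- move=> e e0; exists (Num.max 1 e^-1) => x; rewrite ge_max => /andP[x1 xe].
  rewrite ler_pdivlMr // mulrBl mul1r.
  have h : Num.sqrt (1 + x ^+ 2) <= x + e.
    have x0 : 0 <= x + e by lra.
    rewrite -(ger0_norm x0) -sqrtr_sqr ler_wsqrtr //.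
    have : 1 <= e * x by rewrite mulrC -ler_pdivrMr // div1r.
    by have := sqr_ge0 e; rewrite sqrrD; lra.
  have : e <= e * Num.sqrt (1 + x ^+ 2).
    rewrite ler_pMr // -[leLHS]sqrtr1 ler_wsqrtr // lerDl sqr_ge0 //.
  lra.
Qed.

End RiemannSums.

(** * Finitely supported symmetric step laws *)

Section SymmetricLaw.
Context (R : realType).
Implicit Types (ws : seq (R * Z2)) (f g : Z2 -> R).

(** Sharing each weight between a vector and its opposite makes odd moments vanish and second
    differences centred. *)
Definition symEx (w0 : R) ws f : R :=
  w0 * f 0 + \sum_(p <- ws) p.1 * ((f p.2 + f (- p.2)) / 2).

Context (w0 : R) (ws : seq (R * Z2)).
Hypotheses (w0_ge0 : 0 <= w0) (ws_ge0 : forall p, p \in ws -> 0 <= p.1)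
  (ws_sum1 : w0 + \sum_(p <- ws) p.1 = 1).

Lemma symEx_cst c : symEx w0 ws (fun=> c) = c.
Proof.
have E : (w0 + \sum_(p <- ws) p.1) * c = c by rewrite ws_sum1 mul1r.
rewrite /symEx -[RHS]E [in RHS]mulrDl mulr_suml; congr (_ + _).
by apply: eq_bigr => p _; congr (_ * _); field.
Qed.

Lemma symExD f g : symEx w0 ws (fun v => f v + g v) = symEx w0 ws f + symEx w0 ws g.
Proof.
rewrite /symEx mulrDr addrACA -big_split; congr (_ + _).
by apply: eq_bigr => p _ /=; field.
Qed.

Lemma symExZ c f : symEx w0 ws (fun v => c * f v) = c * symEx w0 ws f.
Proof.
rewrite /symEx mulrDr mulr_sumr mulrCA; congr (_ + _).
by apply: eq_bigr => p _ /=; field.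
Qed.

Lemma symEx_le f g : (forall v, f v <= g v) -> symEx w0 ws f <= symEx w0 ws g.
Proof.
move=> fg; apply: lerD; first exact: ler_wpM2l.
rewrite big_seq [leRHS]big_seq; apply: ler_sum => p /ws_ge0 p0.
by rewrite ler_wpM2l // ler_pM2r // lerD.
Qed.

Lemma symEx_cvg (u : nat -> Z2 -> R) f : (forall v, u ^~ v @ \oo --> f v) ->
  (fun n => symEx w0 ws (u n)) @ \oo --> symEx w0 ws f.
Proof.
move=> uf; apply: cvgD; first by apply: cvgM; [exact: cvg_cst|exact: uf].
elim: ws => [|p s IH].
  by rewrite big_nil; under eq_fun do rewrite big_nil; exact: cvg_cst.
rewrite big_cons; under eq_fun do rewrite big_cons.
apply: cvgD => //; apply: cvgM; first exact: cvg_cst.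
by apply: cvgM; [apply: cvgD; exact: uf|exact: cvg_cst].
Qed.

Definition symlaw : step_law R := {|
  Ex := symEx w0 ws; Ig := fun=> True;
  Ig_cst := fun=> I; Ex_cst := symEx_cst;
  IgD := fun _ _ _ _ => I; ExD := fun f g _ _ => symExD f g;
  IgZ := fun _ _ _ => I; ExZ := fun c f _ => symExZ c f;
  Ig_le := fun _ _ _ _ => I; Ex_le := fun f g _ _ fg => symEx_le fg;
  Ex_cvg := fun u f g _ _ uf => symEx_cvg uf |}.

Lemma conv_symlawE f x : conv symlaw f x =
  w0 * f x + \sum_(p <- ws) p.1 * ((f (x + p.2) + f (x - p.2)) / 2).
Proof. by rewrite /conv /= /symEx addr0. Qed.

(** A finite combination of shifts passes through any expectation by linearity; boundedness supplies
    the integrability. *)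
Lemma conv_symlawC L f B : bnd B f ->
  conv L (conv symlaw f) = conv symlaw (conv L f).
Proof.
move=> Bf; have -> : conv symlaw f = (fun x =>
    w0 * f x + \sum_(p <- ws) p.1 * ((f (x + p.2) + f (x - p.2)) / 2)).
  by apply/funext => x; exact: conv_symlawE.
apply/funext => x; rewrite conv_symlawE.
have IE (s : seq (R * Z2)) : Ig L (fun v => \sum_(p <- s) p.1 * ((f (x + v + p.2) + f (x + v - p.2)) / 2)) /\
   Ex L (fun v => \sum_(p <- s) p.1 * ((f (x + v + p.2) + f (x + v - p.2)) / 2)) =
   \sum_(p <- s) p.1 * ((conv L f (x + p.2) + conv L f (x - p.2)) / 2).
  elim: s => [|p s [IH1 IH2]].
    rewrite big_nil; under eq_fun do rewrite big_nil.
    by rewrite Ex_cst; split=> //; exact: Ig_cst.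
  rewrite big_cons; under eq_fun do rewrite big_cons.
  have I1 := @Ig_sh _ L _ _ (x + p.2) Bf; have I2 := @Ig_sh _ L _ _ (x - p.2) Bf.
  have E : (fun v => p.1 * ((f (x + v + p.2) + f (x + v - p.2)) / 2)) =
     (fun v => p.1 / 2 * (f (x + p.2 + v) + f (x - p.2 + v))).
    by apply/funext => v; rewrite [x + v + _]addrAC [x + v - _]addrAC; field.
  have I3 : Ig L (fun v => p.1 * ((f (x + v + p.2) + f (x + v - p.2)) / 2)).
    by rewrite E; apply: IgZ; exact: IgD.
  split; first exact: IgD.
  rewrite ExD // IH2 E ExZ ?ExD //; last exact: IgD.
  by congr (_ + _); rewrite /conv; field.
have [I1 E1] := IE ws; have I0 := @Ig_sh _ L _ _ x Bf.
by rewrite /conv ExD ?ExZ // ?E1 //; exact: IgZ.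
Qed.

End SymmetricLaw.

(** * Approximate potentials and their total charge *)

Section FinitePotential.
Context (R : realType) (G : step_law R) (C : R) (SG : smooth G C).
Context (IgT : forall f, Ig G f).
Implicit Types (f g psi : Z2 -> R) (x z : Z2) (Lam : seq Z2).

Let K := kcst C.

Lemma convT_lin (a b : R) f g :
  conv G (fun x => a * f x + b * g x) = fun x => a * conv G f x + b * conv G g x.
Proof. by apply/funext => x; rewrite /conv ExD ?ExZ. Qed.

Lemma iter_convT_lin (a b : R) f g n :
  iter n (conv G) (fun x => a * f x + b * g x) =
  fun x => a * iter n (conv G) f x + b * iter n (conv G) g x.
Proof. by elim: n => //= n ->; rewrite convT_lin. Qed.

Lemma iter_convT_sum Lam (F : Z2 -> Z2 -> R) n :
  iter n (conv G) (fun x => \sum_(z <- Lam) F z x) =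
  fun x => \sum_(z <- Lam) iter n (conv G) (F z) x.
Proof.
elim: Lam => [|z s IH].
  have -> : (fun x : Z2 => \sum_(z <- [::]) F z x) = (fun x => 0 * dirac R x + 0 * dirac R x).
    by apply/funext => x; rewrite big_nil !mul0r addr0.
  by rewrite iter_convT_lin; apply/funext => x; rewrite big_nil !mul0r addr0.
have -> : (fun x : Z2 => \sum_(z <- z :: s) F z x) =
   (fun x => 1 * F z x + 1 * (\sum_(z <- s) F z x)).
  by apply/funext => x; rewrite big_cons !mul1r.
by rewrite iter_convT_lin IH; apply/funext => x; rewrite big_cons !mul1r.
Qed.

Lemma iter_convT_le f g n : (forall x, f x <= g x) ->
  forall x, iter n (conv G) f x <= iter n (conv G) g x.
Proof.
by move=> fg; elim: n => //= n IH x; apply: Ex_le => // v; exact: IH.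
Qed.

(* The charge of [psi] sitting on [Lam], as a superposition of point masses. *)
Lemma iter_conv_charge psi Lam n x :
  iter n (conv G) (fun y => \sum_(z <- Lam) psi z * dirac R (y - z)) x =
  \sum_(z <- Lam) psi z * retn G n (x - z).
Proof.
rewrite iter_convT_sum; apply: eq_bigr => z _.
have -> : (fun y => psi z * dirac R (y - z)) =
  (fun y => psi z * dirac R (y - z) + 0 * dirac R (y - z)).
  by apply/funext => y; rewrite mul0r addr0.
by rewrite iter_convT_lin mul0r addr0 (iter_conv_sh G (dirac R) (- z)).
Qed.

Lemma sum_dirac psi Lam y : uniq Lam ->
  \sum_(z <- Lam) psi z * dirac R (y - z) = if y \in Lam then psi y else 0.
Proof.
move=> U; case: ifPn => yL.
  rewrite (bigD1_seq y) //= big1 ?addr0.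
    by rewrite subrr /dirac eqxx mulr1.
  by move=> z zy; rewrite /dirac subr_eq0 eq_sym (negbTE zy) mulr0.
rewrite big_seq big1 // => z zL; rewrite /dirac subr_eq0.
by case: eqP => [yz|_]; [rewrite yz zL in yL|rewrite mulr0].
Qed.

(** Iterating [conv G f = f + psi], the charge at [z] contributes [psi z] times
    [apart G N (x - z) - apart G N (- z)]; replacing the latter by [apart G N x] costs a logarithm
    of [z]. The charge off [Lam] is bounded by [tau] at each of the [N] times, for [x] and for
    [0]. *)
Lemma potential_bound f psi Lam (tau : R) N x : uniq Lam ->
  (forall y, conv G f y = f y + psi y) ->
  (forall z, z \notin Lam -> `|psi z| <= tau) -> 0 <= tau ->
  `|f x - f 0 - (\sum_(z <- Lam) psi z) * apart G N x| <=
  `|iter N (conv G) f x - iter N (conv G) f 0| +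
  2 * K * (\sum_(z <- Lam) `|psi z| * (1 + 4 * lg R z)) + 2 * N%:R * tau.
Proof.
move=> U fpsi tpsi tau0.
pose rest y := if y \in Lam then 0 else psi y.
pose chg y := \sum_(z <- Lam) psi z * dirac R (y - z).
have psiE : psi = (fun y => 1 * chg y + 1 * rest y).
  apply/funext => y; rewrite !mul1r /chg sum_dirac // /rest.
  by case: ifP; rewrite ?addr0 ?add0r.
have rb n y : `|iter n (conv G) rest y| <= tau.
  apply: iter_conv_bnd => z; rewrite /rest; case: ifPn => [|/tpsi //].
  by rewrite normr0.
have iE n y : iter n.+1 (conv G) f y = iter n (conv G) f y +
   (\sum_(z <- Lam) psi z * retn G n (y - z) + iter n (conv G) rest y).
  rewrite iterSr; have -> : conv G f = (fun y => 1 * f y + 1 * psi y).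
    by apply/funext => z; rewrite fpsi !mul1r.
  by rewrite iter_convT_lin !mul1r [in X in _ + X]psiE iter_convT_lin iter_conv_charge !mul1r.
have main : f x - f 0 = (iter N (conv G) f x - iter N (conv G) f 0) +
   \sum_(z <- Lam) psi z * (apart G N (x - z) - apart G N (- z)) -
   \sum_(n < N) (iter n (conv G) rest x - iter n (conv G) rest 0).
  elim: N => [|N IH].
    rewrite big_ord0 subr0 /= big1 ?addr0 // => z _.
    by rewrite /apart !big_ord0 subrr mulr0.
  have aS y : apart G N.+1 y = apart G N y + (retn G N 0 - retn G N y).
    by rewrite /apart big_ord_recr.
  rewrite IH !iE big_ord_recr /=.
  have -> : \sum_(z <- Lam) psi z * (apart G N.+1 (x - z) - apart G N.+1 (- z)) =
     \sum_(z <- Lam) psi z * (apart G N (x - z) - apart G N (- z)) -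
     \sum_(z <- Lam) psi z * retn G N (x - z) + \sum_(z <- Lam) psi z * retn G N (- z).
    by rewrite -sumrB -big_split /=; apply: eq_bigr => z _; rewrite !aS; ring.
  have -> : \sum_(z <- Lam) psi z * retn G N (0 - z) = \sum_(z <- Lam) psi z * retn G N (- z).
    by apply: eq_bigr => z _; rewrite sub0r.
  ring.
have -> : f x - f 0 - (\sum_(z <- Lam) psi z) * apart G N x =
   (iter N (conv G) f x - iter N (conv G) f 0) +
   \sum_(z <- Lam) psi z * (apart G N (x - z) - apart G N x - apart G N (- z)) -
   \sum_(n < N) (iter n (conv G) rest x - iter n (conv G) rest 0).
  rewrite main; set S := \sum_(n < N) _.
  have -> : \sum_(z <- Lam) psi z * (apart G N (x - z) - apart G N x - apart G N (- z)) =
    \sum_(z <- Lam) psi z * (apart G N (x - z) - apart G N (- z)) -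
    (\sum_(z <- Lam) psi z) * apart G N x.
    by rewrite mulr_suml -sumrB; apply: eq_bigr => z _; ring.
  ring.
apply: le_trans (ler_normB _ _) _; apply: lerD; last first.
  apply: le_trans (ler_norm_sum _ _ _) _.
  have -> : 2 * N%:R * tau = \sum_(n < N) (2 * tau).
    by rewrite sumr_const card_ord -mulr_natr; ring.
  apply: ler_sum => n _; apply: le_trans (ler_normB _ _) _.
  by have := rb n x; have := rb n 0; lra.
apply: le_trans (ler_normD _ _) _; rewrite lerD2l.
apply: le_trans (ler_norm_sum _ _ _) _; rewrite mulr_sumr.
apply: ler_sum => z _; rewrite normrM mulrCA ler_wpM2l //.
have := apart_incr SG N x (- z); have := apart_le SG N (- z).
rewrite nrm1N lgN -/(lg R z) -/K => h1 h2.
apply: le_trans (ler_normB _ _) _; lra.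
Qed.

End FinitePotential.

(** * Summation over lattice rectangles *)

Section Rect.
Context (R : realType).

Definition ints (n : nat) : seq int := [seq (k%:Z - n%:Z) | k <- iota 0 (2 * n).+1].
Definition rect (n m : nat) : seq Z2 := [seq (i, j) | i <- ints n, j <- ints m].

Lemma mem_ints n (i : int) : (i \in ints n) = (`|i| <= n)%N.
Proof.
apply/mapP/idP => [[k]|H].
  by rewrite mem_iota => /andP[_ kn] ->; lia.
by exists (absz (i + n%:Z)); [rewrite mem_iota; lia|lia].
Qed.

Lemma ints_uniq n : uniq (ints n).
Proof. by rewrite map_inj_uniq ?iota_uniq // => i j /=; lia. Qed.

Lemma mem_rect n m (z : Z2) : (z \in rect n m) = (`|z.1| <= n)%N && (`|z.2| <= m)%N.
Proof.
rewrite -!mem_ints; apply/allpairsP/andP => [[[i j] /= [h1 h2 ->]]|[h1 h2]] //.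
by exists z; split=> //; case: z {h1 h2}.
Qed.

Lemma rect_uniq n m : uniq (rect n m).
Proof.
apply: allpairs_uniq; rewrite ?ints_uniq //.
by move=> [a b] [c d] _ _ [-> ->].
Qed.

Lemma sum_rect n m (F : Z2 -> R) : \sum_(z <- rect n m) F z =
  \sum_(k < (2 * n).+1) \sum_(j < (2 * m).+1) F (k%:Z - n%:Z, j%:Z - m%:Z).
Proof.
have E k : iota 0 k = index_iota 0 k by rewrite /index_iota subn0.
rewrite big_allpairs_dep big_map E big_mkord.
by apply: eq_bigr => k _; rewrite big_map E big_mkord.
Qed.

Lemma sum_subset (s t : seq Z2) (F : Z2 -> R) : uniq s -> uniq t ->
  {subset s <= t} -> (forall z, 0 <= F z) -> \sum_(z <- s) F z <= \sum_(z <- t) F z.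
Proof.
move=> us ut st F0; rewrite [leRHS](bigID (mem s) xpredT) /=.
have -> : \sum_(z <- t | z \in s) F z = \sum_(z <- s) F z.
  rewrite -big_filter; apply: perm_big; apply: uniq_perm => //.
    exact: filter_uniq.
  by move=> z; rewrite mem_filter; case: (boolP (z \in s)) => //= /st ->.
by rewrite lerDl sumr_ge0.
Qed.

End Rect.

Section VanishAverage.
Context (R : realType) (G : step_law R) (C : R) (SG : smooth G C).
Context (IgT : forall f, Ig G f).

(** Off a large box [g] is small, and the box is occupied at time [n] with probability [O(1/n)]. *)
Lemma iter_conv_vanish g B : bnd B g -> vanish g ->
  forall e, 0 < e -> exists N, forall n, (N <= n)%N -> `|iter n (conv G) g 0| <= e.
Proof.
move=> Bg Vg e e0; have B0 := bnd_ge0 Bg; have K0 := kcst_ge0 SG.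
have e2 : 0 < e / 2 by rewrite divr_gt0.
have [M HM] := Vg _ e2.
set S := rect M M; set c := B * (size S)%:R * kcst C.
have c0 : 0 <= c by rewrite !mulr_ge0.
have [N HN] := nat_gt (c / (e / 2)); exists N => n Nn.
pose h y := \sum_(z <- S) B * dirac R (y - z).
have h0 y : h y = if y \in S then B else 0.
  by rewrite /h (sum_dirac (fun=> B)) // rect_uniq.
have gh y : `|g y| <= e / 2 * 1 + 1 * h y.
  rewrite h0 !mul1r mulr1; case: ifPn => [_|].
    by apply: le_trans (Bg y) _; rewrite lerDr ltW.
  rewrite mem_rect negb_and => yS; rewrite addr0; apply: HM.
  by rewrite /nrm1; move: yS; lia.
have up : iter n (conv G) (fun y => e / 2 * 1 + 1 * h y) 0 <= e.
  rewrite (iter_convT_lin IgT (e / 2) 1 (fun=> 1)) mul1r.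
  have -> : iter n (conv G) (fun=> 1) 0 = 1 :> R.
    have : forall y, iter n (conv G) (fun=> 1) y = 1 :> R.
      elim: n {Nn} => //= n IH y; rewrite /conv.
      by under eq_fun do rewrite IH; rewrite Ex_cst.
    exact.
  rewrite (iter_conv_charge IgT (fun=> B)).
  apply: (@le_trans _ _ (e / 2 * 1 + e / 2)); last by apply: eq_ler; field.
  rewrite lerD2l; apply: (@le_trans _ _ (c / n.+1%:R)).
    rewrite /c -mulr_sumr -!mulrA ler_wpM2l //.
    have -> : (size S)%:R * (kcst C / n.+1%:R) = \sum_(z <- S) (kcst C / n.+1%:R).
      by rewrite big_const_seq count_predT iter_addr_0 mulr_natl.
    by apply: ler_sum => z _; exact: retn_le SG n _.
  rewrite ler_pdivrMr // mulrC -ler_pdivrMr //.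
  by apply: le_trans (ltW HN) _; rewrite ler_nat (leq_trans Nn).
rewrite ler_norml; apply/andP; split.
- pose k y := e / 2 * 1 + 1 * h y.
  have : iter n (conv G) (fun y => (-1) * k y + 0 * (fun=> 0) y) 0 <= iter n (conv G) g 0.
    apply: iter_convT_le => // y; have := gh y.
    by rewrite ler_norml -/(k y) => /andP[? _]; rewrite mul0r addr0 mulN1r.
  rewrite (iter_convT_lin IgT (-1) 0 k (fun=> 0)) mul0r addr0 mulN1r; apply: le_trans.
  by rewrite lerN2.
- apply: le_trans up; apply: iter_convT_le => // y.
  by apply: le_trans (gh y); exact: ler_norm.
Qed.

End VanishAverage.

(** * Riemann sums for the inverse covariance form *)

Section QuadraticForm.
Context (R : realType) (a b c : R).
Hypotheses (a_gt0 : 0 < a) (D_gt0 : 0 < a * c - b ^+ 2).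
Implicit Types (z v x : Z2) (M : R).

Let D := a * c - b ^+ 2.

(* The quadratic form of the inverse of the matrix [[a, b], [b, c]], and its
   polarization. *)
Definition bq z : R :=
  (c * z.1%:~R ^+ 2 - 2 * b * z.1%:~R * z.2%:~R + a * z.2%:~R ^+ 2) / D.
Definition bl z v : R :=
  (c * (z.1%:~R * v.1%:~R) - b * (z.1%:~R * v.2%:~R + z.2%:~R * v.1%:~R)
   + a * (z.2%:~R * v.2%:~R)) / D.

Lemma c_gt0 : 0 < c.
Proof.
have : 0 < a * c by apply: lt_le_trans D_gt0 _; rewrite gerBl sqr_ge0.
by rewrite pmulr_rgt0.
Qed.

Lemma D_neq0 : D != 0. Proof. by rewrite gt_eqF. Qed.

(** Completing the square separates the row index from the position within the row. *)
Lemma bqE z : bq z = z.1%:~R ^+ 2 / a + a / D * (z.2%:~R - b / a * z.1%:~R) ^+ 2.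
Proof.
rewrite /bq; have := D_neq0; rewrite /D => D0; field.
by rewrite gt_eqF //= D0.
Qed.

Lemma bqE' z : bq z = z.2%:~R ^+ 2 / c + c / D * (z.1%:~R - b / c * z.2%:~R) ^+ 2.
Proof.
rewrite /bq; have := D_neq0; rewrite /D => D0; field.
by rewrite gt_eqF ?c_gt0 //= D0.
Qed.

Lemma bq_ge1 z : z.1%:~R ^+ 2 <= a * bq z.
Proof.
rewrite -ler_pdivrMl // mulrC bqE lerDl mulr_ge0 ?sqr_ge0 //.
by rewrite divr_ge0 // ltW.
Qed.

Lemma bq_ge2 z : z.2%:~R ^+ 2 <= c * bq z.
Proof.
rewrite -ler_pdivrMl ?c_gt0 // mulrC bqE' lerDl mulr_ge0 ?sqr_ge0 //.
by rewrite divr_ge0 ?ltW ?c_gt0.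
Qed.

Lemma bq_ge0 z : 0 <= bq z.
Proof. by rewrite -(pmulr_rge0 _ a_gt0) (le_trans (sqr_ge0 _) (bq_ge1 z)). Qed.

Lemma nsqE z : nsq R z = (`|z.1%:~R| + `|z.2%:~R|) ^+ 2.
Proof. by rewrite /nsq /nrm1 natrD !absz_real. Qed.

Definition bq_lo := 2 * (a + c).
Definition bq_hi := (a + c + 2 * `|b|) / D.

Lemma bq_lo_gt0 : 0 < bq_lo.
Proof. by rewrite mulr_gt0 // addr_gt0 // c_gt0. Qed.

Lemma bq_lower z : nsq R z <= bq_lo * bq z.
Proof.
have h1 := bq_ge1 z; have h2 := bq_ge2 z; rewrite nsqE /bq_lo.
move: h1 h2; rewrite -(real_normK (num_real z.1%:~R)) -(real_normK (num_real z.2%:~R)).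
by have := sqr_ge0 (`|z.1%:~R : R| - `|z.2%:~R|); nra.
Qed.

Lemma bq_upper z : bq z <= bq_hi * nsq R z.
Proof.
rewrite /bq /bq_hi [leRHS]mulrAC ler_pM2r ?invr_gt0 // nsqE.
have c0 := c_gt0.
rewrite -(real_normK (num_real z.1%:~R)) -(real_normK (num_real z.2%:~R)).
set u := `|z.1%:~R|; set w := `|z.2%:~R|.
have u0 : 0 <= u := normr_ge0 _. have w0 : 0 <= w := normr_ge0 _.
have h : - (2 * b * z.1%:~R * z.2%:~R) <= 2 * `|b| * (u * w).
  apply: le_trans (ler_norm _) _; rewrite normrN !normrM normr_nat -/u -/w.
  by apply: eq_ler; ring.
have uw : 0 <= u * w by rewrite mulr_ge0.
have h2 : 0 <= `|b| := normr_ge0 b.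
have -> : (a + c + 2 * `|b|) * (u + w) ^+ 2 = c * u ^+ 2 + a * w ^+ 2 + 2 * `|b| * (u * w) +
   (a * u ^+ 2 + c * w ^+ 2 + 2 * (a + c) * (u * w) + 2 * `|b| * (u ^+ 2 + w ^+ 2 + u * w)) by ring.
have : 0 <= a * u ^+ 2 + c * w ^+ 2 + 2 * (a + c) * (u * w) + 2 * `|b| * (u ^+ 2 + w ^+ 2 + u * w).
  by rewrite !addr_ge0 ?mulr_ge0 ?addr_ge0 ?sqr_ge0 // ltW.
lra.
Qed.

(** Lagrange's identity: the defect is a square divided by the determinant. *)
Lemma bq_CS z v : bl z v ^+ 2 <= bq z * bq v.
Proof.
rewrite -subr_ge0.
have -> : bq z * bq v - bl z v ^+ 2 = (z.1%:~R * v.2%:~R - z.2%:~R * v.1%:~R) ^+ 2 / D.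
  by rewrite /bq /bl; have := D_neq0; rewrite /D => D0; field.
by rewrite divr_ge0 ?sqr_ge0 // ltW.
Qed.

Lemma bqD z v : bq (z + v) = bq z + 2 * bl z v + bq v.
Proof.
by rewrite /bq /bl /= !intrD; have := D_neq0; rewrite /D => D0; field.
Qed.

Lemma bqN v : bq (- v) = bq v.
Proof. by rewrite /bq /= !mulrNz; ring. Qed.

Lemma blN z v : bl z (- v) = - bl z v.
Proof. by rewrite /bl /= !mulrNz; ring. Qed.

Definition sM M z : R := M ^+ 2 + bq z.

Lemma sM_ge M z : 1 <= M -> M ^+ 2 <= sM M z.
Proof. by move=> M1; rewrite lerDl bq_ge0. Qed.

Lemma sM_ge1 M z : 1 <= M -> 1 <= sM M z.
Proof. by move=> M1; apply: le_trans (sM_ge z M1); exact: exprn_ege1. Qed.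

Lemma sM_gt0 M z : 1 <= M -> 0 < sM M z.
Proof. by move=> /(sM_ge1 z); apply: lt_le_trans. Qed.

(** On the row with first coordinate [k], [sM] equals [al M k ^ 2 * (1 + t ^ 2)], where [t] runs
    through a grid of mesh [g / al M k]. *)
Let g := Num.sqrt (a / D).
Let al M (k : R) := Num.sqrt (M ^+ 2 + k ^+ 2 / a).

Let g_gt0 : 0 < g. Proof. by rewrite sqrtr_gt0 divr_gt0. Qed.

Let al_ge M k : 1 <= M -> M <= al M k.
Proof.
move=> M1; rewrite -[leLHS](@ger0_norm _ M); last by lra.
by rewrite -sqrtr_sqr ler_wsqrtr // lerDl divr_ge0 ?sqr_ge0 // ltW.
Qed.

Let al_gt0 M k : 1 <= M -> 0 < al M k.
Proof. by move=> M1; have := al_ge k M1; lra. Qed.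

Lemma sM_row M (k j : int) : 1 <= M ->
  sM M (k, j) = al M k%:~R ^+ 2 * (1 + (g / al M k%:~R * (j%:~R - b / a * k%:~R)) ^+ 2).
Proof.
move=> M1; rewrite /sM bqE /=; have al0 := al_gt0 k%:~R M1.
have E : al M k%:~R ^+ 2 = M ^+ 2 + k%:~R ^+ 2 / a.
  by rewrite sqr_sqrtr // addr_ge0 ?sqr_ge0 // divr_ge0 ?sqr_ge0 // ltW.
have gE : g ^+ 2 = a / D by rewrite sqr_sqrtr // divr_ge0 // ltW.
rewrite exprMn expr_div_n gE mulrDr mulr1 {1}E addrA; congr (_ + _).
by field; rewrite (gt_eqF a_gt0) (gt_eqF al0) D_neq0.
Qed.

Lemma al_row M (k : R) : 1 <= M ->
  al M k = M * Num.sqrt (1 + ((M * Num.sqrt a)^-1 * k) ^+ 2).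
Proof.
move=> M1; have M0 : 0 < M by lra.
transitivity (Num.sqrt (M ^+ 2 * (1 + ((M * Num.sqrt a)^-1 * k) ^+ 2))).
  rewrite /al; congr (Num.sqrt _).
  rewrite exprMn exprVn exprMn sqr_sqrtr ?(ltW a_gt0) //.
  by field; rewrite !gt_eqF.
by rewrite sqrtrM ?sqr_ge0 // sqrtr_sqr ger0_norm // ltW.
Qed.

Let Nints (n k : nat) : (k%:Z - n%:Z)%:~R = - n%:R + k%:R :> R.
Proof. by rewrite intrD mulrNz addrC. Qed.

Lemma sum_al3 M n : 1 <= M ->
  \sum_(k < (2 * n).+1) (al M (k%:Z - n%:Z)%:~R ^+ 3)^-1 =
  (M ^+ 3)^-1 * \sum_(k < (2 * n).+1)
    (fun x : R => (Num.sqrt (1 + x ^+ 2) ^+ 3)^-1) ((M * Num.sqrt a)^-1 * (- n%:R + k%:R)).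
Proof.
move=> M1; rewrite mulr_sumr; apply: eq_bigr => k _.
by rewrite al_row // Nints exprMn invfM.
Qed.

Let r'_gt0 M : 1 <= M -> 0 < (M * Num.sqrt a)^-1.
Proof. by move=> M1; rewrite invr_gt0 mulr_gt0 ?sqrtr_gt0 //; lra. Qed.

Lemma sum_al3_upper M n : 1 <= M ->
  \sum_(k < (2 * n).+1) (al M (k%:Z - n%:Z)%:~R ^+ 3)^-1 <=
  (2 * Num.sqrt a + 2 / M) / M ^+ 2.
Proof.
move=> M1; have M0 : 0 < M by lra. rewrite sum_al3 //.
have sa : 0 < Num.sqrt a by rewrite sqrtr_gt0.
have := riemann_upper (- n%:R) (2 * n).+1 (@bump_32 R) (r'_gt0 M1).
rewrite mulrC ler_pdivrMr ?mulr_gt0 // mulrC => H.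
apply: le_trans (ler_wpM2l _ H) _; first by rewrite invr_ge0 exprn_ge0 // ltW.
by apply: eq_ler; field; rewrite !gt_eqF.
Qed.

Lemma sum_al4_upper M n : 1 <= M ->
  \sum_(k < (2 * n).+1) (al M (k%:Z - n%:Z)%:~R ^+ 4)^-1 <=
  (2 * Num.sqrt a + 2) / M ^+ 3.
Proof.
move=> M1; have M0 : 0 < M by lra.
apply: (@le_trans _ _ (M^-1 * \sum_(k < (2 * n).+1) (al M (k%:Z - n%:Z)%:~R ^+ 3)^-1)).
  rewrite mulr_sumr; apply: ler_sum => k _; set A := al _ _.
  have A0 : 0 < A by apply: al_gt0. have MA : M <= A by apply: al_ge.
  rewrite -invfM lef_pV2 ?posrE ?mulr_gt0 ?exprn_gt0 // [leRHS]exprS.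
  by rewrite ler_pM2r ?exprn_gt0.
apply: le_trans (ler_wpM2l _ (sum_al3_upper n M1)) _; first by rewrite invr_ge0 ltW.
have -> : (2 * Num.sqrt a + 2) / M ^+ 3 = M^-1 * ((2 * Num.sqrt a + 2) / M ^+ 2).
  by field; rewrite gt_eqF.
rewrite ler_pM2l ?invr_gt0 // ler_pM2r ?invr_gt0 ?exprn_gt0 // lerD2l.
by rewrite ler_pdivrMr //; lra.
Qed.

Let rowE M (k j : int) : 1 <= M -> (sM M (k, j) ^+ 2)^-1 =
  (al M k%:~R ^+ 4)^-1 *
  (fun x : R => ((1 + x ^+ 2) ^+ 2)^-1) (g / al M k%:~R * (j%:~R - b / a * k%:~R)).
Proof. by move=> M1; rewrite sM_row // exprMn -exprM invfM. Qed.

Let row_ge0 M k : 1 <= M -> 0 < g / al M k.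
Proof. by move=> M1; rewrite divr_gt0 // al_gt0. Qed.

Lemma row_upper M (k : int) m : 1 <= M ->
  \sum_(j < (2 * m).+1) (sM M (k, j%:Z - m%:Z) ^+ 2)^-1 <=
  pi / (2 * g) * (al M k%:~R ^+ 3)^-1 + 2 * (al M k%:~R ^+ 4)^-1.
Proof.
move=> M1; under eq_bigr => j _ do rewrite rowE // Nints.
rewrite -mulr_sumr.
have := riemann_upper (- m%:R - b / a * k%:~R) (2 * m).+1 (@bump_sq R) (row_ge0 k%:~R M1).
under eq_bigr => j _ do rewrite addrAC.
set S := \sum_(j < _) _; have A0 := al_gt0 k%:~R M1; set A := al _ _ in A0 S *.
rewrite mulrC -ler_pdivlMr ?divr_gt0 // => H.
apply: le_trans (ler_wpM2l _ H) _; first by rewrite invr_ge0 exprn_ge0 // ltW.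
by apply: eq_ler; field; rewrite !gt_eqF.
Qed.

Lemma row_lower M (k : int) (e : R) : 1 <= M -> 0 < e ->
  exists N, forall m, (N <= m)%N ->
  (pi / 2 - e) / g * (al M k%:~R ^+ 3)^-1 - 2 * (al M k%:~R ^+ 4)^-1 <=
  \sum_(j < (2 * m).+1) (sM M (k, j%:Z - m%:Z) ^+ 2)^-1.
Proof.
move=> M1 e0.
have [N HN] := riemann_lower (- (b / a * k%:~R)) (@bump_sq R) (row_ge0 k%:~R M1) e0.
exists N => m /HN; under [in X in _ -> X]eq_bigr => j _ do rewrite rowE // Nints.
rewrite -mulr_sumr.
have E (j : nat) : - (b / a * k%:~R) - m%:R + j%:R = - m%:R + j%:R - b / a * k%:~R by ring.
under eq_bigr => j _ do rewrite E.
set S := \sum_(j < _) _; have A0 := al_gt0 k%:~R M1; set A := al _ _ in A0 S *.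
rewrite [leRHS]mulrC -ler_pdivrMr ?divr_gt0 // => H.
apply: le_trans (ler_wpM2l _ H); last by rewrite invr_ge0 exprn_ge0 // ltW.
by apply: eq_ler; field; rewrite !gt_eqF.
Qed.

Let sa_g : Num.sqrt a / g = Num.sqrt D.
Proof.
rewrite /g sqrtrM ?(ltW a_gt0) // sqrtrV ?(ltW D_gt0) //.
by field; rewrite ?gt_eqF ?sqrtr_gt0.
Qed.

(** Collects, over the common denominator [M], the mesh errors of the two Riemann sums and the
    truncation errors [1 / M] of the lower bound. *)
Definition rsum_err := pi / g + (2 + pi / 2) * Num.sqrt D + 4 * Num.sqrt a + 4.

Lemma rsum_err_ge0 : 0 <= rsum_err.
Proof.
have p0 := pi_ge0 R.
have h1 : 0 <= pi / g by rewrite divr_ge0 // ltW.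
have h2 : 0 <= (2 + pi / 2) * Num.sqrt D.
  by rewrite mulr_ge0 ?sqrtr_ge0 // addr_ge0 // divr_ge0.
have h3 := sqrtr_ge0 a; rewrite /rsum_err; lra.
Qed.

(** Rows are summed first, then their totals: the two integrals combine to
    [pi / (2 g) * 2 sqrt a = pi * sqrt D]. *)
Lemma sum_sq_upper M n m : 1 <= M ->
  \sum_(z <- rect n m) (sM M z ^+ 2)^-1 <= (pi * Num.sqrt D + rsum_err / M) / M ^+ 2.
Proof.
move=> M1; have M0 : 0 < M by lra. rewrite sum_rect.
apply: (@le_trans _ _ (\sum_(k < (2 * n).+1) (pi / (2 * g) * (al M (k%:Z - n%:Z)%:~R ^+ 3)^-1 +
    2 * (al M (k%:Z - n%:Z)%:~R ^+ 4)^-1))).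
  by apply: ler_sum => k _; exact: row_upper.
rewrite big_split /= -!mulr_sumr.
have pi0 := pi_ge0 R; have sD : 0 <= Num.sqrt D := sqrtr_ge0 _.
apply: (@le_trans _ _ (pi / (2 * g) * ((2 * Num.sqrt a + 2 / M) / M ^+ 2) +
   2 * ((2 * Num.sqrt a + 2) / M ^+ 3))).
  apply: lerD; apply: ler_wpM2l => //; [|exact: sum_al3_upper|exact: sum_al4_upper].
  by rewrite divr_ge0 // mulr_ge0 // ltW.
have -> : pi / (2 * g) * ((2 * Num.sqrt a + 2 / M) / M ^+ 2) + 2 * ((2 * Num.sqrt a + 2) / M ^+ 3)
  = (pi * (Num.sqrt a / g) + (pi / g + 4 * Num.sqrt a + 4) / M) / M ^+ 2.
  by field; rewrite !gt_eqF.
rewrite sa_g ler_pM2r ?invr_gt0 ?exprn_gt0 // lerD2l ler_pM2r ?invr_gt0 // /rsum_err.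
have : 0 <= (2 + pi / 2) * Num.sqrt D by rewrite mulr_ge0 // addr_ge0 // divr_ge0.
lra.
Qed.

Lemma sum_sq_lower M : 1 <= M -> exists n m,
  (pi * Num.sqrt D - rsum_err / M) / M ^+ 2 <= \sum_(z <- rect n m) (sM M z ^+ 2)^-1.
Proof.
move=> M1; have M0 : 0 < M by lra.
have e0 : 0 < M^-1 by rewrite invr_gt0.
have sa : 0 < Num.sqrt a by rewrite sqrtr_gt0.
have [n Hn] := riemann_lower 0 (@bump_32 R) (r'_gt0 M1) e0.
have {}Hn := Hn n (leqnn n).
have L3 : ((2 - M^-1) * Num.sqrt a - 2 / M) / M ^+ 2 <=
    \sum_(k < (2 * n).+1) (al M (k%:Z - n%:Z)%:~R ^+ 3)^-1.
  rewrite sum_al3 //; move: Hn; under eq_bigr => k _ do rewrite sub0r.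
  rewrite [leRHS]mulrC -ler_pdivrMr ?invr_gt0 ?mulr_gt0 // invrK => H.
  apply: le_trans (ler_wpM2l _ H); last by rewrite invr_ge0 exprn_ge0 // ltW.
  by apply: eq_ler; field; rewrite !gt_eqF.
(* The truncation that a row needs depends on the row, so the number of rows is fixed first and a
   maximum is taken over them. *)
have [m Hm] : exists m, forall k : 'I_((2 * n).+1),
  (pi / 2 - M^-1) / g * (al M (k%:Z - n%:Z)%:~R ^+ 3)^-1 - 2 * (al M (k%:Z - n%:Z)%:~R ^+ 4)^-1 <=
  \sum_(j < (2 * m).+1) (sM M (k%:Z - n%:Z, j%:Z - m%:Z) ^+ 2)^-1.
  have /choice [f Hf] : forall k : 'I_((2 * n).+1), exists N, forall m, (N <= m)%N ->
    (pi / 2 - M^-1) / g * (al M (k%:Z - n%:Z)%:~R ^+ 3)^-1 - 2 * (al M (k%:Z - n%:Z)%:~R ^+ 4)^-1 <=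
    \sum_(j < (2 * m).+1) (sM M (k%:Z - n%:Z, j%:Z - m%:Z) ^+ 2)^-1.
    by move=> k; exact: row_lower.
  exists (\max_k f k)%N => k; apply: Hf; exact: leq_bigmax.
exists n, m; rewrite sum_rect; apply: le_trans (ler_sum _ (fun k _ => Hm k)).
rewrite sumrB -!mulr_sumr.
have pi2 : 2 <= pi :> R by exact: pi_ge2.
have M1' : M^-1 <= 1 by rewrite invf_le1.
have h1 : (pi / 2 - M^-1) / g * (((2 - M^-1) * Num.sqrt a - 2 / M) / M ^+ 2) <=
  (pi / 2 - M^-1) / g * \sum_(k < (2 * n).+1) (al M (k%:Z - n%:Z)%:~R ^+ 3)^-1.
  by apply: ler_wpM2l => //; rewrite divr_ge0 ?(ltW g_gt0) //; lra.
have h2 := sum_al4_upper n M1.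
apply: le_trans (lerD h1 (_ : - (2 * ((2 * Num.sqrt a + 2) / M ^+ 3)) <= _)); last first.
  by rewrite lerN2 ler_pM2l.
have -> : (pi / 2 - M^-1) / g * (((2 - M^-1) * Num.sqrt a - 2 / M) / M ^+ 2) -
   2 * ((2 * Num.sqrt a + 2) / M ^+ 3) =
  (pi * (Num.sqrt a / g) - (pi / g + (2 + pi / 2) * (Num.sqrt a / g) + 4 * Num.sqrt a + 4) / M +
    (Num.sqrt a / g + 2 / g) / M ^+ 2) / M ^+ 2.
  by field; rewrite !gt_eqF.
rewrite sa_g ler_pM2r ?invr_gt0 ?exprn_gt0 // /rsum_err lerDl.
by rewrite divr_ge0 ?addr_ge0 ?exprn_ge0 ?divr_ge0 // ltW.
Qed.

(** Needed to sum a charge of order [sM ^ -2] against the weight [1 + 4 lg z], whose logarithm is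
    absorbed by one factor [sqrt sM]. *)
Lemma sum_32_upper M : 1 <= M -> exists B, forall n m,
  \sum_(z <- rect n m) (Num.sqrt (sM M z) ^+ 3)^-1 <= B.
Proof.
move=> M1; have M0 : 0 < M by lra.
exists ((2 / g + 2) * ((M ^+ 2)^-1 * (2 * (pi / 2) / (M * Num.sqrt a)^-1 + 2))) => n m.
have r0 := r'_gt0 M1.
rewrite sum_rect.
apply: (@le_trans _ _ (\sum_(k < (2 * n).+1) (2 / g + 2) * (al M (k%:Z - n%:Z)%:~R ^+ 2)^-1)).
  apply: ler_sum => k _; set i := k%:Z - n%:Z.
  have A0 := al_gt0 i%:~R M1; have A1 := al_ge i%:~R M1.
  have E (j : nat) : (Num.sqrt (sM M (i, j%:Z - m%:Z)) ^+ 3)^-1 = (al M i%:~R ^+ 3)^-1 *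
    (fun x : R => (Num.sqrt (1 + x ^+ 2) ^+ 3)^-1) (g / al M i%:~R * (- m%:R - b / a * i%:~R + j%:R)).
    rewrite sM_row // sqrtrM ?sqr_ge0 // sqrtr_sqr (ger0_norm (ltW A0)) exprMn invfM.
    by rewrite Nints addrAC.
  under eq_bigr => j _ do rewrite E.
  rewrite -mulr_sumr.
  have := riemann_upper (- m%:R - b / a * i%:~R) (2 * m).+1 (@bump_32 R) (row_ge0 i%:~R M1).
  set S := \sum_(j < _) _; set A := al _ _ in A0 A1 S *.
  rewrite mulrC -ler_pdivlMr ?divr_gt0 // => H.
  apply: le_trans (ler_wpM2l _ H) _; first by rewrite invr_ge0 exprn_ge0 // ltW.
  have -> : (A ^+ 3)^-1 * ((2 * 1 + 2 * (g / A)) / (g / A)) = (2 / g + 2 / A) * (A ^+ 2)^-1.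
    by field; rewrite !gt_eqF.
  rewrite ler_pM2r ?invr_gt0 ?exprn_gt0 // lerD2l ler_pdivrMr //; lra.
rewrite -mulr_sumr ler_wpM2l ?addr_ge0 ?divr_ge0 ?(ltW g_gt0) //.
have E (k : nat) : (al M (k%:Z - n%:Z)%:~R ^+ 2)^-1 = (M ^+ 2)^-1 *
  (fun x : R => (1 + x ^+ 2)^-1) ((M * Num.sqrt a)^-1 * (- n%:R + k%:R)).
  by rewrite al_row // Nints exprMn sqr_sqrtr ?invfM // ltW // onesq_gt0.
under eq_bigr => k _ do rewrite E.
rewrite -mulr_sumr ler_wpM2l ?invr_ge0 ?exprn_ge0 ?(ltW M0) //.
have := riemann_upper (- n%:R) (2 * n).+1 (@bump_atan R) r0.
set S := \sum_(j < _) _; rewrite mulrC -ler_pdivlMr //.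
by rewrite mulrDl mulfK ?gt_eqF.
Qed.

End QuadraticForm.

(** * The logarithm as an approximate potential *)

Section ReferenceKernel.
Context (R : realType) (w0 : R) (ws : seq (R * Z2)).
Hypotheses (w0_ge0 : 0 <= w0) (ws_ge0 : forall p, p \in ws -> 0 <= p.1)
  (ws_sum1 : w0 + \sum_(p <- ws) p.1 = 1).
Context (a b c : R) (a_gt0 : 0 < a) (D_gt0 : 0 < a * c - b ^+ 2).
Hypotheses (m11 : \sum_(p <- ws) p.1 * p.2.1%:~R ^+ 2 = a)
  (m12 : \sum_(p <- ws) p.1 * (p.2.1%:~R * p.2.2%:~R) = b)
  (m22 : \sum_(p <- ws) p.1 * p.2.2%:~R ^+ 2 = c).

Let G := symlaw w0_ge0 ws_ge0 ws_sum1.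
Let Q := bq a b c.
Let S := sM a b c.
Let D := a * c - b ^+ 2.
Implicit Types (z v x : Z2) (M : R).

Let Q0 z : 0 <= Q z. Proof. exact: bq_ge0. Qed.
Let S1 M z : 1 <= M -> 1 <= S M z. Proof. exact: sM_ge1. Qed.
Let Sp M z : 1 <= M -> 0 < S M z. Proof. exact: sM_gt0. Qed.

Definition logS M z : R := ln (S M z) / 2.
Definition charge M z : R := conv G (logS M) z - logS M z.

Lemma ln1D_quad (y : R) : `|y| <= 2^-1 -> `|ln (1 + y) - y| <= 2 * y ^+ 2.
Proof.
rewrite ler_norml => /andP[y1 y2].
have p : 0 < 1 + y by lra.
have up : ln (1 + y) <= y by apply: le_ln1Dx; lra.
have lo : y - 2 * y ^+ 2 <= ln (1 + y).
  have h : ln ((1 + y)^-1) <= (1 + y)^-1 - 1.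
    have := @le_ln1Dx R ((1 + y)^-1 - 1); have -> : 1 + ((1 + y)^-1 - 1) = (1 + y)^-1 by ring.
    by apply; rewrite ltrBrDr addNr invr_gt0.
  rewrite lnV ?posrE // in h.
  have h2 : (1 + y)^-1 - 1 <= - y + 2 * y ^+ 2.
    rewrite -subr_ge0.
    have -> : - y + 2 * y ^+ 2 - ((1 + y)^-1 - 1) = y ^+ 2 * (1 + 2 * y) / (1 + y).
      by field; rewrite gt_eqF.
    by rewrite divr_ge0 ?(ltW p) // mulr_ge0 ?sqr_ge0 //; lra.
  lra.
have y20 := sqr_ge0 y.
by rewrite ler_norml; apply/andP; split; lra.
Qed.

Definition Qmax : R := \sum_(p <- ws) Q p.2.

Lemma Qmax_ge0 : 0 <= Qmax.
Proof. by apply: sumr_ge0. Qed.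

Lemma Q_le_max p : p \in ws -> Q p.2 <= Qmax.
Proof.
move=> pws; rewrite /Qmax (perm_big _ (perm_to_rem pws)) big_cons lerDl.
exact: sumr_ge0.
Qed.

(** In [log_ratio] the first term gives [2 Qmax], the last one [4 Qmax] by Cauchy-Schwarz, and the
    middle one [Qmax ^ 2], each over [S] because [S >= 1]. *)
Definition ratio_cst := 6 * Qmax + Qmax ^+ 2.

Lemma ratio_cst_ge0 : 0 <= ratio_cst.
Proof. by rewrite addr_ge0 ?mulr_ge0 ?sqr_ge0 ?Qmax_ge0. Qed.

(** [1 + log_ratio] is [S(z + v) S(z - v) / S(z)^2]; the odd powers of [v] cancel in the product. *)
Definition log_ratio M z v : R :=
  2 * Q v / S M z + Q v ^+ 2 / S M z ^+ 2 - 4 * bl a b c z v ^+ 2 / S M z ^+ 2.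

Lemma blQ z v M : bl a b c z v ^+ 2 <= S M z * Q v.
Proof.
apply: le_trans (bq_CS D_gt0 z v) _; rewrite ler_wpM2r //.
by rewrite lerDr sqr_ge0.
Qed.

Lemma log_ratio_le M z p : 1 <= M -> p \in ws ->
  `|log_ratio M z p.2| <= ratio_cst / S M z.
Proof.
move=> M1 /Q_le_max; move: (p.2) => v vQ; have s1 := S1 z M1; have s0 := Sp z M1.
have q0 := Q0 v; have h := blQ z v M; have h0 := sqr_ge0 (bl a b c z v).
rewrite /log_ratio; set s := S M z in s1 s0 h *; set q := Q v in vQ q0 h *.
set t := bl a b c z v ^+ 2 in h h0 *.
have i0 : 0 < s^-1 by rewrite invr_gt0.
have i1 : s^-1 <= 1 by rewrite invf_le1.
have E2 : (s ^+ 2)^-1 = s^-1 * s^-1 by rewrite expr2 invfM.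
have t1 : t * (s ^+ 2)^-1 <= q * s^-1.
  rewrite E2 mulrA ler_pM2r // mulrC -ler_pdivlMl ?invr_gt0 // invrK //.
have t0 : 0 <= t * (s ^+ 2)^-1 by rewrite mulr_ge0 // invr_ge0 exprn_ge0 // ltW.
have q2 : q ^+ 2 * (s ^+ 2)^-1 <= q ^+ 2 * s^-1.
  by rewrite E2 ler_wpM2l ?sqr_ge0 // ler_piMr //; exact: ltW.
have q20 : 0 <= q ^+ 2 * (s ^+ 2)^-1 by rewrite mulr_ge0 ?sqr_ge0 // invr_ge0 exprn_ge0 // ltW.
have qs : 0 <= q * s^-1 by rewrite mulr_ge0 // ltW.
have m1 : 6 * (q * s^-1) <= 6 * (Qmax * s^-1) by rewrite ler_pM2l // ler_pM2r.
have m2 : q ^+ 2 * s^-1 <= Qmax ^+ 2 * s^-1.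
  by rewrite ler_pM2r // lerXn2r ?nnegrE ?Qmax_ge0.
have -> : ratio_cst / s = 6 * (Qmax * s^-1) + Qmax ^+ 2 * s^-1 by rewrite /ratio_cst; ring.
have -> : 2 * q / s + q ^+ 2 / s ^+ 2 - 4 * t / s ^+ 2 =
  2 * (q * s^-1) + q ^+ 2 * (s ^+ 2)^-1 - 4 * (t * (s ^+ 2)^-1) by ring.
rewrite ler_norml; apply/andP; split; lra.
Qed.

Lemma log_second_diff M z v : 1 <= M ->
  (logS M (z + v) + logS M (z - v)) / 2 - logS M z = ln (1 + log_ratio M z v) / 4.
Proof.
move=> M1; have s0 := Sp z M1; have sp := Sp (z + v) M1; have sm := Sp (z - v) M1.
have E1 : S M (z + v) = S M z + 2 * bl a b c z v + Q v.
  by rewrite /S /sM bqD // !addrA.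
have E2 : S M (z - v) = S M z - 2 * bl a b c z v + Q v.
  by rewrite /S /sM bqD // blN bqN !addrA mulrN.
have -> : 1 + log_ratio M z v = S M (z + v) * S M (z - v) / S M z ^+ 2.
  by rewrite E1 E2 /log_ratio; field; rewrite gt_eqF.
rewrite /logS ln_div ?posrE ?mulr_gt0 ?exprn_gt0 // lnM ?posrE // lnXn //.
by field.
Qed.

Lemma chargeE M z : 1 <= M ->
  charge M z = \sum_(p <- ws) p.1 * (ln (1 + log_ratio M z p.2) / 4).
Proof.
move=> M1; rewrite /charge conv_symlawE.
have E : logS M z = w0 * logS M z + \sum_(p <- ws) p.1 * logS M z.
  by rewrite -mulr_suml -mulrDl ws_sum1 mul1r.
rewrite [X in _ - X]E opprD addrACA subrr add0r -sumrB; apply: eq_bigr => p _.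
by rewrite -mulrBr -log_second_diff.
Qed.

(** The trace of the covariance matrix against its inverse, that is, the dimension. *)
Lemma sum_Q : \sum_(p <- ws) p.1 * Q p.2 = 2.
Proof.
have -> : \sum_(p <- ws) p.1 * Q p.2 = c / D * a - 2 * b / D * b + a / D * c.
  rewrite -[X in c / D * X]m11 -[X in 2 * b / D * X]m12 -[X in a / D * X]m22.
  rewrite !mulr_sumr -sumrB -big_split /=; apply: eq_bigr => p _.
  by rewrite /Q /bq -/D; field; exact: D_neq0.
by rewrite /D; field; exact: D_neq0.
Qed.

(** The matrix identity [V^-1 V V^-1 = V^-1] for the covariance [V]. *)
Lemma sum_bl z : \sum_(p <- ws) p.1 * bl a b c z p.2 ^+ 2 = Q z.
Proof.
set x : R := z.1%:~R; set y : R := z.2%:~R.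
have -> : \sum_(p <- ws) p.1 * bl a b c z p.2 ^+ 2 =
   ((c * x - b * y) / D) ^+ 2 * a + 2 * ((c * x - b * y) / D) * ((a * y - b * x) / D) * b
    + ((a * y - b * x) / D) ^+ 2 * c.
  rewrite -[X in (_ ^+ 2) * X + _]m11 -[X in _ * _ * _ * X]m12 -[X in _ + (_ ^+ 2) * X]m22.
  rewrite !mulr_sumr -!big_split /=; apply: eq_bigr => p _.
  by rewrite /bl -/D -/x -/y; field; exact: D_neq0.
rewrite /Q /bq -/D -/x -/y.
have D0 : D != 0 by exact: D_neq0.
apply: (mulIf (expf_neq0 2 D0)).
have -> : ((c * x - b * y) / D) ^+ 2 * a + 2 * ((c * x - b * y) / D) * ((a * y - b * x) / D) * b
    + ((a * y - b * x) / D) ^+ 2 * c = ((c * x - b * y) ^+ 2 * a + 2 * (c * x - b * y) * (a * y - b * x) * b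
    + (a * y - b * x) ^+ 2 * c) / D ^+ 2 by field.
by rewrite mulfVK ?expf_neq0 // expr2 mulrA mulfVK // /D; ring.
Qed.

Lemma w_le1 : \sum_(p <- ws) p.1 <= 1.
Proof. by rewrite -ws_sum1 lerDr. Qed.

Definition charge_err := (2 * ratio_cst ^+ 2 + Qmax ^+ 2) / 4.

Lemma charge_err_ge0 : 0 <= charge_err.
Proof.
rewrite /charge_err; have := sqr_ge0 ratio_cst; have := sqr_ge0 Qmax; lra.
Qed.

(** The leading terms average to [1 / S - Q / S^2 = M^2 / S^2]: the order [1 / |z|^2] disappears,
    which reflects the harmonicity of the logarithm in the plane. The condition on [M] keeps the
    argument of the logarithm within [1/2] of [1]. *)
Lemma charge_approx M z : 1 <= M -> 2 * ratio_cst <= M ^+ 2 ->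
  `|charge M z - M ^+ 2 / S M z ^+ 2| <= charge_err / S M z ^+ 2.
Proof.
move=> M1 Mr; rewrite chargeE //; have s0 := Sp z M1; set s := S M z in s0 *.
have sz : s - M ^+ 2 = Q z by rewrite /s /S /sM addrC addKr.
have -> : M ^+ 2 / s ^+ 2 =
   \sum_(p <- ws) p.1 * ((log_ratio M z p.2 - Q p.2 ^+ 2 / s ^+ 2) / 4).
  have -> : \sum_(p <- ws) p.1 * ((log_ratio M z p.2 - Q p.2 ^+ 2 / s ^+ 2) / 4) =
    (2 * s)^-1 * (\sum_(p <- ws) p.1 * Q p.2) -
    (s ^+ 2)^-1 * (\sum_(p <- ws) p.1 * bl a b c z p.2 ^+ 2).
    rewrite !mulr_sumr -sumrB; apply: eq_bigr => p _.
    by rewrite /log_ratio -/s; field; rewrite gt_eqF.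
  by rewrite sum_Q sum_bl -sz; field; rewrite gt_eqF.
rewrite -sumrB; apply: le_trans (ler_norm_sum _ _ _) _.
apply: (@le_trans _ _ (\sum_(p <- ws) p.1 * (charge_err / s ^+ 2))); last first.
  rewrite -mulr_suml ler_piMl ?w_le1 // divr_ge0 ?charge_err_ge0 //.
  by rewrite exprn_ge0 // ltW.
rewrite big_seq [leRHS]big_seq; apply: ler_sum => p pws; have p0 := ws_ge0 pws.
rewrite -mulrBr normrM ger0_norm // ler_wpM2l //.
have rl := log_ratio_le z M1 pws; rewrite -/s in rl.
have half : `|log_ratio M z p.2| <= 2^-1.
  apply: le_trans rl _; rewrite ler_pdivrMr //.
  by have := sM_ge a_gt0 D_gt0 z M1; rewrite -/(S M z) -/s; lra.
have lq := ln1D_quad half.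
set y := log_ratio _ _ _ in rl half lq *.
have y2 : y ^+ 2 <= ratio_cst ^+ 2 / s ^+ 2.
  rewrite -(real_normK (num_real y)) -expr_div_n lerXn2r ?nnegrE //.
  by rewrite divr_ge0 ?ratio_cst_ge0 // ltW.
have q2 : Q p.2 ^+ 2 / s ^+ 2 <= Qmax ^+ 2 / s ^+ 2.
  by rewrite ler_pM2r ?invr_gt0 ?exprn_gt0 // lerXn2r ?nnegrE ?Qmax_ge0 ?Q_le_max.
have q0 : 0 <= Q p.2 ^+ 2 / s ^+ 2 by rewrite divr_ge0 ?sqr_ge0.
have -> : charge_err / s ^+ 2 = (2 * (ratio_cst ^+ 2 / s ^+ 2) + Qmax ^+ 2 / s ^+ 2) / 4.
  by rewrite /charge_err; ring.
move: lq; rewrite !ler_norml => /andP[l1 l2]; apply/andP; split; lra.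
Qed.

Lemma nsq_le_S M z : nsq R z <= bq_lo a c * S M z.
Proof.
apply: le_trans (bq_lower a_gt0 D_gt0 z) _.
by rewrite ler_pM2l ?(bq_lo_gt0 a_gt0 D_gt0) // lerDr sqr_ge0.
Qed.

Lemma nrm1_le_sqrtS M z : (nrm1 z)%:R <= Num.sqrt (bq_lo a c) * Num.sqrt (S M z).
Proof.
have l0 := ltW (bq_lo_gt0 a_gt0 D_gt0).
rewrite -sqrtrM // -[leLHS](@ger0_norm _ (nrm1 z)%:R) // -sqrtr_sqr ler_wsqrtr //.
exact: nsq_le_S.
Qed.

Lemma ln_sub_le (u v : R) : 0 < u -> 0 < v ->
  `|ln u - ln v| <= `|u - v| / u + `|u - v| / v.
Proof.
have half (x y : R) : 0 < x -> 0 < y -> ln x - ln y <= `|x - y| / y :> R.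
  move=> x0 y0; rewrite -ln_div ?posrE //.
  have -> : x / y = 1 + (x - y) / y by field; rewrite gt_eqF.
  apply: le_trans (le_ln1Dx _) _.
    by rewrite ltr_pdivlMr // mulN1r; lra.
  by rewrite ler_pM2r ?invr_gt0 // ler_norm.
move=> u0 v0; have h1 := half u v u0 v0; have h2 := half v u v0 u0.
rewrite distrC in h2.
have n1 : 0 <= `|u - v| / u by rewrite divr_ge0 // ltW.
have n2 : 0 <= `|u - v| / v by rewrite divr_ge0 // ltW.
by rewrite ler_norml; apply/andP; split; lra.
Qed.

Definition log_mod M x z : R := (2 * Num.sqrt (Q x) + Q x) / Num.sqrt (S M z).

(** By Cauchy-Schwarz [S] changes by at most a multiple of [sqrt S], hence its logarithm by
    [O(1 / sqrt S)]. Both end points appear because either may be the nearer to the origin. *)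
Lemma logS_incr M x z : 1 <= M ->
  `|diff x (logS M) z| <= log_mod M x z + log_mod M x (z + x).
Proof.
move=> M1; have q0 := Q0 x; set q := Num.sqrt (Q x).
have qE : q ^+ 2 = Q x by rewrite sqr_sqrtr.
have qp : 0 <= q := sqrtr_ge0 _.
have key v w (e : R) : `|e| = 1 -> S M w - S M v = 2 * bl a b c v x * e + Q x ->
    `|S M w - S M v| / S M v <= log_mod M x v.
  move=> e1 E; have s0 := Sp v M1; have s1 := S1 v M1.
  have r0 : 0 < Num.sqrt (S M v) by rewrite sqrtr_gt0.
  have rE : Num.sqrt (S M v) ^+ 2 = S M v by rewrite sqr_sqrtr // ltW.
  have r1 : 1 <= Num.sqrt (S M v) by rewrite -sqrtr1 ler_wsqrtr.
  have B : `|bl a b c v x| <= Num.sqrt (S M v) * q.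
    rewrite -sqrtr_sqr -sqrtrM ?(ltW s0) // ler_wsqrtr //; exact: blQ.
  have H : `|S M w - S M v| <= 2 * (Num.sqrt (S M v) * q) + Q x.
    rewrite E; apply: le_trans (ler_normD _ _) _.
    by rewrite (ger0_norm q0) normrM e1 mulr1 normrM normr_nat; lra.
  rewrite ler_pdivrMr // /log_mod -/q -[X in _ * X]rE.
  have -> : (2 * q + Q x) / Num.sqrt (S M v) * Num.sqrt (S M v) ^+ 2 =
    (2 * q + Q x) * Num.sqrt (S M v) by field; rewrite gt_eqF.
  apply: le_trans H _; nra.
have K1 := key z (z + x) 1 (normr1 _); have K2 := key (z + x) z (-1) _.
have L := ln_sub_le (Sp (z + x) M1) (Sp z M1).
rewrite /diff /logS -mulrBl normrM [X in _ * X]ger0_norm ?invr_ge0 // ler_pdivrMr //.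
apply: le_trans L _.
have SE : S M (z + x) - S M z = 2 * bl a b c z x * 1 + Q x.
  by rewrite /S /sM bqD // /Q; ring.
have SE' : S M z - S M (z + x) = 2 * bl a b c (z + x) x * (-1) + Q x.
  have -> : S M z = S M (z + x - x) by rewrite addrK.
  by rewrite /S /sM bqD // bqN blN /Q; ring.
have k1 := K1 SE; have k2 := K2 (normrN1 _) SE'.
rewrite distrC in k2.
have n1 : 0 <= log_mod M x z by rewrite divr_ge0 // addr_ge0 // mulr_ge0.
have n2 : 0 <= log_mod M x (z + x) by rewrite divr_ge0 // addr_ge0 // mulr_ge0.
lra.
Qed.

Lemma log_mod_vanish M x : 1 <= M -> vanish (log_mod M x).
Proof.
move=> M1 e e0; set A := 2 * Num.sqrt (Q x) + Q x; set l := Num.sqrt (bq_lo a c).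
have A0 : 0 <= A by rewrite addr_ge0 // mulr_ge0.
have l0 : 0 < l by rewrite sqrtr_gt0 (bq_lo_gt0 a_gt0 D_gt0).
have [N HN] := nat_gt (A * l / e); exists N => z Nz.
have r0 : 0 < Num.sqrt (S M z) by rewrite sqrtr_gt0 Sp.
rewrite /log_mod -/A ger0_norm ?divr_ge0 // ler_pdivrMr //.
have := nrm1_le_sqrtS M z; rewrite -/l => h.
have h2 : A * l / e <= l * Num.sqrt (S M z).
  by apply: le_trans (ltW HN) _; apply: le_trans h; rewrite ler_nat.
move: h2; rewrite ler_pdivrMr // => h2.
by rewrite -(ler_pM2l l0); lra.
Qed.

Lemma log_mod_bnd M x : 1 <= M -> bnd (2 * Num.sqrt (Q x) + Q x) (log_mod M x).
Proof.
move=> M1 z; have A0 : 0 <= 2 * Num.sqrt (Q x) + Q x by rewrite addr_ge0 // mulr_ge0.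
have r1 : 1 <= Num.sqrt (S M z) by rewrite -sqrtr1 ler_wsqrtr // S1.
by rewrite /log_mod ger0_norm ?divr_ge0 // ler_pdivrMr ?ler_peMr //; lra.
Qed.

Lemma lg_le_nrm1 z : lg R z <= (nrm1 z)%:R.
Proof. by apply: ln1D_le. Qed.

Lemma logS_lg M : 1 <= M -> exists B, forall z, `|logS M z - lg R z| <= B.
Proof.
move=> M1; set l := bq_lo a c; set h := bq_hi a b c.
have l0 : 0 < l := bq_lo_gt0 a_gt0 D_gt0.
have h0 : 0 <= h.
  rewrite /h /bq_hi divr_ge0 ?(ltW D_gt0) // !addr_ge0 ?mulr_ge0 ?normr_ge0 ?(ltW a_gt0) //.
  exact: ltW (c_gt0 a_gt0 D_gt0).
exists (ln (2 + 2 * l) + ln (M ^+ 2 + h + 1)) => z.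
have s0 := Sp z M1; have s1 := S1 z M1.
have n0 : 0 < 1 + (nrm1 z)%:R :> R by rewrite ltr_pwDl.
have A1 : 0 < 2 + 2 * l by lra.
have A2 : 0 < M ^+ 2 + h + 1 by rewrite ltr_wpDl // addr_ge0 // sqr_ge0.
have L1 : 0 <= ln (2 + 2 * l) by apply: ln_ge0; lra.
have L2 : 0 <= ln (M ^+ 2 + h + 1) by apply: ln_ge0; have := sqr_ge0 M; lra.
have E : 2 * lg R z = ln ((1 + (nrm1 z)%:R) ^+ 2) by rewrite lnXn // mulr_natl.
have N1 := nsq_le_S M z; have N2 := bq_upper a_gt0 D_gt0 z.
rewrite -/l -/h in N1 N2.
have up : 2 * lg R z <= ln (2 + 2 * l) + ln (S M z).
  rewrite E -lnM ?posrE // ler_ln ?posrE ?mulr_gt0 ?exprn_gt0 //.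
  have := sqr_ge0 ((nrm1 z)%:R - 1 : R); rewrite /nsq in N1; nra.
have lo : ln (S M z) <= ln (M ^+ 2 + h + 1) + 2 * lg R z.
  rewrite E -lnM ?posrE ?exprn_gt0 // ler_ln ?posrE ?mulr_gt0 ?exprn_gt0 //.
  rewrite /S /sM; apply: le_trans (lerD (lexx _) N2) _; rewrite /nsq.
  set m := (nrm1 z)%:R : R; have m0 : 0 <= m by rewrite /m.
  have hm : 0 <= h * m by rewrite mulr_ge0.
  have M2 := sqr_ge0 M; have Mm : 0 <= M ^+ 2 * m by rewrite mulr_ge0.
  have Mmm : 0 <= M ^+ 2 * m ^+ 2 by rewrite mulr_ge0 ?sqr_ge0.
  have m2 := sqr_ge0 m.
  have -> : (M ^+ 2 + h + 1) * (1 + m) ^+ 2 = M ^+ 2 + 2 * (M ^+ 2 * m) + M ^+ 2 * m ^+ 2 +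
    h + 2 * (h * m) + h * m ^+ 2 + (1 + 2 * m + m ^+ 2) by ring.
  lra.
rewrite /logS ler_norml; apply/andP; split; lra.
Qed.

End ReferenceKernel.

(** * Asymptotics of the reference kernel *)

Section ReferenceAsymptotics.
Context (R : realType) (w0 : R) (ws : seq (R * Z2)).
Hypotheses (w0_ge0 : 0 <= w0) (ws_ge0 : forall p, p \in ws -> 0 <= p.1)
  (ws_sum1 : w0 + \sum_(p <- ws) p.1 = 1).
Context (a b c : R) (a_gt0 : 0 < a) (D_gt0 : 0 < a * c - b ^+ 2).
Hypotheses (m11 : \sum_(p <- ws) p.1 * p.2.1%:~R ^+ 2 = a)
  (m12 : \sum_(p <- ws) p.1 * (p.2.1%:~R * p.2.2%:~R) = b)
  (m22 : \sum_(p <- ws) p.1 * p.2.2%:~R ^+ 2 = c).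

Let G := symlaw w0_ge0 ws_ge0 ws_sum1.
Context (C : R) (SG : smooth G C).
Let S := sM a b c.
Let D := a * c - b ^+ 2.
Let chg M := charge w0_ge0 ws_ge0 ws_sum1 a b c M.
Let ce := charge_err ws a b c.
Let rc := ratio_cst ws a b c.
Implicit Types (z v x : Z2) (M : R).

Let IgT (f : Z2 -> R) : Ig G f := I.

Let chg_bounds M z : 1 <= M -> 2 * rc <= M ^+ 2 ->
  (M ^+ 2 - ce) * (S M z ^+ 2)^-1 <= chg M z <= (M ^+ 2 + ce) * (S M z ^+ 2)^-1.
Proof.
move=> M1 M2.
have := charge_approx w0_ge0 ws_ge0 ws_sum1 a_gt0 D_gt0 m11 m12 m22 z M1 M2.
rewrite -/S -/ce -/(chg M) ler_norml => /andP[h1 h2].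
by rewrite mulrBl mulrDl; apply/andP; split; lra.
Qed.

(** The constant [k] is the total charge of the regularized logarithm. The conditions on [M] give
    the approximation of the charge and its nonnegativity, so that sums over growing squares are
    monotone. *)
Lemma reference_scale M : 1 <= M -> 2 * rc <= M ^+ 2 -> ce <= M ^+ 2 ->
  exists k B, `|k - pi * Num.sqrt D| <=
     (rsum_err a b c + ce * (pi * Num.sqrt D) + ce * rsum_err a b c) / M /\
   forall x, `|lg R x - k * pk G x| <= B.
Proof.
move=> M1 M2 M3; have M0 : 0 < M by lra.
have ce0 : 0 <= ce := charge_err_ge0 ws a b c.
have c0 := c_gt0 a_gt0 D_gt0.
have s0 z : 0 < S M z by apply: sM_gt0.
have s1 z : 1 <= S M z by apply: sM_ge1.
have i0 z : 0 < (S M z ^+ 2)^-1 by rewrite invr_gt0 exprn_gt0.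
have psi0 z : 0 <= chg M z.
  have /andP[h _] := chg_bounds z M1 M2; apply: le_trans h.
  by rewrite mulr_ge0 ?subr_ge0 // ltW.
pose sig n := \sum_(z <- rect n n) chg M z.
have rs n m k : (n <= k)%N -> (m <= k)%N -> {subset rect n m <= rect k k}.
  move=> nk mk z; rewrite !mem_rect => /andP[h1 h2].
  by rewrite (leq_trans h1) // (leq_trans h2).
have sig_mono : nondecreasing_seq sig.
  by move=> n m nm; apply: sum_subset; rewrite ?rect_uniq //; exact: rs.
set P := pi * Num.sqrt D; set E := rsum_err a b c.
have P0 : 0 <= P by rewrite mulr_ge0 // pi_ge0.
have iM0 : 0 < M^-1 by rewrite invr_gt0.
have iM1 : M^-1 <= 1 by rewrite invf_le1.
have E0 : 0 <= E by exact: rsum_err_ge0.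
have iM := ltW iM0; have ceP : 0 <= ce * P := mulr_ge0 ce0 P0.
have ceE : 0 <= ce * E := mulr_ge0 ce0 E0.
have ceEM : 0 <= ce * E * M^-1 := mulr_ge0 ceE iM.
have sig_up n : sig n <= P + (E + ce * P + ce * E) / M.
  apply: (@le_trans _ _ ((M ^+ 2 + ce) * \sum_(z <- rect n n) (S M z ^+ 2)^-1)).
    by rewrite mulr_sumr; apply: ler_sum => z _; have /andP[] := chg_bounds z M1 M2.
  apply: le_trans (ler_wpM2l _ (sum_sq_upper a_gt0 D_gt0 n n M1)) _.
    by rewrite addr_ge0 // sqr_ge0.
  rewrite -/D -/P -/E.
  have -> : (M ^+ 2 + ce) * ((P + E / M) / M ^+ 2) =
    P + E * M^-1 + ce * P * M^-1 * M^-1 + ce * E * M^-1 * M^-1 * M^-1.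
    by field; rewrite gt_eqF.
  have q1 : ce * P * M^-1 * M^-1 <= ce * P * M^-1.
    exact: ler_piMr (mulr_ge0 ceP iM) iM1.
  have q2 : ce * E * M^-1 * M^-1 * M^-1 <= ce * E * M^-1.
    apply: (@le_trans _ _ (ce * E * M^-1 * M^-1)).
      exact: ler_piMr (mulr_ge0 ceEM iM) iM1.
    exact: ler_piMr ceEM iM1.
  lra.
have [n1 [m1 Hlow]] := sum_sq_lower a_gt0 D_gt0 M1.
have sig_lo : P - (E + ce * P + ce * E) / M <= sig (maxn n1 m1).
  apply: (@le_trans _ _ ((M ^+ 2 - ce) * \sum_(z <- rect n1 m1) (S M z ^+ 2)^-1)); last first.
    apply: (@le_trans _ _ (\sum_(z <- rect n1 m1) chg M z)).
      by rewrite mulr_sumr; apply: ler_sum => z _; have /andP[] := chg_bounds z M1 M2.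
    by apply: sum_subset; rewrite ?rect_uniq //; apply: rs; rewrite ?leq_maxl ?leq_maxr.
  apply: le_trans (ler_wpM2l _ Hlow); last by rewrite subr_ge0.
  rewrite -/D -/P -/E.
  have -> : (M ^+ 2 - ce) * ((P - E / M) / M ^+ 2) =
    P - E * M^-1 - ce * P * M^-1 * M^-1 + ce * E * M^-1 * M^-1 * M^-1.
    by field; rewrite gt_eqF.
  have q1 : ce * P * M^-1 * M^-1 <= ce * P * M^-1.
    exact: ler_piMr (mulr_ge0 ceP iM) iM1.
  have q2 : 0 <= ce * E * M^-1 * M^-1 * M^-1 := mulr_ge0 (mulr_ge0 ceEM iM) iM.
  lra.
have sig_cvg : cvgn sig.
  apply: nondecreasing_is_cvgn => //.
  by exists (P + (E + ce * P + ce * E) / M) => _ [n _ <-]; exact: sig_up.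
set k := lim (sig @ \oo).
have k_up : k <= P + (E + ce * P + ce * E) / M.
  by apply: limr_le => //; apply: nearW => n; exact: sig_up.
have k_lo : P - (E + ce * P + ce * E) / M <= k.
  by apply: le_trans sig_lo _; exact: nondecreasing_cvgn_le.
have [B32 HB] := sum_32_upper a_gt0 D_gt0 M1.
set l := Num.sqrt (bq_lo a c).
have l0 : 0 <= l := sqrtr_ge0 _.
set K := kcst C; have K0 : 0 <= K := kcst_ge0 SG.
pose Bd := (M ^+ 2 + ce) * (1 + 4 * l) * B32.
have Mce : 0 <= M ^+ 2 + ce by rewrite addr_ge0 // sqr_ge0.
have l4 : 0 <= 1 + 4 * l by lra.
have sumB n : \sum_(z <- rect n n) `|chg M z| * (1 + 4 * lg R z) <= Bd.
  rewrite /Bd; apply: le_trans (ler_wpM2l _ (HB n n)); last first.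
    exact: mulr_ge0 Mce l4.
  rewrite mulr_sumr; apply: ler_sum => z _; rewrite ger0_norm //.
  have /andP[_ up] := chg_bounds z M1 M2.
  have r0 : 0 < Num.sqrt (S M z) by rewrite sqrtr_gt0.
  have r1 : 1 <= Num.sqrt (S M z) by rewrite -sqrtr1 ler_wsqrtr.
  have rE : Num.sqrt (S M z) ^+ 2 = S M z by rewrite sqr_sqrtr // ltW.
  have lz : 1 + 4 * lg R z <= (1 + 4 * l) * Num.sqrt (S M z).
    have := le_trans (lg_le_nrm1 R z) (nrm1_le_sqrtS a_gt0 D_gt0 M z).
    by rewrite -/l -/S; lra.
  apply: le_trans (ler_pM _ _ up lz) _ => //.
    by rewrite addr_ge0 // mulr_ge0 // lg_ge0.
  apply: eq_ler; rewrite -/S; move: rE r0; set t := Num.sqrt (S M z) => <- r0.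
  by field; rewrite gt_eqF.
have tail n z : z \notin rect n.+1 n.+1 -> `|chg M z| <= (M ^+ 2 + ce) * bq_lo a c / n.+1%:R.
  move=> zn; rewrite ger0_norm //; have /andP[_ up] := chg_bounds z M1 M2.
  apply: le_trans up _; rewrite -mulrA ler_wpM2l ?addr_ge0 ?sqr_ge0 //.
  have nz : (n.+1 <= nrm1 z)%N by move: zn; rewrite mem_rect negb_and /nrm1; clear; lia.
  have h := nsq_le_S a_gt0 D_gt0 M z; rewrite -/S in h.
  have h2 : n.+1%:R <= bq_lo a c * S M z.
    apply: le_trans h; apply: le_trans (nrm1_le_sq R z); by rewrite ler_nat.
  apply: (@le_trans _ _ (S M z)^-1).
    rewrite lef_pV2 ?posrE ?exprn_gt0 // expr2 ler_peMr //; exact: ltW.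
  rewrite ler_pdivlMr // mulrC ler_pdivrMr //.
pose f := logS a b c M.
have main x : `|f x - f 0 - k * pk G x| <= 1 + 2 * K * Bd.
  set A := 2 * Num.sqrt (bq a b c x) + bq a b c x.
  have inc z := logS_incr a_gt0 D_gt0 x z M1.
  have Bf : bnd (2 * A) (diff x f).
    move=> z; apply: le_trans (inc z) _.
    have := log_mod_bnd a_gt0 D_gt0 x M1 z; have := log_mod_bnd a_gt0 D_gt0 x M1 (z + x).
    by rewrite !ler_norml -/A => /andP[_ ?] /andP[_ ?]; lra.
  have V0 := log_mod_vanish a_gt0 D_gt0 x M1.
  have Vf : vanish (diff x f).
    apply: vanish_le (vanishD V0 (vanish_sh x V0)) _ => z.
    by apply: le_trans (inc z) _; exact: ler_norm.
  (* The increment of [f] along [x] is bounded and vanishes at infinity, so averaging removes it;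
     this is the [1] in the bound. *)
  have [N0 HN0] := iter_conv_vanish SG IgT Bf Vf ltr01.
  have iterE N : iter N (conv G) f x - iter N (conv G) f 0 = iter N (conv G) (diff x f) 0.
    have -> : diff x f = (fun z => 1 * f (z + x) + (-1) * f z).
      by apply/funext => z; rewrite /diff mul1r mulN1r.
    rewrite (iter_convT_lin IgT 1 (-1) (fun z => f (z + x)) f N).
    by rewrite (iter_conv_sh G f x N) add0r mul1r mulN1r.
  have step N : (N0 <= N)%N -> `|f x - f 0 - k * apart G N x| <= 1 + 2 * K * Bd.
    move=> N0N.
    (* The square grows while [N] is fixed, which removes the cost of the neglected charge; only
       then does [N] tend to infinity. *)
    have Hn n : `|f x - f 0 - sig n.+1 * apart G N x| <= 1 + 2 * K * Bd +
        2 * N%:R * ((M ^+ 2 + ce) * bq_lo a c / n.+1%:R).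
      have tau0 : 0 <= (M ^+ 2 + ce) * bq_lo a c / n.+1%:R.
        by rewrite divr_ge0 // mulr_ge0 ?(ltW (bq_lo_gt0 a_gt0 D_gt0)) // addr_ge0 ?sqr_ge0.
      have fchg y : conv G f y = f y + chg M y.
        by rewrite /chg /charge -/G -/f addrC subrK.
      apply: le_trans (potential_bound SG IgT N x (rect_uniq _ _) fchg (@tail n) tau0) _.
      rewrite lerD2r; apply: lerD; first by rewrite iterE; exact: HN0.
      by rewrite ler_wpM2l ?mulr_ge0.
    apply/ler_addgt0Pr => e e0.
    have H : (fun n => `|f x - f 0 - sig n * apart G N x|) @ \oo --> `|f x - f 0 - k * apart G N x|.
      apply: cvg_norm; apply: cvgB; first exact: cvg_cst.
      by apply: cvgM; [exact: sig_cvg|exact: cvg_cst].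
    set t := 2 * N%:R * ((M ^+ 2 + ce) * bq_lo a c).
    have [m Hm] := nat_gt (t / e).
    apply: (cvgr_to_le H); exists m.+1 => // -[//|n] /= mn.
    apply: le_trans (Hn n) _; rewrite lerD2l.
    have -> : 2 * N%:R * ((M ^+ 2 + ce) * bq_lo a c / n.+1%:R) = t / n.+1%:R by rewrite /t; ring.
    rewrite ler_pdivrMr // mulrC -ler_pdivrMr //; apply: le_trans (ltW Hm) _.
    by rewrite ler_nat ltnW.
  have H : (fun N => `|f x - f 0 - k * apart G N x|) @ \oo --> `|f x - f 0 - k * pk G x|.
    apply: cvg_norm; apply: cvgB; first exact: cvg_cst.
    by apply: cvgM; [exact: cvg_cst|exact: apart_cvg SG x].
  by apply: (cvgr_to_le H); exists N0.
have [B1 HB1] := logS_lg a_gt0 D_gt0 M1.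
exists k, (B1 + `|f 0| + (1 + 2 * K * Bd)); split.
  by rewrite ler_norml; apply/andP; split; lra.
move=> x; have -> : lg R x - k * pk G x = - (f x - lg R x) + f 0 + (f x - f 0 - k * pk G x) by ring.
apply: le_trans (ler_normD _ _) _; apply: lerD => //.
apply: le_trans (ler_normD _ _) _; rewrite lerD2r normrN; exact: HB1.
Qed.

Lemma lg_unbounded (B : R) : exists x, B < lg R x.
Proof.
have [n Hn] := nat_gt (expR B); exists (n%:Z, 0).
have np : 0 < n%:R :> R by apply: lt_trans Hn; exact: expR_gt0.
rewrite /lg /nrm1 /= addn0 -[X in X < _](@expRK R) ltr_ln ?posrE ?expR_gt0 //.
by apply: lt_le_trans Hn _; rewrite lerDr.
Qed.

(** Expansions at two values of [M] have the same constant because [lg] is unbounded. Lying within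
    [O(1/M)] of [pi * sqrt D] for all large [M], this constant is equal to it. *)
Lemma reference_asymptotics : exists B, forall x,
  `|lg R x - pi * Num.sqrt D * pk G x| <= B.
Proof.
set P := pi * Num.sqrt D.
have ce0 : 0 <= ce := charge_err_ge0 ws a b c.
have rc0 : 0 <= rc by apply: ratio_cst_ge0.
set Ec := rsum_err a b c + ce * P + ce * rsum_err a b c.
(* Large enough for the three conditions at once, since [M <= M ^ 2] when [M >= 1]. *)
pose M0 := 1 + 2 * rc + ce.
have good M : M0 <= M -> [/\ 1 <= M, 2 * rc <= M ^+ 2 & ce <= M ^+ 2].
  rewrite /M0 => h; have M1 : 1 <= M by lra.
  have : M <= M ^+ 2 by rewrite expr2 ler_peMr //; lra.
  by move=> h2; split; lra.
have [g1 g2 g3] := good M0 (lexx _).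
have [k [B [_ HB]]] := reference_scale g1 g2 g3.
suff -> : P = k by exists B.
have uniq k' B' : (forall x, `|lg R x - k' * pk G x| <= B') -> k' = k.
  move=> HB'; apply/eqP/negPn/negP => kk.
  have kk0 : 0 < `|k' - k| by rewrite normr_gt0 subr_eq0.
  have [x Hx] := lg_unbounded ((`|k| * B' + `|k'| * B) / `|k' - k|).
  have : `|k' - k| * lg R x <= `|k| * B' + `|k'| * B.
    rewrite -[lg R x in X in X <= _](@ger0_norm _ (lg R x)) ?lg_ge0 // -normrM.
    have -> : (k' - k) * lg R x = - (k * (lg R x - k' * pk G x)) + k' * (lg R x - k * pk G x) by ring.
    apply: le_trans (ler_normD _ _) _; rewrite normrN !normrM.
    by apply: lerD; apply: ler_wpM2l.
  by move: Hx; rewrite ltr_pdivrMr // [X in _ < X]mulrC => H1 H2; have := lt_le_trans H1 H2; rewrite ltxx.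
apply/eqP; rewrite -subr_eq0 -normr_le0 leNgt; apply/negP => d0.
have [n Hn] := nat_gt (Ec / `|P - k|).
have Mn : M0 <= M0 + n%:R by rewrite lerDl.
have [h1 h2 h3] := good _ Mn.
have [k' [B' [Hk' HB']]] := reference_scale h1 h2 h3.
rewrite (uniq _ _ HB') distrC -/P -/Ec in Hk'.
have Mp : 0 < M0 + n%:R by lra.
move: Hk'; rewrite ler_pdivlMr // leNgt => /negP; apply.
move: Hn; rewrite ltr_pdivrMr // => Hn; apply: lt_le_trans Hn _.
rewrite mulrC ler_pM2l // lerDr; lra.
Qed.

End ReferenceAsymptotics.

(** * Asymptotics of the potential kernel *)

Section Support.
Context (R : realType).
Implicit Types (L : step_law R) (f : Z2 -> R) (x v : Z2).

Definition pmf L v : R := Ex L (fun z => dirac R (z - v)).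

Lemma dirac_shift_bnd v : bnd 1 (fun z => dirac R (z - v)).
Proof. by move=> z; exact: dirac_bnd. Qed.

Lemma pmf_ge0 L v : 0 <= pmf L v.
Proof. by apply: Ex_ge0 => [|z]; [exact: Ig_bnd (dirac_shift_bnd v)|exact: dirac_ge0]. Qed.

Lemma Ex_ge_pmf L f v : Ig L f -> (forall z, 0 <= f z) -> pmf L v * f v <= Ex L f.
Proof.
move=> If f0; rewrite mulrC -(ExZ _ (Ig_bnd L (dirac_shift_bnd v))); apply: Ex_le => //.
  by apply: IgZ; exact: Ig_bnd (dirac_shift_bnd v).
move=> z; rewrite /dirac subr_eq0; case: eqP => [->|_]; first by rewrite mulr1.
by rewrite mulr0.
Qed.

(** The functional is continuous along dominated sequences and the lattice is countable: exhausting
    it in the order of [pickle] adds one point mass at a time. *)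
Lemma Ex_support L f : Ig L f -> (forall z, 0 <= f z) -> 0 < Ex L f ->
  exists v, 0 < pmf L v /\ 0 < f v.
Proof.
move=> If f0; apply: contraPP => H; apply/negP; rewrite -leNgt.
have pf v : pmf L v * f v = 0.
  apply/eqP; rewrite mulf_eq0; have [//|p0] := eqVneq (pmf L v) 0; rewrite /=.
  rewrite eq_le f0 andbT leNgt; apply/negP => fv; apply: H; exists v; split=> //.
  by rewrite lt0r p0 pmf_ge0.
pose u n z := f z * (pickle z < n)%N%:R.
have uf n z : `|u n z| <= f z.
  rewrite /u normrM normr_nat ger0_norm // ler_piMr //.
  by case: (_ < _)%N.
have Iu n : Ig L (u n) by exact: (Ig_le If).
have u0 n : Ex L (u n) = 0.
  elim: n => [|n IH].
    rewrite (_ : u 0%N = fun=> 0); first exact: Ex_cst.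
    by apply/funext => z; rewrite /u mulr0.
  case E : (unpickle n : option Z2) => [v|].
  - have [vn|vn] := eqVneq (pickle v) n; last first.
      rewrite (_ : u n.+1 = u n) //; apply/funext => z; rewrite /u ltnS leq_eqVlt.
      case: eqP => // zn; exfalso; move: E; rewrite -zn pickleK => -[zv].
      by rewrite -zv zn eqxx in vn.
    have Ev : u n.+1 = (fun z => u n z + f v * dirac R (z - v)).
      apply/funext => z; rewrite /u /dirac subr_eq0 ltnS leq_eqVlt -vn.
      rewrite (inj_eq (pcan_inj pickleK)); have [->|zv] := eqVneq z v.
        by rewrite ltnn mulr0 add0r.
      by rewrite mulr0 addr0.
    rewrite Ev ExD //; last by apply: IgZ; exact: Ig_bnd (dirac_shift_bnd v).
    by rewrite ExZ ?IH ?add0r -/(pmf L v) 1?mulrC //; exact: Ig_bnd (dirac_shift_bnd v).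
  - rewrite (_ : u n.+1 = u n) //; apply/funext => z; rewrite /u ltnS leq_eqVlt.
    by case: eqP => // zn; exfalso; move: E; rewrite -zn pickleK.
have : (fun n => Ex L (u n)) @ \oo --> Ex L f.
  apply: (Ex_cvg If uf) => z; apply/seq_cvgP => e e0; exists (pickle z).+1 => n zn.
  by rewrite /u zn mulr1 subrr normr0 ltW.
move=> H1; have : (fun n => Ex L (u n)) @ \oo --> (0 : R).
  by under eq_fun do rewrite u0; exact: cvg_cst.
by move=> H2; rewrite (cvg_unique _ H1 H2).
Qed.

(** The additive monoid generated by the support; irreducibility makes it the whole lattice. *)
Inductive reach L : Z2 -> Prop :=
| reach0 : reach L 0
| reachS v x : 0 < pmf L v -> reach L x -> reach L (v + x).

(** The sign is reversed because [retn] describes the passage from [x] to the origin. *)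
Lemma retn_reach L n x : 0 < retn L n x -> reach L (- x).
Proof.
elim: n x => [|n IH] x.
  rewrite /retn /= /dirac; case: eqP => [->|]; last by rewrite ltxx.
  by rewrite oppr0 => _; exact: reach0.
rewrite /retn /= -/(retn L n) /conv => /Ex_support[]; first exact: Ig_sh (@retn_bnd1 _ L n).
  by move=> v; exact: retn_ge0.
move=> v [pv /IH Hr]; have -> : - x = v + - (x + v) by rewrite opprD addrCA subrr addr0.
exact: reachS.
Qed.

Definition irr L := forall x, exists2 n, (0 < n)%N & 0 < retn L n x.

Lemma irr_reach L x : irr L -> reach L x.
Proof. by move=> /(_ (- x)) [n _ /retn_reach]; rewrite opprK. Qed.

(** Smoothness along single support vectors is carried along a path by additivity of directions; the
    unit vectors are obtained in this way. *)
Lemma reach_smooth L L' x : (forall v, 0 < pmf L v -> exists c, minorized L' c v) ->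
  reach L x -> exists2 C, 0 <= C & smooth_dir L' C x.
Proof.
move=> H; elim=> [|v y pv _ [C C0 S]]; first by exists 0 => //; exact: smooth_dir0.
have [c mc] := H v pv; have [c0 _] := mc.
exists (((2 * c)^-1 + 1) + C).
  by rewrite !addr_ge0 // invr_ge0 mulr_ge0 // ltW.
apply: smooth_dirD => //; move=> n f B Bf; exact: minorized_smooth mc Bf.
Qed.

Lemma smooth_weaken L C C' h : C <= C' -> smooth_dir L C h -> smooth_dir L C' h.
Proof.
move=> CC S n f B Bf x; apply: le_trans (S n f B Bf x) _.
by rewrite ler_wpM2r ?invr_ge0 // ler_wpM2r // (bnd_ge0 Bf).
Qed.

Lemma smooth_units L C C' : 0 <= C -> 0 <= C' -> smooth_dir L C e1 -> smooth_dir L C' e2 ->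
  smooth L (C + C').
Proof.
move=> C0 C'0 S1 S2; split; first exact: addr_ge0.
by move=> h [->|->]; [apply: smooth_weaken S1|apply: smooth_weaken S2]; rewrite ?lerDl ?lerDr.
Qed.

Lemma smooth_mono L C C' : C <= C' -> smooth L C -> smooth L C'.
Proof.
move=> CC [C0 S]; split; first exact: le_trans CC.
by move=> h /S; exact: smooth_weaken.
Qed.

End Support.

(** * Lazy walks *)

Section Lazy.
Context (R : realType) (L : step_law R) (ep : R) (ep0 : 0 < ep) (ep1 : ep <= 2^-1).
Implicit Types (f g : Z2 -> R).

(** The mass at the origin supplies one half of [minorized], the support of [L] the other. *)
Definition lazyEx f : R := (1 - ep) * f 0 + ep * Ex L f.

Let ep' : 0 <= 1 - ep. Proof. by move: ep0 ep1 => ? ?; lra. Qed.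

Lemma lazyEx_cst c : lazyEx (fun=> c) = c.
Proof. by rewrite /lazyEx Ex_cst; ring. Qed.

Lemma lazyExD f g : Ig L f -> Ig L g -> lazyEx (fun v => f v + g v) = lazyEx f + lazyEx g.
Proof. by move=> If Ig0; rewrite /lazyEx ExD //; ring. Qed.

Lemma lazyExZ c f : Ig L f -> lazyEx (fun v => c * f v) = c * lazyEx f.
Proof. by move=> If; rewrite /lazyEx ExZ //; ring. Qed.

Lemma lazyEx_le f g : Ig L f -> Ig L g -> (forall v, f v <= g v) -> lazyEx f <= lazyEx g.
Proof.
move=> If Ig0 fg; apply: lerD; first by rewrite ler_wpM2l.
by rewrite ler_pM2l //; exact: Ex_le.
Qed.

Lemma lazyEx_cvg (u : nat -> Z2 -> R) f g : Ig L g ->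
    (forall n v, `|u n v| <= g v) -> (forall v, u ^~ v @ \oo --> f v) ->
    (fun n => lazyEx (u n)) @ \oo --> lazyEx f.
Proof.
move=> I0 ug uf; apply: cvgD; apply: cvgM; try exact: cvg_cst; first exact: uf.
exact: Ex_cvg I0 ug uf.
Qed.

Definition lazy_law : step_law R := {|
  Ex := lazyEx; Ig := Ig L;
  Ig_cst := Ig_cst L; Ex_cst := lazyEx_cst;
  IgD := @IgD _ L; ExD := lazyExD; IgZ := @IgZ _ L; ExZ := lazyExZ;
  Ig_le := @Ig_le _ L; Ex_le := lazyEx_le; Ex_cvg := lazyEx_cvg |}.

Lemma lazy_minorized v : 0 < pmf L v -> exists c, minorized lazy_law c v.
Proof.
move=> pv; exists (Num.min (1 - ep) (ep * pmf L v)).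
have p0 : 0 < ep * pmf L v by rewrite mulr_gt0.
split; first by rewrite lt_min p0 andbT; move: ep0 ep1 => ? ?; lra.
move=> f B Bf f0 /=; rewrite /lazyEx.
have h := Ex_ge_pmf v (Ig_bnd L Bf) f0.
set c := Num.min _ _; have c1 : c <= 1 - ep by rewrite ge_min lexx.
have c2 : c <= ep * pmf L v by rewrite ge_min lexx orbT.
rewrite mulrDr; apply: lerD; first by rewrite ler_wpM2r.
apply: (@le_trans _ _ (ep * pmf L v * f v)); first by rewrite ler_wpM2r.
by rewrite -mulrA ler_pM2l.
Qed.

End Lazy.

(** * A finite law with prescribed covariance *)

Section ReferenceWeights.
Context (R : realType).

(** The rank-one part along the real direction [(1, b / p)] is carried by two neighbouring lattice
    points [(N, k)] and [(N, k + 1)] whose weighted mean lies on that line. The surplus that this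
    rounding adds to the last entry tends to [0] with [N] and is taken from the weight of [e2]; a
    small [eta] keeps both unit vectors in the support. *)
Lemma spanning_weights (a b c : R) : 0 < a -> 0 < a * c - b ^+ 2 ->
  exists W : seq (R * Z2), [/\ forall p, p \in W -> 0 <= p.1,
    (exists2 w, 0 < w & (w, e1) \in W) /\ (exists2 w, 0 < w & (w, e2) \in W),
    \sum_(p <- W) p.1 * p.2.1%:~R ^+ 2 = a,
    \sum_(p <- W) p.1 * (p.2.1%:~R * p.2.2%:~R) = b &
    \sum_(p <- W) p.1 * p.2.2%:~R ^+ 2 = c].
Proof.
move=> a0 D0; have c0 := c_gt0 a0 D0; set D := a * c - b ^+ 2 in D0.
have ac0 : 0 < a + c by lra.
(* This gives [p * r = D / 2 + eta ^ 2], so taking [eta] off both diagonal entries leaves a positive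
   definite matrix. *)
pose eta := D / (2 * (a + c)).
have eta0 : 0 < eta by rewrite divr_gt0 // mulr_gt0.
have etaE : eta * (a + c) = D / 2 by rewrite /eta; field; rewrite gt_eqF.
have etaa : eta < a.
  rewrite /eta ltr_pdivrMr ?mulr_gt0 // /D.
  have := sqr_ge0 b; have := mulr_gt0 a0 c0; have := mulr_gt0 a0 a0; nra.
set p := a - eta; have p0 : 0 < p by rewrite subr_gt0.
set r := c - eta - b ^+ 2 / p.
have r0 : 0 < r.
  have : 0 < p * r.
    have -> : p * r = a * c - b ^+ 2 - eta * (a + c) + eta ^+ 2.
      by rewrite /r /p; field; rewrite gt_eqF.
    by rewrite etaE -/D; have := sqr_ge0 eta; lra.
  by rewrite pmulr_rgt0.
have [n Hn] := nat_gt (p / r).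
set N := n.+1; have N0 : 0 < N%:R :> R by rewrite ltr0n.
have N2 : p / N%:R ^+ 2 <= r.
  rewrite ler_pdivrMr ?exprn_gt0 // mulrC -ler_pdivrMr //; apply: le_trans (ltW Hn) _.
  by rewrite -natrX ler_nat /N; nia.
set t := b / p; set k := Num.floor (t * N%:R); set l := t * N%:R - k%:~R.
have l0 : 0 <= l by rewrite subr_ge0 floor_le_tmp.
have l1 : l < 1.
  by rewrite ltrBlDl; have := floorD1_gt (t * N%:R); rewrite intrD.
have kE : k%:~R = t * N%:R - l :> R by rewrite /l; ring.
pose w3 := p * (1 - l) / N%:R ^+ 2; pose w4 := p * l / N%:R ^+ 2.
pose w2 := eta + r - p / N%:R ^+ 2 * (l * (1 - l)).
have w20 : 0 < w2.
  have h1 : 0 <= p / N%:R ^+ 2 by rewrite divr_ge0 ?exprn_ge0 // ltW.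
  have : p / N%:R ^+ 2 * (l * (1 - l)) <= p / N%:R ^+ 2.
    by rewrite ler_piMr //; nra.
  by rewrite /w2; lra.
have w30 : 0 <= w3 by rewrite divr_ge0 ?exprn_ge0 ?mulr_ge0 ?(ltW p0) ?subr_ge0 // ltW.
have w40 : 0 <= w4 by rewrite divr_ge0 ?exprn_ge0 ?mulr_ge0 // ltW.
exists [:: (eta, e1); (w2, e2); (w3, (N%:Z, k)); (w4, (N%:Z, k + 1))]; split.
- move=> q; rewrite !inE => /or4P[] /eqP -> //=; exact: ltW.
- by split; [exists eta|exists w2] => //; rewrite !inE eqxx ?orbT.
- rewrite !big_cons big_nil /= -!pmulrn.
  by rewrite /w3 /w4; rewrite expr1n expr0n /= /p; field; rewrite gt_eqF.
- rewrite !big_cons big_nil /= intrD kE -!pmulrn /w3 /w4 /t /p; field.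
  by rewrite !gt_eqF.
- rewrite !big_cons big_nil /= intrD kE /w2 /w3 /w4 /r /t /p; field.
  by rewrite !gt_eqF.
Qed.

End ReferenceWeights.

(** * Potential kernel of an irreducible centred walk *)

Section PotentialKernelTheorem.
Context (R : realType) (L : step_law R) (IL : Ig L (@nsq R)) (irrL : irr L).
Hypotheses (mean1 : Ex L (fun v => v.1%:~R) = 0) (mean2 : Ex L (fun v => v.2%:~R) = 0).

Let q11 := Ex L (fun v => v.1%:~R * v.1%:~R).
Let q12 := Ex L (fun v => v.1%:~R * v.2%:~R).
Let q22 := Ex L (fun v => v.2%:~R * v.2%:~R).

Let sqr_support (f : Z2 -> R) : Ig L (fun v => f v * f v) ->
  Ex L (fun v => f v * f v) = 0 -> forall v, 0 < pmf L v -> f v = 0.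
Proof.
move=> If E0 v pv.
have f0 z : 0 <= f z * f z by rewrite -expr2 sqr_ge0.
have := Ex_ge_pmf v If f0; rewrite E0 pmulr_rle0 // -expr2 => h.
by apply/eqP; rewrite -sqrf_eq0 eq_le h sqr_ge0.
Qed.

Lemma q11_gt0 : 0 < q11.
Proof.
rewrite lt0r; apply/andP; split; last first.
  by apply: Ex_ge0 => [|v]; [exact: Ig_v11|rewrite -expr2 sqr_ge0].
apply/eqP => E0.
have S := @sqr_support (fun v => v.1%:~R) (Ig_v11 IL) E0.
have : forall x, reach L x -> x.1%:~R = 0 :> R.
  by move=> x; elim=> // v y pv _ IH; rewrite /= intrD (S v pv) IH addr0.
move=> /(_ e1 (irr_reach e1 irrL)) /eqP; rewrite /= intr_eq0 //.
Qed.

(** Otherwise the linear form [q12 v.1 - q11 v.2] has zero second moment, so it vanishes on the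
    support and on everything reachable, whereas it is nonzero at [e2]. *)
Lemma det_gt0 : 0 < q11 * q22 - q12 ^+ 2.
Proof.
have q0 := q11_gt0.
have I11 := Ig_v11 IL; have I12 := Ig_v12 IL; have I22 := Ig_v22 IL.
pose f v : R := q12 * v.1%:~R - q11 * v.2%:~R.
have fE : (fun v => f v * f v) = (fun v => q12 ^+ 2 * (v.1%:~R * v.1%:~R) +
   - (2 * q12 * q11) * (v.1%:~R * v.2%:~R) + q11 ^+ 2 * (v.2%:~R * v.2%:~R)).
  by apply/funext => v; rewrite /f; ring.
have J1 := IgZ (q12 ^+ 2) I11; have J2 := IgZ (- (2 * q12 * q11)) I12.
have J3 := IgZ (q11 ^+ 2) I22; have J12 := IgD J1 J2.
have If : Ig L (fun v => f v * f v) by rewrite fE; exact: IgD J12 J3.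
have Ef : Ex L (fun v => f v * f v) = q11 * (q11 * q22 - q12 ^+ 2).
  by rewrite fE (ExD J12 J3) (ExD J1 J2) !ExZ // -/q11 -/q12 -/q22; ring.
have f0 z : 0 <= f z * f z by rewrite -expr2 sqr_ge0.
have : 0 <= Ex L (fun v => f v * f v) by exact: Ex_ge0.
rewrite Ef pmulr_rge0 // le0r => /orP[/eqP D0|//]; exfalso.
have S := @sqr_support f If; rewrite Ef D0 mulr0 in S.
have : forall x, reach L x -> f x = 0.
  move=> x; elim=> [|v y pv _ IH]; first by rewrite /f /= !mulr0 subrr.
  by have := S erefl v pv; move: IH; rewrite /f /= !intrD; lra.
move=> /(_ e2 (irr_reach e2 irrL)); rewrite /f /= mulr0 mulr1; lra.
Qed.

Let kap := pi * Num.sqrt (q11 * q22 - q12 ^+ 2).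

Lemma potential_kernel_exists : exists (a : Z2 -> R) (K : R),
  [/\ forall x, conv L a x = a x + dirac R x,
      forall x, Ig L (fun v => a (x + v)),
      forall x v, `|a (x + v) - a x| <= K * (1 + lg R v),
      forall v, vanish (fun x => a (x + v) - a x) &
      (forall e, 0 < e -> exists B, forall x, `|lg R x - kap * a x| <= B + e * lg R x) /\
      (Ig L (fun v => nsq R v * lg R v) -> exists B, forall x, `|lg R x - kap * a x| <= B)].
Proof.
have q0 := q11_gt0; have D0 := det_gt0.
have [W [W0 [[w1 w10 W1] [w2 w20 W2]] M11 M12 M22]] := spanning_weights q0 D0.
set sW := \sum_(p <- W) p.1.
have sW0 : 0 <= sW by rewrite /sW big_seq sumr_ge0.
(* Small enough for the lazy and the reference walk both to stay put with probability at least one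
   half. *)
pose ep := (2 * (1 + sW))^-1.
have ep0 : 0 < ep by rewrite invr_gt0; lra.
have ep1 : ep <= 2^-1 by rewrite lef_pV2 ?posrE //; lra.
have epW : ep * sW <= 2^-1.
  have -> : ep * sW = sW / (1 + sW) / 2 by rewrite /ep; field; rewrite gt_eqF //; lra.
  by rewrite -[leRHS]mul1r ler_pM2r // ler_pdivrMr ?mul1r; lra.
pose ws := [seq (ep * p.1, p.2) | p <- W].
have sumws (F : Z2 -> R) : \sum_(p <- ws) p.1 * F p.2 = ep * \sum_(p <- W) p.1 * F p.2.
  by rewrite big_map mulr_sumr; apply: eq_bigr => p _ /=; rewrite mulrA.
have ws0 p : p \in ws -> 0 <= p.1.
  by move=> /mapP[r /W0 r0 ->] /=; rewrite mulr_ge0 // ltW.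
have w00 : 0 <= 1 - ep * sW by lra.
have ws1 : (1 - ep * sW) + \sum_(p <- ws) p.1 = 1.
  by rewrite big_map -mulr_sumr -/sW subrK.
pose G := symlaw w00 ws0 ws1; pose L' := lazy_law L ep0 ep1.
have minG w h : 0 < w -> (w, h) \in W -> exists c, minorized G c h.
  move=> w0 wW; have ew : 0 < ep * w / 2 by rewrite divr_gt0 // mulr_gt0.
  exists (Num.min (1 - ep * sW) (ep * w / 2)); split.
    by rewrite lt_min ew andbT; lra.
  move=> f B Bf f0 /=; rewrite /symEx mulrDr; apply: lerD.
    by rewrite ler_wpM2r // ge_min lexx.
  have inws : (ep * w, h) \in ws by apply/mapP; exists (w, h).
  rewrite (perm_big _ (perm_to_rem inws)) big_cons /=.
  apply: (@le_trans _ _ (ep * w * ((f h + f (- h)) / 2))).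
    apply: (@le_trans _ _ (ep * w / 2 * f h)); first by rewrite ler_wpM2r // ge_min lexx orbT.
    have := f0 (- h); have : 0 < ep * w by rewrite mulr_gt0.
    nra.
  rewrite lerDl big_seq sumr_ge0 // => p pr.
  rewrite mulr_ge0 ?divr_ge0 ?addr_ge0 //; exact: (ws0 p (mem_rem pr)).
have [CG SG] : exists C, smooth G C.
  have [c1 m1] := minG _ _ w10 W1; have [c2 m2] := minG _ _ w20 W2.
  have [c10 _] := m1; have [c20 _] := m2.
  exists (((2 * c1)^-1 + 1) + ((2 * c2)^-1 + 1)); apply: smooth_units.
  - by rewrite addr_ge0 // invr_ge0 mulr_ge0 // ltW.
  - by rewrite addr_ge0 // invr_ge0 mulr_ge0 // ltW.
  - by move=> n f B Bf; exact: minorized_smooth m1 Bf.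
  - by move=> n f B Bf; exact: minorized_smooth m2 Bf.
have [CL SL] : exists C, smooth L' C.
  have lm v := @lazy_minorized R L ep ep0 ep1 v.
  have [C1 C10 S1] := reach_smooth lm (irr_reach e1 irrL).
  have [C2 C20 S2] := reach_smooth lm (irr_reach e2 irrL).
  by exists (C1 + C2); exact: smooth_units.
have CG0 : 0 <= CG by case: SG. have CL0 : 0 <= CL by case: SL.
set C := CL + CG.
have {}SG : smooth G C by apply: smooth_mono SG; rewrite /C lerDr.
have {}SL : smooth L' C by apply: smooth_mono SL; rewrite /C lerDl.
have LGC f B : bnd B f -> conv L' (conv G f) = conv G (conv L' f).
  by move=> Bf; exact: conv_symlawC Bf.
have odd0 (F : Z2 -> R) : (forall v, F (- v) = - F v) -> Ex G F = 0.
  move=> oF; rewrite /= /symEx; have F0 : F 0 = 0.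
    by have := oF 0; rewrite oppr0; lra.
  by rewrite F0 mulr0 add0r big1 // => p _; rewrite oF subrr mul0r mulr0.
have even (F : Z2 -> R) : (forall v, F (- v) = F v) -> F 0 = 0 ->
    Ex G F = ep * \sum_(p <- W) p.1 * F p.2.
  move=> eF F0; rewrite /= /symEx F0 mulr0 add0r -sumws; apply: eq_bigr => p _.
  by rewrite eF; field.
have mom : same_moments L' G.
  split; rewrite [LHS]/= /lazyEx.
  - by rewrite mean1 odd0 ?mulr0 ?addr0 // => v; rewrite /= mulrNz.
  - by rewrite mean2 odd0 ?mulr0 ?addr0 // => v; rewrite /= mulrNz.
  - rewrite even; [|by move=> v; rewrite /= !mulrNz mulrNN|by rewrite /= mulr0].
    by rewrite !mulr0 add0r -/q11 -M11; congr (_ * _); apply: eq_bigr.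
  - rewrite even; [|by move=> v; rewrite /= !mulrNz mulrNN|by rewrite /= mulr0].
    by rewrite !mulr0 add0r -/q12 -M12; congr (_ * _); apply: eq_bigr.
  - rewrite even; [|by move=> v; rewrite /= !mulrNz mulrNN|by rewrite /= mulr0].
    by rewrite !mulr0 add0r -/q22 -M22; congr (_ * _); apply: eq_bigr.
have IGn : Ig G (@nsq R) by [].
have Ilg : Ig L (lg R).
  apply: (Ig_le IL) => v; rewrite ger0_norm ?lg_ge0 //.
  apply: le_trans (nrm1_le_sq R v); exact: lg_le_nrm1.
have [B0 HB0] : exists B, forall x, `|lg R x - kap * (ep * pk G x)| <= B.
  have s11 : \sum_(p <- ws) p.1 * p.2.1%:~R ^+ 2 = ep * q11.
    by rewrite (sumws (fun v => v.1%:~R ^+ 2)) M11.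
  have s12 : \sum_(p <- ws) p.1 * (p.2.1%:~R * p.2.2%:~R) = ep * q12.
    by rewrite (sumws (fun v => v.1%:~R * v.2%:~R)) M12.
  have s22 : \sum_(p <- ws) p.1 * p.2.2%:~R ^+ 2 = ep * q22.
    by rewrite (sumws (fun v => v.2%:~R ^+ 2)) M22.
  (* The determinant scales by [ep ^ 2], hence the constant by [ep]; this is the factor restored by
     [a x := ep * pk L' x]. *)
  have eD : ep * q11 * (ep * q22) - (ep * q12) ^+ 2 = ep ^+ 2 * (q11 * q22 - q12 ^+ 2) by ring.
  have eD0 : 0 < ep * q11 * (ep * q22) - (ep * q12) ^+ 2.
    by rewrite eD mulr_gt0 // exprn_gt0.
  have [B HB] := reference_asymptotics (mulr_gt0 ep0 q0) eD0 s11 s12 s22 SG.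
  exists B => x; have := HB x; rewrite eD sqrtrM ?sqr_ge0 // sqrtr_sqr (ger0_norm (ltW ep0)).
  by rewrite /kap -!mulrA [ep * (_ * _)]mulrCA.
have kap0 : 0 <= kap by rewrite mulr_ge0 ?pi_ge0.
pose a x := ep * pk L' x.
exists a, (ep * (4 * kcst C)); split.
- move=> x; have := conv_pk SL Ilg x.
  have I1 := Ig_pk SL Ilg x.
  rewrite /a /conv /= /lazyEx addr0 (@ExZ _ L ep _ I1) => h.
  by have := congr1 (fun t => t - (1 - ep) * pk L' x) h => /= h2; lra.
- by move=> x; apply: IgZ; exact: Ig_pk SL Ilg x.
- move=> x v; rewrite /a -mulrBr normrM ger0_norm ?(ltW ep0) // -[leRHS]mulrA ler_pM2l //.
  apply: le_trans (pk_incr SL x v) _; rewrite -/(lg R v).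
  by have := kcst_ge0 SL; have := lg_ge0 R v; nra.
- move=> v; apply: vanish_le (vanishZ ep (pk_incr_vanish SL v)) _ => x.
  by rewrite /a mulrBr.
- have dist x b : `|pk L' x - pk G x| <= b -> `|lg R x - kap * a x| <= B0 + kap * ep * b.
    move=> h; rewrite /a.
    have -> : lg R x - kap * (ep * pk L' x) = (lg R x - kap * (ep * pk G x)) -
      kap * ep * (pk L' x - pk G x) by ring.
    apply: le_trans (ler_normB _ _) _; apply: lerD => //.
    have ke : 0 <= kap * ep by rewrite mulr_ge0 // ltW.
    by rewrite normrM (ger0_norm ke) ler_wpM2l.
  split.
    move=> e e0; have ke : 0 < kap * ep + 1 by rewrite ltr_wpDl // mulr_ge0 // ltW.
    have [B HB] := pk_compare_small SL SG IL IGn mom LGC (divr_gt0 e0 ke).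
    exists (B0 + kap * ep * B) => x; apply: le_trans (dist x _ (HB x)) _.
    rewrite mulrDr addrA lerD2l mulrA ler_wpM2r ?lg_ge0 //.
    rewrite mulrA ler_pdivrMr // mulrC ler_pM2l // lerDl //.
  move=> Il; have [B HB] := pk_compare_log SL SG IL IGn mom LGC Il I.
  by exists (B0 + kap * ep * B) => x; exact: dist.
Qed.

End PotentialKernelTheorem.

(** * Green function of the killed walk *)

Section KilledOperator.
Context (R : realType) (L : step_law R) (Ilg : Ig L (lg R)).
Implicit Types (f g : Z2 -> R) (b : pred Z2) (x z v : Z2).

Definition res b f z : R := if b z then f z else 0.
(** The transition operator killed on arrival outside [b]. The starting point is not tested, in
    accordance with entrance times that begin at [1]. *)
Definition kop b f := conv L (res b f).

(** At most logarithmic growth: an integrable class that contains the potential kernel and is stable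
    under shifts and restrictions. *)
Definition lgb f := exists C, forall z, `|f z| <= C * (1 + lg R z).

Lemma bnd_lgb B f : bnd B f -> lgb f.
Proof.
move=> Bf; exists B => z; apply: le_trans (Bf z) _.
by rewrite ler_peMr ?(bnd_ge0 Bf) // lerDl lg_ge0.
Qed.

Lemma lgb_lin (c d : R) f g : lgb f -> lgb g -> lgb (fun z => c * f z + d * g z).
Proof.
move=> [C HC] [C' HC']; exists (`|c| * C + `|d| * C') => z.
apply: le_trans (ler_normD _ _) _; rewrite !normrM mulrDl -!mulrA.
by apply: lerD; apply: ler_wpM2l.
Qed.

Lemma lgbD f g : lgb f -> lgb g -> lgb (fun z => f z + g z).
Proof.
move=> F G; have := lgb_lin 1 1 F G; congr lgb.
by apply/funext => z; rewrite !mul1r.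
Qed.

Lemma lgbZ c f : lgb f -> lgb (fun z => c * f z).
Proof.
move=> F; have := lgb_lin c 0 F F; congr lgb.
by apply/funext => z; rewrite mul0r addr0.
Qed.

Lemma lgb_res b f : lgb f -> lgb (res b f).
Proof.
move=> [C HC]; exists C => z; rewrite /res; case: ifP => // _.
by rewrite normr0; apply: le_trans (HC z).
Qed.

Lemma lgb_sum (s : seq Z2) (F : Z2 -> Z2 -> R) : (forall y, lgb (F y)) ->
  lgb (fun z => \sum_(y <- s) F y z).
Proof.
move=> HF; elim: s => [|y s IH].
  by exists 0 => z; rewrite big_nil normr0 mul0r.
have := lgbD (HF y) IH; congr lgb; apply/funext => z; by rewrite big_cons.
Qed.

Lemma lgb_sh f x : lgb f -> lgb (fun z => f (z + x)).
Proof.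
move=> [C HC]; exists (C * (1 + lg R x)) => z; apply: le_trans (HC _) _.
have C0 : 0 <= C.
  by have := le_trans (normr_ge0 _) (HC 0); rewrite /lg nrm1_0 addr0 ln1 addr0 mulr1.
rewrite -mulrA ler_wpM2l //; have := lgD R z x; have := lg_ge0 R z; have := lg_ge0 R x.
by move=> h1 h2 h3; have := mulr_ge0 h1 h2; lra.
Qed.

Lemma Ig_lgb f x : lgb f -> Ig L (fun v => f (x + v)).
Proof.
move=> /(lgb_sh x) [C HC]; apply: (@Ig_le _ L _ (fun v => C + C * lg R v)).
  by apply: IgD; [exact: Ig_cst|exact: IgZ].
by move=> v; have := HC v; rewrite addrC mulrDr mulr1.
Qed.

Lemma conv_lgb_lin (c d : R) f g x : lgb f -> lgb g ->
  conv L (fun z => c * f z + d * g z) x = c * conv L f x + d * conv L g x.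
Proof.
move=> F G; have I1 := Ig_lgb x F; have I2 := Ig_lgb x G.
by rewrite /conv ExD ?ExZ //; exact: IgZ.
Qed.

Lemma conv_lgbD f g x : lgb f -> lgb g ->
  conv L (fun z => f z + g z) x = conv L f x + conv L g x.
Proof. by move=> F G; rewrite /conv ExD //; exact: Ig_lgb. Qed.

Lemma conv_lgbZ c f x : lgb f -> conv L (fun z => c * f z) x = c * conv L f x.
Proof. by move=> F; rewrite /conv ExZ //; exact: Ig_lgb. Qed.

Lemma conv_lgb_sum (s : seq Z2) (F : Z2 -> Z2 -> R) x : (forall y, lgb (F y)) ->
  conv L (fun z => \sum_(y <- s) F y z) x = \sum_(y <- s) conv L (F y) x.
Proof.
move=> HF; elim: s => [|y s IH].
  rewrite big_nil /conv; under eq_fun do rewrite big_nil; exact: Ex_cst.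
rewrite big_cons -IH -conv_lgbD //; last exact: lgb_sum.
by congr (conv L _ x); apply/funext => z; rewrite big_cons.
Qed.

Lemma conv_lgb_le f g x : lgb f -> lgb g -> (forall z, f z <= g z) ->
  conv L f x <= conv L g x.
Proof. by move=> F G fg; apply: Ex_le => //; exact: Ig_lgb. Qed.

Lemma conv_lgb_ge0 f x : lgb f -> (forall z, 0 <= f z) -> 0 <= conv L f x.
Proof. by move=> F f0; apply: Ex_ge0 => //; exact: Ig_lgb. Qed.

Lemma res_le b f g : (forall z, b z -> f z <= g z) -> forall z, res b f z <= res b g z.
Proof. by move=> fg z; rewrite /res; case: ifP => // /fg. Qed.

Lemma kop_le b f g x : lgb f -> lgb g -> (forall z, b z -> f z <= g z) ->
  kop b f x <= kop b g x.
Proof.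
by move=> F G fg; apply: conv_lgb_le; [exact: lgb_res|exact: lgb_res|exact: res_le].
Qed.

Lemma kop_lin b (c d : R) f g x : lgb f -> lgb g ->
  kop b (fun z => c * f z + d * g z) x = c * kop b f x + d * kop b g x.
Proof.
move=> F G; rewrite /kop -conv_lgb_lin; [|exact: lgb_res|exact: lgb_res].
congr (conv L _ x); apply/funext => z; rewrite /res; case: ifP => // _.
by rewrite !mulr0 addr0.
Qed.

Lemma kop_ge0 b f x : lgb f -> (forall z, 0 <= f z) -> 0 <= kop b f x.
Proof.
by move=> F f0; apply: conv_lgb_ge0 => [|z]; [exact: lgb_res|rewrite /res; case: ifP].
Qed.

Lemma bnd_res b B f : bnd B f -> bnd B (res b f).
Proof.
move=> Bf z; rewrite /res; case: ifP => // _; rewrite normr0; exact: bnd_ge0 Bf.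
Qed.

Lemma kop_bnd b B f : bnd B f -> bnd B (kop b f).
Proof. by move=> Bf; apply: conv_bnd; exact: bnd_res. Qed.

Lemma iter_kop_bnd b B f n : bnd B f -> bnd B (iter n (kop b) f).
Proof. by move=> Bf; elim: n => //= n; exact: kop_bnd. Qed.

Lemma iter_kop_ge0 b B f n x : bnd B f -> (forall z, 0 <= f z) -> 0 <= iter n (kop b) f x.
Proof.
move=> Bf f0; elim: n x => //= n IH x.
by apply: kop_ge0 IH; exact: bnd_lgb (iter_kop_bnd b n Bf).
Qed.

Lemma iter_kop_lin b (c d : R) B B' f g n : bnd B f -> bnd B' g ->
  iter n (kop b) (fun z => c * f z + d * g z) =
  fun z => c * iter n (kop b) f z + d * iter n (kop b) g z.
Proof.
move=> Bf Bg; elim: n => //= n ->; apply/funext => x.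
by rewrite kop_lin //; [exact: bnd_lgb (iter_kop_bnd b n Bf)|exact: bnd_lgb (iter_kop_bnd b n Bg)].
Qed.

Lemma iter_kop_le b B B' f g n x : bnd B f -> bnd B' g -> (forall z, f z <= g z) ->
  iter n (kop b) f x <= iter n (kop b) g x.
Proof.
move=> Bf Bg fg; elim: n x => //= n IH x; apply: kop_le => //.
  exact: bnd_lgb (iter_kop_bnd b n Bf). exact: bnd_lgb (iter_kop_bnd b n Bg).
Qed.

Definition surv b n := iter n (kop b) (fun=> 1 : R).

Lemma cst_bnd (c : R) : bnd `|c| (fun=> c : R). Proof. by []. Qed.

Lemma one_bnd : bnd 1 (fun=> 1 : R). Proof. by move=> z; rewrite normr1. Qed.

Lemma surv_bnd b n : bnd 1 (surv b n).
Proof. exact: iter_kop_bnd one_bnd. Qed.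

Lemma surv_ge0 b n x : 0 <= surv b n x.
Proof. by apply: iter_kop_ge0 one_bnd _. Qed.

Lemma iter_kop_surv b B f n x : bnd B f -> `|iter n (kop b) f x| <= B * surv b n x.
Proof.
move=> Bf; have B0 := bnd_ge0 Bf.
have E (s : R) : iter n (kop b) (fun z => s * B * 1 + 0 * 1) x = s * B * surv b n x.
  by rewrite (iter_kop_lin b (s * B) 0 n one_bnd one_bnd) mul0r addr0.
have Bs (s : R) : bnd (`|s * B| * 1 + `|0 : R| * 1) (fun z : Z2 => s * B * 1 + 0 * 1).
  exact: (bnd_lin (s * B) 0 one_bnd one_bnd).
rewrite ler_norml; apply/andP; split.
- have -> : - (B * surv b n x) = -1 * B * surv b n x by ring.
  rewrite -(E (-1)).
  apply: (iter_kop_le _ _ _ (Bs _) Bf) => z; have := Bf z.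
  by rewrite ler_norml => /andP[]; lra.
- have -> : B * surv b n x = 1 * B * surv b n x by ring.
  rewrite -(E 1).
  apply: (iter_kop_le _ _ _ Bf (Bs _)) => z; have := Bf z.
  by rewrite ler_norml => /andP[]; lra.
Qed.

Lemma surv_decr b n x : surv b n.+1 x <= surv b n x.
Proof.
rewrite /surv iterSr; apply: (iter_kop_le _ _ _ (kop_bnd b one_bnd) one_bnd) => z.
by have := kop_bnd b one_bnd z; rewrite ler_norml => /andP[].
Qed.

(** A sum of [n] iterates written as a first-step recursion, the form that suits inductions over all
    starting points at once. *)
Fixpoint psum b phi n : Z2 -> R :=
  if n is n'.+1 then (fun z => phi z + kop b (psum b phi n') z) else (fun=> 0).

Lemma psum_bnd b B phi n : bnd B phi -> bnd (n%:R * B) (psum b phi n).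
Proof.
move=> Bp; elim: n => [|n IH] z /=; first by rewrite mul0r normr0.
apply: le_trans (ler_normD _ _) _; rewrite -natr1 mulrDl mul1r addrC.
by apply: lerD; [exact: kop_bnd IH z|exact: Bp].
Qed.

Lemma psumE b B phi n x : bnd B phi ->
  psum b phi n x = \sum_(k < n) iter k (kop b) phi x.
Proof.
move=> Bp; elim: n x => [|n IH] x; first by rewrite big_ord0.
rewrite big_ord_recl /=; congr (_ + _).
have S m y : \sum_(k < m) iter k.+1 (kop b) phi y = kop b (fun z => \sum_(k < m) iter k (kop b) phi z) y.
  have Bs k : bnd (k%:R * B) (fun z => \sum_(i < k) iter i (kop b) phi z).
    elim: k => [|k IHk] z; first by rewrite big_ord0 normr0 mul0r.
    rewrite big_ord_recr /=; apply: le_trans (ler_normD _ _) _.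
    by rewrite -natr1 mulrDl mul1r; apply: lerD; [exact: IHk|exact: iter_kop_bnd].
  elim: m => [|m IHm].
    rewrite big_ord0 /kop /conv (_ : (fun _ => _) = fun=> 0) ?Ex_cst //.
    by apply/funext => v; rewrite /res big_ord0; case: ifP.
  rewrite big_ord_recr /= IHm.
  have := kop_lin b 1 1 y (bnd_lgb (Bs m)) (bnd_lgb (iter_kop_bnd b m Bp)).
  rewrite !mul1r => <-; congr (kop b _ y); apply/funext => z.
  by rewrite big_ord_recr /= !mul1r.
rewrite S; congr (kop b _ x); apply/funext => z; exact: IH.
Qed.

End KilledOperator.

(** * Maximum principle *)

Section MaximumPrinciple.
Context (R : realType) (L : step_law R) (irrL : irr L).
Implicit Types (w : Z2 -> R) (A : seq Z2).

Lemma seq_argmax (s : seq Z2) w x : x \in s -> exists2 y, y \in s & forall z, z \in s -> w z <= w y.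
Proof.
elim: s x => // y s IH x _; case: s IH => [|z s] IH.
  by exists y; rewrite ?inE // => z; rewrite inE => /eqP ->.
have [|m ms Hm] := IH z; first by rewrite inE eqxx.
have [h|h] := leP (w m) (w y).
  exists y; first by rewrite inE eqxx.
  by move=> t; rewrite inE => /predU1P[-> //|/Hm /le_trans]; apply.
exists m; first by rewrite inE ms orbT.
by move=> t; rewrite inE => /predU1P[->|/Hm //]; exact: ltW.
Qed.

(** A positive value would give a maximum on a finite box. Subharmonicity spreads it along the
    support, through points that are off [A] because [w] is positive there, up to a point of [A]: a
    contradiction. *)
Lemma maximum_principle A w : A != [::] ->
  (forall x, Ig L (fun v => w (x + v))) ->
  (forall x, x \notin A -> w x <= conv L w x) -> (forall x, x \in A -> w x <= 0) ->
  (exists M, forall x, (M <= nrm1 x)%N -> w x <= 0) ->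
  forall x, w x <= 0.
Proof.
move=> A0 Iw sub bdy [M far] x0; rewrite leNgt; apply/negP => w0.
have posr x : 0 < w x -> x \in rect M M.
  move=> wx; rewrite mem_rect; apply/negPn/negP => xn.
  have : (M <= nrm1 x)%N by move: xn; rewrite negb_and /nrm1; clear; lia.
  by move/far; rewrite leNgt wx.
have [x1 x1r Hx1] := seq_argmax w (posr _ w0).
have m0 : 0 < w x1 := lt_le_trans w0 (Hx1 _ (posr _ w0)).
have wm x : w x <= w x1.
  have [wx|/le_trans] := ltP 0 (w x); first by apply: Hx1; exact: posr.
  by apply; exact: ltW.
have prop z : reach L z -> forall x, w x = w x1 -> w (x + z) = w x1.
  elim=> [|v y pv _ IH] x wx; first by rewrite addr0.
  rewrite addrA; apply: IH.
  have xA : x \notin A by apply/negP => /bdy; rewrite wx leNgt m0.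
  have If : Ig L (fun v => w x1 - w (x + v)) by apply: IgB => //; exact: Ig_cst.
  have f0 z0 : 0 <= w x1 - w (x + z0) by rewrite subr_ge0.
  have := Ex_ge_pmf v If f0; rewrite ExB ?Ex_cst //; last exact: Ig_cst.
  move=> h; have := sub x xA; rewrite wx /conv => h2.
  have : pmf L v * (w x1 - w (x + v)) <= 0 by apply: le_trans h _; rewrite subr_le0.
  rewrite pmulr_rle0 // subr_le0 => h3; apply/eqP; rewrite eq_le h3 andbT; exact: wm.
case: A A0 sub bdy prop => // xi A _ sub bdy prop.
have := prop _ (irr_reach (xi - x1) irrL) x1 erefl.
rewrite addrC subrK => E; have := bdy xi; rewrite inE eqxx => /(_ isT).
by rewrite E leNgt m0.
Qed.

End MaximumPrinciple.

(** * Recurrence, hitting distribution and Green function *)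

Section Recurrence.
Context (R : realType) (L : step_law R) (Ilg : Ig L (lg R)) (irrL : irr L).
Context (A : seq Z2) (uA : uniq A) (xi0 : Z2) (xi0A : xi0 \in A).
Context (a : Z2 -> R) (K kap : R) (kap0 : 0 < kap).
Hypotheses (Ha : forall x, conv L a x = a x + dirac R x)
  (Hincr : forall x v, `|a (x + v) - a x| <= K * (1 + lg R v))
  (Hvan : forall v, vanish (fun x => a (x + v) - a x))
  (Hlg : forall e, 0 < e -> exists B, forall x, `|lg R x - kap * a x| <= B + e * lg R x).
Implicit Types (x y z xi : Z2).

Let off z := z \notin A.
Let Kop := kop L off.
(** Centring the kernel at a point of [A] places its charge inside [A], so [a0] is harmonic off
    [A]. *)
Let a0 x := a (x - xi0).

Let A0 : A != [::]. Proof. by case: A xi0A. Qed.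

Lemma a_lgb : lgb a.
Proof.
have K0 : 0 <= K.
  have := le_trans (normr_ge0 _) (Hincr 0 0).
  by rewrite /lg nrm1_0 addr0 ln1 addr0 mulr1.
exists (`|a 0| + K) => z; have := Hincr 0 z; rewrite add0r => h.
have l0 := lg_ge0 R z; have n0 := normr_ge0 (a 0).
have -> : a z = (a z - a 0) + a 0 by rewrite subrK.
apply: le_trans (ler_normD _ _) _.
have := mulr_ge0 n0 l0; lra.
Qed.

Lemma a0_lgb : lgb a0. Proof. exact: lgb_sh a_lgb. Qed.

Lemma conv_a0 y x : conv L (fun z => a (z - y)) x = a (x - y) + dirac R (x - y).
Proof. by rewrite -Ha (conv_sh L a (- y)). Qed.

Lemma a_bounded_below : exists c, forall x, 0 <= a x + c.
Proof.
have [B HB] := Hlg (divr_gt0 ltr01 (ltr0n R 2) : 0 < 1 / 2).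
exists (B / kap) => x; have := HB x; rewrite ler_norml => /andP[_ h].
have l0 := lg_ge0 R x.
have : 0 <= kap * (a x + B / kap) by rewrite mulrDr mulrCA divff ?gt_eqF // mulr1; lra.
by rewrite pmulr_rge0.
Qed.

Lemma a_infty (T : R) : exists M, forall x, (M <= nrm1 x)%N -> T <= a x.
Proof.
have [B HB] := Hlg (divr_gt0 ltr01 (ltr0n R 2) : 0 < 1 / 2).
have [M HM] := nat_gt (expR (2 * (kap * T + B))); exists M => x Mx.
rewrite -(ler_pM2l kap0); have := HB x; rewrite ler_norml => /andP[_ h].
have : 2 * (kap * T + B) <= lg R x; last by lra.
rewrite -[leLHS]expRK /lg ler_ln ?posrE ?expR_gt0 ?ltr_pwDl //.
apply: le_trans (ltW HM) _; apply: (@le_trans _ _ (nrm1 x)%:R); first by rewrite ler_nat.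
by rewrite lerDr.
Qed.

Lemma far_sh M y : exists M', forall x, (M' <= nrm1 x)%N -> (M <= nrm1 (x - y)%R)%N.
Proof.
exists (M + nrm1 y)%N => x; have := nrm1D (x - y) y; rewrite subrK; lia.
Qed.

Let survlim x := lim ((fun n => surv L off n x) @ \oo).

Let surv_cvg x : (fun n => surv L off n x) @ \oo --> survlim x.
Proof.
apply: nonincreasing_is_cvgn.
  by apply/nonincreasing_seqP => n; exact: surv_decr.
by exists 0 => _ [n _ <-]; exact: surv_ge0.
Qed.

Let survlim_bnd : bnd 1 survlim.
Proof.
move=> x; have H : (fun n => `|surv L off n x|) @ \oo --> `|survlim x|.
  by apply: cvg_norm; exact: surv_cvg.
by apply: (cvgr_to_le H); apply: nearW => n; exact: surv_bnd.
Qed.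

Let survlim_fix x : survlim x = Kop survlim x.
Proof.
have H1 : (fun n => surv L off n.+1 x) @ \oo --> survlim x.
  by rewrite (cvg_shiftS (fun n => surv L off n x)); exact: surv_cvg.
have H2 : (fun n => surv L off n.+1 x) @ \oo --> Kop survlim x.
  rewrite /surv /=; apply: (@Ex_cvg _ L _ _ (fun=> 1) (Ig_cst L 1)).
    by move=> n v; apply: bnd_res; exact: surv_bnd.
  move=> v; rewrite /res; case: ifP => _; [exact: surv_cvg|exact: cvg_cst].
exact: cvg_unique H1 H2.
Qed.

(** The limit of the survival probabilities is bounded and harmonic for the killed walk; every small
    multiple of [a0 + c], which tends to infinity, dominates it by the maximum principle. *)
Lemma surv_cvg0 x : (fun n => surv L off n x) @ \oo --> (0 : R).
Proof.
suff E y : y \notin A -> survlim y = 0.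
  have := @surv_cvg x; suff -> : survlim x = 0 by [].
  rewrite survlim_fix /Kop /kop /conv (_ : (fun _ => _) = fun=> 0) ?Ex_cst //.
  by apply/funext => v; rewrite /res /off; case: ifP => // /E.
move=> yA; have [c Hc] := a_bounded_below.
have sl0 z : 0 <= survlim z.
  by apply: (cvgr_to_ge (@surv_cvg z)); apply: nearW => n; exact: surv_ge0.
have key e : 0 < e -> survlim y <= e * (a0 y + c).
  move=> e0; pose w z := 1 * res off survlim z + (- e) * (a0 z + c).
  have lc : lgb (fun z => a0 z + c).
    by apply: lgbD; [exact: a0_lgb|exact: bnd_lgb (@cst_bnd R c)].
  have ls : lgb survlim := bnd_lgb survlim_bnd.
  have lw : lgb w by apply: lgb_lin => //; exact: lgb_res.
  suff : w y <= 0 by rewrite /w /res /off yA mul1r mulNr subr_le0.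
  apply: (maximum_principle irrL A0).
  - by move=> x0; exact: Ig_lgb.
  - move=> z zA; rewrite /w conv_lgb_lin //; last exact: lgb_res.
    rewrite conv_lgbD //; [|exact: a0_lgb|exact: bnd_lgb (@cst_bnd R c)].
    have kE : conv L (res off survlim) z = survlim z := esym (survlim_fix z).
    have cE : conv L (fun=> c) z = c := Ex_cst L c.
    rewrite kE cE /a0 conv_a0 -/(a0 z) /res /off zA /dirac subr_eq0.
    case: eqP => [zx|_]; first by rewrite zx xi0A in zA.
    by rewrite addr0.
  - move=> z zA; rewrite /w /res /off zA /= mulr0 add0r mulNr oppr_le0.
    by rewrite mulr_ge0 ?(ltW e0) // Hc.
  - have [M HM] := a_infty (e^-1 - c); have [M' HM'] := far_sh M xi0.
    exists M' => z /HM' /HM h; rewrite /w mul1r mulNr subr_le0.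
    apply: (@le_trans _ _ 1).
      by have := bnd_res off survlim_bnd z; rewrite ler_norml => /andP[].
    by rewrite mulrC -ler_pdivrMr // div1r -lerBlDr.
apply/eqP; rewrite eq_le sl0 andbT; apply/ler_addgt0Pr => e e0; rewrite add0r.
have d0 : 0 < e / (a0 y + c + 1) by rewrite divr_gt0 // ltr_wpDl // Hc.
apply: le_trans (key _ d0) _; rewrite mulrAC ler_pdivrMr ?ltr_wpDl ?Hc //.
by rewrite ler_pM2l // lerDl.
Qed.

Lemma iter_kop_cvg0 B f x : bnd B f -> (fun n => iter n Kop f x) @ \oo --> (0 : R).
Proof.
move=> Bf; apply/seq_cvgP => e e0; have B0 := bnd_ge0 Bf.
have d0 : 0 < e / (B + 1) by rewrite divr_gt0 // ltr_wpDl.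
have /seq_cvgP /(_ _ d0) [N HN] := surv_cvg0 x.
exists N => n /HN; rewrite !subr0 => h.
apply: le_trans (iter_kop_surv Ilg off n x Bf) _.
apply: (@le_trans _ _ (B * (e / (B + 1)))).
  by rewrite ler_wpM2l //; apply: le_trans h; exact: ler_norm.
by rewrite mulrCA ger_pMr // ler_pdivrMr ?ltr_wpDl // mul1r lerDl.
Qed.

(* [hit xi x] is the probability that the first visit to [A] at a positive time
   is at [xi]. *)
Definition hitn xi n := psum L off (conv L (fun z => dirac R (z - xi))) n.
Definition hit xi x : R := lim ((fun n => hitn xi n x) @ \oo).

Let dsh xi : bnd 1 (fun z => dirac R (z - xi)) := @dirac_shift_bnd R xi.

Let cdsh xi : bnd 1 (conv L (fun z => dirac R (z - xi))).
Proof. exact: conv_bnd. Qed.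

Let iter_ge0 xi n x : 0 <= iter n Kop (conv L (fun z => dirac R (z - xi))) x.
Proof.
apply: (iter_kop_ge0 Ilg _ _ _ (cdsh xi)) => z.
by apply: (conv_ge0 L (dsh xi)) => t; exact: dirac_ge0.
Qed.

Lemma sum_hitn n x : \sum_(xi <- A) hitn xi n x = 1 - surv L off n x.
Proof.
elim: n x => [|n IH] x.
  by rewrite /hitn /= big1 // /surv /= subrr.
rewrite /hitn /= big_split /=.
have -> : \sum_(xi <- A) conv L (fun z => dirac R (z - xi)) x = 1 - kop L off (fun=> 1) x.
  rewrite -(conv_lgb_sum Ilg); last by move=> xi; exact: bnd_lgb (dsh xi).
  have I1 : Ig L (fun=> 1 : R) := Ig_cst L 1.
  have I2 := @Ig_sh _ L _ _ x (bnd_res off (@one_bnd R)).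
  transitivity (Ex L (fun v => 1 - res off (fun=> 1) (x + v))).
    2: by rewrite (ExB I1 I2) Ex_cst.
  congr (Ex L _); apply/funext => v.
  transitivity (\sum_(xi <- A) (1 : R) * dirac R (x + v - xi)).
    by apply: eq_bigr => xi _; rewrite mul1r.
  rewrite (sum_dirac (fun=> 1) (x + v) uA) /res /off.
  by case: (_ \in _); rewrite ?subrr ?subr0.
have -> : \sum_(xi <- A) kop L off (psum L off (conv L (fun z => dirac R (z - xi))) n) x =
   kop L off (fun z => 1 * 1 + (-1) * surv L off n z) x.
  have E : kop L off (fun z => 1 * 1 + (-1) * surv L off n z) x =
     conv L (fun z => \sum_(xi <- A) res off (hitn xi n) z) x.
    rewrite /kop; congr (conv L _ x); apply/funext => z; rewrite /res.
    case: ifP => _; last by rewrite big1.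
    by rewrite IH mul1r mulN1r.
  rewrite E (conv_lgb_sum Ilg) // => xi; apply: lgb_res.
  exact: bnd_lgb (psum_bnd L off n (cdsh xi)).
rewrite kop_lin //; [|exact: bnd_lgb (@one_bnd R)|exact: bnd_lgb (surv_bnd L off n)].
by rewrite /surv /= mul1r mulN1r; ring.
Qed.

Lemma hitn_ge0 xi n x : 0 <= hitn xi n x.
Proof. by rewrite /hitn (psumE Ilg _ _ _ (cdsh xi)) sumr_ge0. Qed.

Lemma hitn_le1 xi n x : xi \in A -> hitn xi n x <= 1.
Proof.
move=> xA; apply: (@le_trans _ _ (1 - surv L off n x)); last by rewrite gerBl surv_ge0.
rewrite -sum_hitn (perm_big _ (perm_to_rem xA)) big_cons /= lerDl.
by apply: sumr_ge0 => *; exact: hitn_ge0.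
Qed.

Lemma hit_cvg xi x : xi \in A -> (fun n => hitn xi n x) @ \oo --> hit xi x.
Proof.
move=> xA; apply: nondecreasing_is_cvgn.
  apply/nondecreasing_seqP => n; rewrite /hitn !(psumE Ilg _ _ _ (cdsh xi)).
  by rewrite big_ord_recr /= lerDl.
by exists 1 => _ [n _ <-]; exact: hitn_le1.
Qed.

Lemma hit_bounds xi x : xi \in A -> 0 <= hit xi x <= 1.
Proof.
move=> xA; have H := @hit_cvg xi x xA; apply/andP; split.
  by apply: (cvgr_to_ge H); apply: nearW => n; exact: hitn_ge0.
by apply: (cvgr_to_le H); apply: nearW => n; exact: hitn_le1.
Qed.

Lemma sum_hit x : \sum_(xi <- A) hit xi x = 1.
Proof.
have H (s : seq Z2) : {subset s <= A} ->
   (fun n => \sum_(xi <- s) hitn xi n x) @ \oo --> \sum_(xi <- s) hit xi x.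
  elim: s => [|y s IH] sA.
    by rewrite big_nil; under eq_fun do rewrite big_nil; exact: cvg_cst.
  rewrite big_cons; under eq_fun do rewrite big_cons.
  apply: cvgD; first by apply: hit_cvg; apply: sA; rewrite inE eqxx.
  by apply: IH => z zs; apply: sA; rewrite inE zs orbT.
have H1 := H A (fun z => id).
have H2 : (fun n => \sum_(xi <- A) hitn xi n x) @ \oo --> (1 - 0 : R).
  under eq_fun do rewrite sum_hitn.
  by apply: cvgB; [exact: cvg_cst|exact: surv_cvg0].
by rewrite (cvg_unique _ H1 H2) // subr0.
Qed.

(** Since [hit] counts positive times only, it is replaced on [A] by the boundary value; averaging
    this extension over one step gives back [hit] at every starting point. *)
Definition hext xi z : R := if z \in A then dirac R (z - xi) else hit xi z.

Lemma hext_bnd xi : xi \in A -> bnd 1 (hext xi).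
Proof.
move=> xA z; rewrite /hext; case: ifP => _; first exact: dirac_bnd.
by have /andP[h0 h1] := @hit_bounds xi z xA; rewrite ger0_norm.
Qed.

Lemma conv_hext xi x : xi \in A -> conv L (hext xi) x = hit xi x.
Proof.
move=> xA.
have H1 : (fun n => hitn xi n.+1 x) @ \oo --> hit xi x.
  by rewrite (cvg_shiftS (fun n => hitn xi n x)); exact: hit_cvg.
have H2 : (fun n => hitn xi n.+1 x) @ \oo --> conv L (hext xi) x.
  have E n : hitn xi n.+1 x = Ex L (fun v => dirac R (x + v - xi) + res off (hitn xi n) (x + v)).
    rewrite /hitn /= /kop /conv -ExD //; first exact: (@Ig_sh _ L _ _ x (dsh xi)).
    exact: (@Ig_sh _ L _ _ x (bnd_res off (psum_bnd L off n (cdsh xi)))).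
  under eq_fun do rewrite E.
  apply: (@Ex_cvg _ L _ _ (fun=> 2) (Ig_cst L 2)) => [n v|v].
    apply: le_trans (ler_normD _ _) _.
    have h1 := @dirac_bnd R (x + v - xi).
    have h2 : `|res off (hitn xi n) (x + v)| <= 1.
      by apply: bnd_res => z; rewrite ger0_norm ?hitn_ge0 ?hitn_le1.
    lra.
  rewrite /hext /res /off; case: ifP => vA /=.
    by rewrite addr0; exact: cvg_cst.
  have d0 : dirac R (x + v - xi) = 0.
    by rewrite /dirac subr_eq0; case: eqP => // E0; rewrite E0 xA in vA.
  by rewrite d0; under eq_fun do rewrite add0r; exact: hit_cvg.
by rewrite (cvg_unique _ H2 H1).
Qed.

Lemma sum_hext_lgb (c : Z2 -> R) : lgb (fun z => \sum_(xi <- A) c xi * hext xi z).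
Proof.
have E : (fun z => \sum_(xi <- A) c xi * hext xi z) =
   (fun z => \sum_(xi <- A) (if xi \in A then c xi * hext xi z else 0)).
  by apply/funext => z; apply: eq_big_seq => xi xA; rewrite xA.
rewrite E; apply: (@lgb_sum R A (fun xi z => if xi \in A then c xi * hext xi z else 0)) => xi /=; case xA : (xi \in A).
  by apply: lgbZ; exact: bnd_lgb (hext_bnd xA).
exact: bnd_lgb (@cst_bnd R 0).
Qed.

Lemma conv_sum_hext (c : Z2 -> R) x :
  conv L (fun z => \sum_(xi <- A) c xi * hext xi z) x = \sum_(xi <- A) c xi * hit xi x.
Proof.
have E : (fun z => \sum_(xi <- A) c xi * hext xi z) =
   (fun z => \sum_(xi <- A) (if xi \in A then c xi * hext xi z else 0)).
  by apply/funext => z; apply: eq_big_seq => xi xA; rewrite xA.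
have lF xi : lgb (fun z => if xi \in A then c xi * hext xi z else 0).
  case xA : (xi \in A); last exact: bnd_lgb (@cst_bnd R 0).
  by apply: lgbZ; exact: bnd_lgb (hext_bnd xA).
rewrite E (conv_lgb_sum Ilg A x lF); apply: eq_big_seq => xi xA; rewrite xA.
by rewrite conv_lgbZ // ?conv_hext //; exact: bnd_lgb (hext_bnd xA).
Qed.

Section GreenFunction.
Context (y : Z2).

(** The growth of the two kernels cancels, and the correction makes the difference vanish on [A];
    off [A] there remains the single charge [-1] at [y]. *)
Let Gam z := a0 z - a (z - y) + \sum_(xi <- A) (a (xi - y) - a0 xi) * hext xi z.
(** Differs from [Gam] only on [A], where a start uses [hit] and picks up the point mass created by
    [a0]. *)
Definition greenf x : R := a0 x + dirac R (x - xi0) - a (x - y) +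
  \sum_(xi <- A) (a (xi - y) - a0 xi) * hit xi x.

Let Gam_bnd : exists B, bnd B Gam.
Proof.
exists (K * (1 + lg R (y - xi0)) + \sum_(xi <- A) `|a (xi - y) - a0 xi|) => z.
apply: le_trans (ler_normD _ _) _; apply: lerD.
  have := Hincr (z - y) (y - xi0); have -> : z - y + (y - xi0) = z - xi0.
    by rewrite addrA subrK.
  by [].
apply: le_trans (ler_norm_sum _ _ _) _; rewrite big_seq [leRHS]big_seq.
apply: ler_sum => xi xA; rewrite normrM ler_piMr //; exact: hext_bnd.
Qed.

Let Gam0 z : z \in A -> Gam z = 0.
Proof.
move=> zA; rewrite /Gam.
have -> : \sum_(xi <- A) (a (xi - y) - a0 xi) * hext xi z = a (z - y) - a0 z.
  have := sum_dirac (fun xi => a (xi - y) - a0 xi) z uA; rewrite zA => <-.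
  by apply: eq_bigr => xi _; rewrite /hext zA.
ring.
Qed.

Lemma conv_Gam x : conv L Gam x = greenf x - dirac R (x - y).
Proof.
have E : Gam = fun z => (1 * a0 z + (-1) * a (z - y)) +
    \sum_(xi <- A) (a (xi - y) - a0 xi) * hext xi z.
  by apply/funext => z; rewrite /Gam mul1r mulN1r.
have l1 := a0_lgb; have l2 : lgb (fun z => a (z - y)) := lgb_sh (- y) a_lgb.
rewrite E (conv_lgbD Ilg _ (lgb_lin 1 (-1) l1 l2) (sum_hext_lgb (fun xi => a (xi - y) - a0 xi))).
rewrite (conv_lgb_lin Ilg _ _ _ l1 l2).
rewrite /a0 !conv_a0 conv_sum_hext /greenf /a0; ring.
Qed.

Lemma greenf_off x : x \notin A -> greenf x = Gam x.
Proof.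
move=> xA; rewrite /greenf /Gam.
have -> : dirac R (x - xi0) = 0.
  by rewrite /dirac subr_eq0; case: eqP => // E; rewrite E xi0A in xA.
rewrite addr0; congr (_ + _); apply: eq_bigr => xi _.
by rewrite /hext (negbTE xA).
Qed.

Lemma greenf_bnd : exists B, bnd B greenf.
Proof.
have [B HB] := Gam_bnd; exists (B + 1) => x.
have -> : greenf x = conv L Gam x + dirac R (x - y) by rewrite conv_Gam subrK.
apply: le_trans (ler_normD _ _) _; apply: lerD; first exact: conv_bnd.
exact: dirac_bnd.
Qed.

Lemma kop_greenf x : Kop greenf x = greenf x - dirac R (x - y).
Proof.
rewrite -conv_Gam /Kop /kop; congr (conv L _ x); apply/funext => z.
by rewrite /res /off; case: ifPn => [/greenf_off//|/negPn /Gam0 ->].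
Qed.

(** Since [greenf] is the point mass at [y] plus [Kop greenf], the partial sums are [greenf] minus
    its n-th iterate, which tends to [0] by recurrence. *)
Lemma green_cvg x :
  (fun n => \sum_(k < n) iter k Kop (fun z => dirac R (z - y)) x) @ \oo --> greenf x.
Proof.
have [B HB] := greenf_bnd.
have dE : (fun z => dirac R (z - y)) = (fun z => 1 * greenf z + (-1) * Kop greenf z).
  by apply/funext => z; rewrite kop_greenf mul1r mulN1r; ring.
have E n : \sum_(k < n) iter k Kop (fun z => dirac R (z - y)) x = greenf x - iter n Kop greenf x.
  elim: n => [|n IH]; first by rewrite big_ord0 subrr.
  rewrite big_ord_recr /= IH {1}dE (iter_kop_lin Ilg off 1 (-1) n HB (kop_bnd L off HB)).
  by rewrite -[iter n (kop L off) (Kop greenf) x]/(iter n Kop (Kop greenf) x) -iterSr /= mul1r mulN1r addrA subrK.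
under eq_fun do rewrite E.
have : (fun n => greenf x - iter n Kop greenf x) @ \oo --> greenf x - 0.
  by apply: cvgB; [exact: cvg_cst|exact: iter_kop_cvg0 HB].
by rewrite subr0.
Qed.

End GreenFunction.

(** The limit of [greenf y x] as [y] recedes: [a (xi - y) - a (x - y)] tends to [0] and the hitting
    probabilities sum to [1]. *)
Definition uf x : R := a0 x + dirac R (x - xi0) - \sum_(xi <- A) a0 xi * hit xi x.

Lemma greenf_uf x : vanish (fun y => greenf y x - uf x).
Proof.
have V : vanish (fun y => \sum_(xi <- A) (a (xi - y) - a (x - y)) * hit xi x).
  elim: A => [|xi s IH].
    by move=> e e0; exists 0%N => z _; rewrite big_nil normr0 ltW.
  have Vx : vanish (fun y => (a (xi - y) - a (x - y)) * hit xi x).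
    have := vanish_oppn (vanish_sh x (Hvan (xi - x))) => V0.
    have V1 : vanish (fun y => hit xi x * (a (- y + x + (xi - x)) - a (- y + x))).
      exact: vanishZ V0.
    apply: vanish_le V1 _ => y; apply: eq_ler; congr `|_|; rewrite mulrC.
    have -> : - y + x + (xi - x) = xi - y by rewrite -addrA [x + (xi - x)]addrC subrK addrC.
    by rewrite [- y + x]addrC.
  apply: vanish_le (vanishD Vx IH) _ => y; by rewrite big_cons.
apply: vanish_le V _ => y; apply: eq_ler; congr `|_|.
have -> : \sum_(xi <- A) (a (xi - y) - a (x - y)) * hit xi x =
  \sum_(xi <- A) (a (xi - y) - a0 xi) * hit xi x + \sum_(xi <- A) a0 xi * hit xi x -
  a (x - y) * \sum_(xi <- A) hit xi x.
  by rewrite mulr_sumr -big_split -sumrB; apply: eq_bigr => xi _ /=; ring.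
by rewrite sum_hit /greenf /uf; ring.
Qed.

Lemma greenf_ge0 y x : 0 <= greenf y x.
Proof.
apply: (cvgr_to_ge (@green_cvg y x)); apply: nearW => n; apply: sumr_ge0 => k _.
by apply: (iter_kop_ge0 Ilg _ _ _ (dsh y)) => z; exact: dirac_ge0.
Qed.

Lemma uf_ge0 x : 0 <= uf x.
Proof.
rewrite -(lerD2r 0) addr0; apply/ler_addgt0Pr => e e0; rewrite addr0.
have [M HM] := greenf_uf x e0; pose y : Z2 := (M%:Z, 0).
have ny : nrm1 y = M by rewrite /nrm1 /= addn0.
have := HM y; rewrite ny leqnn => /(_ isT); rewrite ler_norml => /andP[_].
by have := @greenf_ge0 y x; lra.
Qed.

Lemma uf_a0 x : `|uf x - a0 x| <= 1 + \sum_(xi <- A) `|a0 xi|.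
Proof.
have -> : uf x - a0 x = dirac R (x - xi0) - \sum_(xi <- A) a0 xi * hit xi x.
  by rewrite /uf; ring.
apply: le_trans (ler_normB _ _) _; apply: lerD; first exact: dirac_bnd.
apply: le_trans (ler_norm_sum _ _ _) _; rewrite big_seq [leRHS]big_seq.
apply: ler_sum => xi xA; rewrite normrM ler_piMr //.
by have /andP[h0 h1] := @hit_bounds xi x xA; rewrite ger0_norm.
Qed.

Lemma uf_lgb : lgb uf.
Proof.
have B : bnd (1 + \sum_(xi <- A) `|a0 xi|) (fun x => uf x - a0 x) by exact: uf_a0.
have := lgbD a0_lgb (bnd_lgb B); congr lgb; apply/funext => x; ring.
Qed.

(** The function [a0] minus the extension of its values on [A] agrees with [uf] off [A] and vanishes
    on [A], so it is the restriction of [uf]. *)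
Lemma kop_uf x : kop L off uf x = uf x.
Proof.
have E : res off uf = fun z => 1 * a0 z + (-1) * (\sum_(xi <- A) a0 xi * hext xi z).
  apply/funext => z; rewrite /res /off mul1r mulN1r; case: ifPn => [zA|/negPn zA].
    have d0 : dirac R (z - xi0) = 0.
      by rewrite /dirac subr_eq0; case: eqP => // E; rewrite E xi0A in zA.
    rewrite /uf d0 addr0; congr (_ - _); apply: eq_bigr => xi _.
    by rewrite /hext (negbTE zA).
  have := sum_dirac a0 z uA; rewrite zA => h.
  rewrite -[X in X - _]h -sumrB big1 // => xi _; by rewrite /hext zA subrr.
rewrite /kop E (conv_lgb_lin Ilg _ _ _ a0_lgb (sum_hext_lgb a0)) conv_sum_hext.
by rewrite {1}/a0 conv_a0 /uf -/(a0 x); ring.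
Qed.

Lemma uf_lg (e B : R) : 0 <= e -> (forall x, `|lg R x - kap * a x| <= B + e * lg R x) ->
  exists B', forall x, `|lg R x - kap * uf x| <= B' + e * lg R x.
Proof.
move=> e0 HB; set S := 1 + \sum_(xi <- A) `|a0 xi|.
exists (lg R xi0 + (B + e * lg R xi0) + kap * S) => x.
have h1 := HB (x - xi0); have h2 := uf_a0 x; rewrite -/S -/(a0 x) in h1 h2.
have l1 : lg R x <= lg R (x - xi0) + lg R xi0 by have := lgD R (x - xi0) xi0; rewrite subrK.
have l2 : lg R (x - xi0) <= lg R x + lg R xi0 by have := lgD R x (- xi0); rewrite lgN.
have l3 : e * lg R (x - xi0) <= e * (lg R x + lg R xi0) by rewrite ler_wpM2l.
have -> : lg R x - kap * uf x = (lg R x - lg R (x - xi0)) + (lg R (x - xi0) - kap * a0 x)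
   - kap * (uf x - a0 x) by ring.
apply: le_trans (ler_normB _ _) _; apply: le_trans (lerD (ler_normD _ _) (lexx _)) _.
have k1 : `|kap * (uf x - a0 x)| <= kap * S.
  by rewrite normrM (gtr0_norm kap0) ler_pM2l.
have l4 : `|lg R x - lg R (x - xi0)| <= lg R xi0 by rewrite ler_norml; apply/andP; split; lra.
lra.
Qed.

(** Far away [uf] is at least [1], and finitely many points remain. *)
Lemma uf_gap : exists2 c, 0 < c & forall x, uf x = 0 \/ c <= uf x.
Proof.
have half0 : 0 <= 2^-1 :> R by rewrite invr_ge0.
have [B0 HB0] := Hlg (divr_gt0 ltr01 (ltr0n R 2) : 0 < 1 / 2).
have [|B HB] := @uf_lg 2^-1 B0 half0; first by move=> x; have := HB0 x; rewrite div1r.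
(* Beyond [M] one has [lg x >= 2 (kap + B)], whence [kap * uf x >= lg x / 2 - B >= kap]. *)
have [M HM] := nat_gt (expR (2 * (kap * 1 + B))).
have far x : (M <= nrm1 x)%N -> 1 <= uf x.
  move=> Mx; rewrite -(ler_pM2l kap0); have := HB x; rewrite ler_norml => /andP[_ h].
  have : 2 * (kap * 1 + B) <= lg R x; last by lra.
  rewrite -[leLHS]expRK /lg ler_ln ?posrE ?expR_gt0 ?ltr_pwDl //.
  apply: le_trans (ltW HM) _; apply: (@le_trans _ _ (nrm1 x)%:R); first by rewrite ler_nat.
  by rewrite lerDr.
pose s := [seq x <- rect M M | 0 < uf x].
have ins x : uf x != 0 -> (nrm1 x < M)%N -> x \in s.
  move=> ux xM; rewrite mem_filter lt0r ux uf_ge0 mem_rect /=.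
  by move: xM; rewrite /nrm1; clear; lia.
case E : s => [|y s'].
  exists 1 => // x; have [->|ux] := eqVneq (uf x) 0; first by left.
  right; have [/far //|xM] := leqP M (nrm1 x).
  by have := ins x ux xM; rewrite E.
have ys : y \in s by rewrite E inE eqxx.
have [m ms Hm] := seq_argmax (fun x => - uf x) ys.
have m0 : 0 < uf m by move: ms; rewrite mem_filter => /andP[].
exists (Num.min 1 (uf m)); first by rewrite lt_min ltr01.
move=> x; have [->|ux] := eqVneq (uf x) 0; first by left.
right; have [/far h|xM] := leqP M (nrm1 x); first by rewrite ge_min h.
by have := Hm x (ins x ux xM); rewrite lerN2 ge_min => ->; rewrite orbT.
Qed.

End Recurrence.

(** * Exit from a large disc *)

Section Exit.
Context (R : realType) (L : step_law R) (IL : Ig L (@nsq R)).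
Hypotheses (mean1 : Ex L (fun v => v.1%:~R) = 0) (mean2 : Ex L (fun v => v.2%:~R) = 0).
Implicit Types (x z v : Z2) (r e B : R).

Definition ns z : R := z.1%:~R ^+ 2 + z.2%:~R ^+ 2.

Lemma ns_ge0 z : 0 <= ns z. Proof. by rewrite addr_ge0 ?sqr_ge0. Qed.

Lemma nsq_ns z : nsq R z <= 2 * ns z.
Proof.
rewrite nsqE /ns -(real_normK (num_real z.1%:~R)) -(real_normK (num_real z.2%:~R)).
by have := sqr_ge0 (`|z.1%:~R : R| - `|z.2%:~R|); nra.
Qed.

Lemma ns_nsq z : ns z <= nsq R z.
Proof.
rewrite nsqE /ns -(real_normK (num_real z.1%:~R)) -(real_normK (num_real z.2%:~R)).
have := mulr_ge0 (normr_ge0 (z.1%:~R : R)) (normr_ge0 (z.2%:~R : R)); nra.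
Qed.

Lemma nsD x v : ns (x + v) = ns x + 2 * (x.1%:~R * v.1%:~R + x.2%:~R * v.2%:~R) + ns v.
Proof. by rewrite /ns /= !intrD; ring. Qed.

Lemma nsD_le x v : ns (x + v) <= 2 * ns x + 2 * ns v.
Proof.
rewrite nsD /ns; have := sqr_ge0 (x.1%:~R - v.1%:~R : R); have := sqr_ge0 (x.2%:~R - v.2%:~R : R).
nra.
Qed.

Lemma nrm1_le_ns z r : 0 <= r -> ns z <= r ^+ 2 -> (nrm1 z)%:R <= 2 * r.
Proof.
move=> r0 zr; rewrite -(ler_pXn2r (n:=2)) ?nnegrE ?mulr_ge0 //.
by apply: le_trans (nsq_ns z) _; have := sqr_ge0 r; rewrite exprMn; nra.
Qed.

Lemma ns_le_nrm1 z r : 0 <= r -> r ^+ 2 <= ns z -> r <= (nrm1 z)%:R.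
Proof.
move=> r0 zr; rewrite -(ler_pXn2r (n:=2)) ?nnegrE //.
exact: le_trans zr (ns_nsq z).
Qed.

Let tr := Ex L (fun v => v.1%:~R * v.1%:~R) + Ex L (fun v => v.2%:~R * v.2%:~R).
Hypothesis tr_gt0 : 0 < tr.

Definition tailn r v : R := ns v * (r ^+ 2 < ns v)%R%:R.
Definition tail r := Ex L (tailn r).

Lemma tailn_ge0 r v : 0 <= tailn r v. Proof. by rewrite mulr_ge0 ?ns_ge0. Qed.

Lemma tailn_le r v : tailn r v <= nsq R v.
Proof.
apply: le_trans (ns_nsq v); rewrite /tailn ler_piMr ?ns_ge0 //.
by case: (_ < _).
Qed.

Lemma Ig_tailn r : Ig L (tailn r).
Proof. by apply: (Ig_le IL) => v; rewrite ger0_norm ?tailn_ge0 ?tailn_le. Qed.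

Lemma tail_ge0 r : 0 <= tail r.
Proof. by apply: Ex_ge0 (Ig_tailn r) _ => v; exact: tailn_ge0. Qed.

Lemma tail_decr r r' : 0 <= r -> r <= r' -> tail r' <= tail r.
Proof.
move=> r0 rr; apply: Ex_le; try exact: Ig_tailn; move=> v.
rewrite /tailn ler_wpM2l ?ns_ge0 // ler_nat; case: ltP => // h.
suff -> : r ^+ 2 < ns v by [].
by apply: le_lt_trans h; rewrite lerXn2r ?nnegrE // (le_trans r0).
Qed.

Lemma tail_small e : 0 < e -> exists2 r0, 0 <= r0 & forall r, r0 <= r -> tail r <= e.
Proof.
move=> e0; have : (fun n => Ex L (tailn n%:R)) @ \oo --> Ex L (fun=> 0).
  apply: (@Ex_cvg _ L _ _ _ IL) => [n v|v]; first by rewrite ger0_norm ?tailn_ge0 ?tailn_le.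
  apply/seq_cvgP => d d0; have [N HN] := nat_gt (ns v); exists N.+1 => n Nn.
  rewrite subr0 /tailn; case: ltP => h; last by rewrite mulr0 normr0 ltW.
  exfalso; have : ns v <= n%:R ^+ 2.
    apply: le_trans (ltW HN) _; rewrite -natrX ler_nat.
    by move: Nn; clear; nia.
  by rewrite leNgt h.
rewrite Ex_cst => /seq_cvgP /(_ e e0) [n /(_ n (leqnn n))].
rewrite subr0 => h; exists n%:R => // r nr; apply: le_trans (tail_decr (ler0n _ n) nr) _.
by apply: le_trans h; exact: ler_norm.
Qed.

(** On the event [|v| > r] the factor [lg v] is at least [ln r]. *)
Lemma tail_log : Ig L (fun v => nsq R v * lg R v) ->
  forall r, 1 < r -> tail r <= Ex L (fun v => nsq R v * lg R v) / ln r.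
Proof.
move=> Il r r1; have l0 : 0 < ln r by rewrite ln_gt0.
rewrite ler_pdivlMr // mulrC -ExZ; last exact: Ig_tailn.
apply: Ex_le => //; first by apply: IgZ; exact: Ig_tailn.
move=> v; rewrite /tailn; case: ltP => h; last first.
  by rewrite !mulr0 mulr_ge0 ?nsq_ge0 ?lg_ge0.
rewrite mulr1 mulrC ler_pM ?ns_ge0 ?(ltW l0) ?ns_nsq //.
have rn : r <= (nrm1 v)%:R by apply: ns_le_nrm1; [lra|exact: ltW].
by rewrite /lg ler_ln ?posrE ?ltr_pwDl //; lra.
Qed.

Context (off : pred Z2).

Definition inU r z := ns z < r ^+ 2.
Definition stay r z := off z && inU r z.

Let Ilg : Ig L (lg R).
Proof.
apply: (Ig_le IL) => v; rewrite ger0_norm ?lg_ge0 //.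
apply: le_trans (nrm1_le_sq R v); exact: lg_le_nrm1.
Qed.

(* [4 r^2 - |z|^2] is a Lyapunov function for the walk killed outside [U(r)]. *)
Lemma exit_time_bound : exists2 r0, 0 <= r0 & forall r, r0 <= r -> forall n x, inU r x ->
  psum L (stay r) (fun=> 1) n x <= 8 / tr * r ^+ 2.
Proof.
have t4 : 0 < tr / 4 by rewrite divr_gt0.
have [r0 r00 Hr0] := tail_small t4; exists r0 => // r rr n x xU.
have T := Hr0 r rr; have r2 := sqr_ge0 r.
suff H : psum L (stay r) (fun=> 1) n x <= 2 / tr * (4 * r ^+ 2 - ns x).
  apply: le_trans H _; have -> : 8 / tr * r ^+ 2 = 2 / tr * (4 * r ^+ 2) by ring.
  by rewrite ler_pM2l ?divr_gt0 // gerBl ns_ge0.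
have c0 : 0 <= 2 / tr by rewrite divr_ge0 // ltW.
elim: n x xU => [|n IH] x xU /=.
  by rewrite mulr_ge0 // subr_ge0; move: xU; rewrite /inU => h; lra.
(* Majorant of the Lyapunov function after one step. It must be nonnegative at an exit: for
   [|v| <= r] one has [|x + v|^2 <= 4 r^2], and for longer steps [2 tailn] compensates. Its drift is
   [-tr + 2 tail <= -tr / 2], whence the factor [2 / tr]. *)
pose g v := (4 * r ^+ 2 - ns x) + (- (2 * x.1%:~R) * v.1%:~R + - (2 * x.2%:~R) * v.2%:~R +
   (-1) * (v.1%:~R * v.1%:~R + v.2%:~R * v.2%:~R)) + 2 * tailn r v : R.
have I1 := Ig_v1 IL; have I2 := Ig_v2 IL; have I11 := Ig_v11 IL; have I22 := Ig_v22 IL.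
have J1 := IgZ (- (2 * x.1%:~R)) I1; have J2 := IgZ (- (2 * x.2%:~R)) I2.
have J3 := IgZ (-1) (IgD I11 I22); have J4 := IgZ 2 (Ig_tailn r).
have J0 := Ig_cst L (4 * r ^+ 2 - ns x).
have J12 := IgD J1 J2; have J123 := IgD J12 J3; have J5 := IgD J0 J123; have J6 : Ig L g := IgD J5 J4.
have Eg : Ex L g = 4 * r ^+ 2 - ns x - tr + 2 * tail r.
  rewrite /g (ExD J5 J4) (ExD J0 J123) (ExD J12 J3) (ExD J1 J2) Ex_cst.
  rewrite (ExZ _ I1) (ExZ _ I2) (ExZ _ (IgD I11 I22)) (ExZ _ (Ig_tailn r)).
  by rewrite (ExD I11 I22) mean1 mean2 -/tr -/(tail r) /tr; ring.
have kb : kop L (stay r) (psum L (stay r) (fun=> 1) n) x <= 2 / tr * Ex L g.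
  rewrite -(ExZ _ J6); apply: Ex_le.
  - apply: (Ig_lgb Ilg); apply: lgb_res; exact: bnd_lgb (psum_bnd L (stay r) n (@one_bnd R)).
  - exact: IgZ.
  move=> v; have gE : g v = 4 * r ^+ 2 - ns (x + v) + 2 * tailn r v.
    by rewrite /g nsD /ns; ring.
  have t0 := tailn_ge0 r v.
  rewrite /res /stay; case: ifP => [/andP[_ xvU]|_].
    apply: le_trans (IH _ xvU) _; rewrite ler_wpM2l // gE; lra.
  rewrite mulr_ge0 // gE; have := nsD_le x v; move: xU t0; rewrite /inU /tailn.
  by case: (ltP (r ^+ 2) (ns v)) => h xU t0 h2; rewrite ?mulr1 ?mulr0; lra.
apply: le_trans (lerD (lexx _) kb) _; rewrite Eg.
have -> : 2 / tr * (4 * r ^+ 2 - ns x - tr + 2 * tail r) =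
  2 / tr * (4 * r ^+ 2 - ns x) - 2 + 4 * (tail r / tr) by field; rewrite gt_eqF.
have : tail r / tr <= 4^-1 by rewrite ler_pdivrMr // mulrC.
lra.
Qed.

Definition outU r z : R := (~~ inU r z)%:R.
Definition jump r := conv L (outU r).
(** The last step is tested only for leaving the disc; the exit point avoids [A] once [A] lies
    inside. *)
Definition escn r n := psum L (stay r) (jump r) n.
Definition esc r x : R := lim ((fun n => escn r n x) @ \oo).

Lemma outU_bnd r : bnd 1 (outU r).
Proof. by move=> z; rewrite /outU normr_nat; case: (inU r z). Qed.

Lemma jump_bnd r : bnd 1 (jump r). Proof. exact: conv_bnd (outU_bnd r). Qed.

Lemma jump_ge0 r x : 0 <= jump r x.
Proof. by apply: (conv_ge0 L (outU_bnd r)) => z; exact: ler0n. Qed.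

Lemma escn_ge0 r n x : 0 <= escn r n x.
Proof.
rewrite /escn (psumE Ilg _ _ _ (jump_bnd r)) sumr_ge0 // => k _.
by apply: (iter_kop_ge0 Ilg _ _ _ (jump_bnd r)) => z; exact: jump_ge0.
Qed.

Lemma escn_le1 r n x : escn r n x <= 1.
Proof.
elim: n x => [|n IH] x //=.
have l1 := bnd_lgb (psum_bnd L (stay r) n (jump_bnd r)).
have l2 := bnd_lgb (outU_bnd r).
rewrite /escn /= /jump /kop -(conv_lgbD Ilg) //; last exact: lgb_res.
have cE : conv L (fun=> 1) x = 1 :> R := Ex_cst L 1.
rewrite -[leRHS]cE; apply: (conv_lgb_le Ilg).
- by apply: lgbD => //; exact: lgb_res.
- exact: bnd_lgb (@one_bnd R).
move=> z; rewrite /outU /res /stay; case: (inU r z); rewrite ?andbF ?addr0 //=.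
by rewrite add0r andbT; case: (off z) => //; exact: IH.
Qed.

Lemma esc_cvg r x : (fun n => escn r n x) @ \oo --> esc r x.
Proof.
apply: nondecreasing_is_cvgn.
  apply/nondecreasing_seqP => n; rewrite /escn !(psumE Ilg _ _ _ (jump_bnd r)).
  rewrite big_ord_recr /= lerDl.
  by apply: (iter_kop_ge0 Ilg _ _ _ (jump_bnd r)) => z; exact: jump_ge0.
by exists 1 => _ [n _ <-]; exact: escn_le1.
Qed.

Lemma esc_bounds r x : 0 <= esc r x <= 1.
Proof.
have H := @esc_cvg r x; apply/andP; split.
  by apply: (cvgr_to_ge H); apply: nearW => n; exact: escn_ge0.
by apply: (cvgr_to_le H); apply: nearW => n; exact: escn_le1.
Qed.

Context (u : Z2 -> R) (kap : R) (kap0 : 0 < kap).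
Hypotheses (ul : lgb u) (u0 : forall x, 0 <= u x) (uK : forall x, kop L off u x = u x).

Section FixedRadius.
Context (r : R) (r1 : 1 <= r) (offr : forall z, ~~ inU r z -> off z).

Let outu z := outU r z * u z.

Let outu_lgb : lgb outu.
Proof.
have [C HC] := ul; exists C => z; apply: le_trans (HC z); rewrite /outu normrM.
by rewrite ler_piMl //; exact: outU_bnd.
Qed.

Let u_split x : u x = kop L (stay r) u x + conv L outu x.
Proof.
rewrite -[LHS]uK /kop -(conv_lgbD Ilg) //; last exact: lgb_res.
congr (conv L _ x); apply/funext => z; rewrite /res /stay /outu /outU.
have [zU|zU] := boolP (inU r z); first by rewrite andbT mul0r addr0.
by rewrite andbF (offr zU) add0r mul1r.
Qed.

(** Optional stopping in which only the exit values are kept, the others being nonnegative. *)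
Lemma esc_lower m x : 0 <= m -> (forall z, ~~ inU r z -> m <= u z) -> m * esc r x <= u x.
Proof.
move=> m0 mu.
have key n y : m * escn r n y <= u y.
  elim: n y => [|n IH] y; first by rewrite /escn /= mulr0.
  rewrite u_split /escn /= mulrDr addrC; apply: lerD.
    rewrite /kop -(conv_lgbZ Ilg); last first.
      by apply: lgb_res; exact: bnd_lgb (psum_bnd L (stay r) n (jump_bnd r)).
    apply: (conv_lgb_le Ilg); last by move=> z; rewrite /res; case: ifP; rewrite ?mulr0 // => _; exact: IH.
      by apply: lgbZ; apply: lgb_res; exact: bnd_lgb (psum_bnd L (stay r) n (jump_bnd r)).
    exact: lgb_res.
  rewrite /jump -(conv_lgbZ Ilg); last exact: bnd_lgb (outU_bnd r).
  apply: (conv_lgb_le Ilg) => //; first by apply: lgbZ; exact: bnd_lgb (outU_bnd r).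
  move=> z; rewrite /outu /outU; have [_|zU] := boolP (inU r z); first by rewrite mulr0 mul0r.
  by rewrite mulr1 mul1r; exact: mu.
have H : (fun n => m * escn r n x) @ \oo --> m * esc r x.
  by apply: cvgM; [exact: cvg_cst|exact: esc_cvg].
by apply: (cvgr_to_le H); apply: nearW => n; exact: key.
Qed.

(** Optional stopping with two costs: an exit counts [M], and every step taken inside the disc adds
    [t] for the overshoot, so [t] is multiplied by the expected exit time. *)
Lemma esc_upper M t Cb x : 0 <= M -> 0 <= t ->
  (forall y, inU r y -> conv L outu y <= M * jump r y + t) ->
  (forall n y, inU r y -> psum L (stay r) (fun=> 1) n y <= Cb) ->
  inU r x -> u x <= M * esc r x + t * Cb.
Proof.
move=> M0 t0 out1 Sb xU; have r1' := r1.
have [Ms Ms0 HMs] : exists2 Ms, 0 <= Ms & forall z, inU r z -> u z <= Ms.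
  have [C HC] := ul; have C0 : 0 <= C.
    by have := le_trans (normr_ge0 _) (HC 0); rewrite /lg nrm1_0 addr0 ln1 addr0 mulr1.
  exists (C * (1 + 2 * r)); first by apply: mulr_ge0 => //; move: r1; lra.
  move=> z zU; apply: le_trans (ler_norm _) _; apply: le_trans (HC z) _.
  rewrite ler_wpM2l // lerD2l; apply: le_trans (lg_le_nrm1 R z) _.
  by apply: nrm1_le_ns; [lra|exact: ltW].
pose S n := psum L (stay r) (fun=> 1) n.
have lE n : lgb (escn r n) := bnd_lgb (psum_bnd L (stay r) n (jump_bnd r)).
have lS n : lgb (S n) := bnd_lgb (psum_bnd L (stay r) n (@one_bnd R)).
have lV n : lgb (surv L (stay r) n) := bnd_lgb (surv_bnd L (stay r) n).
have key n y : inU r y -> u y <= M * escn r n y + t * S n y + Ms * surv L (stay r) n y.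
  elim: n y => [|n IH] y yU.
    by rewrite /escn /S /surv /= !mulr0 !add0r mulr1; exact: HMs.
  pose b z := 1 * (M * escn r n z + t * S n z) + Ms * surv L (stay r) n z.
  have lb : lgb (fun z => M * escn r n z + t * S n z) by apply: lgb_lin.
  have h1 : kop L (stay r) u y <= kop L (stay r) b y.
    apply: (kop_le Ilg) => //; first exact: lgb_lin.
    by move=> z /andP[_ zU]; rewrite /b mul1r; exact: IH.
  rewrite u_split; apply: le_trans (lerD h1 (out1 y yU)) _.
  rewrite /b (kop_lin Ilg) // (kop_lin Ilg) // mul1r /escn /S /surv /=.
  by apply: eq_ler; ring.
(* Survival probabilities decrease, so a bounded expected exit time forces them below [Cb / n]. *)
have nS n y : n%:R * surv L (stay r) n y <= S n y.
  rewrite /S (psumE Ilg _ _ _ (@one_bnd R)).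
  have dec k : (k <= n)%N -> surv L (stay r) n y <= surv L (stay r) k y.
    have /nonincreasing_seqP H : forall i, surv L (stay r) i.+1 y <= surv L (stay r) i y.
      by move=> i; exact: surv_decr.
    by move=> kn; exact: H.
  have -> : n%:R * surv L (stay r) n y = \sum_(k < n) surv L (stay r) n y.
    by rewrite sumr_const card_ord mulr_natl.
  by apply: ler_sum => k _; apply: dec; exact: ltnW.
have Cb0 : 0 <= Cb by apply: le_trans (Sb 0%N x xU).
apply/ler_addgt0Pr => e e0.
have [N HN] := nat_gt (Ms * Cb / e).
have Np : 0 < N%:R :> R by apply: le_lt_trans HN; rewrite divr_ge0 ?mulr_ge0 // ltW.
have sv : Ms * surv L (stay r) N x <= e.
  have h : surv L (stay r) N x <= Cb / N%:R.
    by rewrite ler_pdivlMr // mulrC; apply: le_trans (nS N x) (Sb N x xU).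
  apply: le_trans (ler_wpM2l Ms0 h) _; rewrite mulrA ler_pdivrMr // [leRHS]mulrC -ler_pdivrMr //.
  exact: ltW.
have eN : escn r N x <= esc r x.
  apply: (@nondecreasing_cvgn_le R (fun n => escn r n x)).
    apply/nondecreasing_seqP => n; rewrite /escn !(psumE Ilg _ _ _ (jump_bnd r)).
    rewrite big_ord_recr /= lerDl.
    by apply: (iter_kop_ge0 Ilg _ _ _ (jump_bnd r)) => z; exact: jump_ge0.
  exact: cvgP (@esc_cvg r x).
apply: le_trans (key N x xU) _; rewrite -!addrA; apply: lerD; first exact: ler_wpM2l.
by apply: lerD => //; rewrite ler_wpM2l //; exact: Sb.
Qed.

Lemma overshoot_bound e B x : 0 <= e -> (forall z, `|lg R z - kap * u z| <= B + e * lg R z) ->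
  inU r x ->
  conv L outu x <= (B + (1 + e) * (ln r + 4)) / kap * jump r x + 2 * (1 + e) / (kap * r ^+ 2) * tail r.
Proof.
move=> e0 HB xU; have r1' := r1.
have r0 : 0 < r by lra. have r20 : 0 < r ^+ 2 by rewrite exprn_gt0.
have e10 : 0 <= 1 + e by lra.
(* Steps of length at most [r] give [1 + nrm1 (x + v) <= 5 r], which accounts for the [4]; longer
   ones satisfy [|v| <= |v|^2 / r], which accounts for the tail. *)
have lgz v : lg R (x + v) <= ln r + 4 + 2 / r ^+ 2 * tailn r v.
  have nx : (nrm1 x)%:R <= 2 * r by apply: nrm1_le_ns; [lra|exact: ltW].
  have nxv : (nrm1 (x + v)%R)%:R <= (nrm1 x)%:R + (nrm1 v)%:R :> R.
    by rewrite -natrD ler_nat nrm1D.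
  have lnle (q : R) : 0 <= q -> 1 + (nrm1 (x + v)%R)%:R <= r * (1 + q) -> lg R (x + v) <= ln r + q.
    move=> q0 h; apply: (@le_trans _ _ (ln (r * (1 + q)))).
      by rewrite /lg ler_ln ?posrE ?mulr_gt0 ?ltr_pwDl.
    by rewrite lnM ?posrE ?ltr_pwDl // lerD2l; exact: ln1D_le.
  rewrite /tailn -addrA; case: ltP => h; apply: lnle.
  - by rewrite mulr1 addr_ge0 // mulr_ge0 ?divr_ge0 ?ns_ge0 // ltW.
  - rewrite mulr1; set s := Num.sqrt (ns v).
    have s2 : s ^+ 2 = ns v by rewrite sqr_sqrtr // ns_ge0.
    have s0 : 0 <= s := sqrtr_ge0 _.
    have rs : r <= s by rewrite -(ler_pXn2r (n:=2)) ?nnegrE ?s2 // ltW.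
    have nv : (nrm1 v)%:R <= 2 * s by apply: nrm1_le_ns; rewrite ?s2.
    have : s <= ns v / r by rewrite ler_pdivlMr // -s2 expr2 ler_wpM2l.
    have -> : r * (1 + (4 + 2 / r ^+ 2 * ns v)) = 5 * r + 2 * (ns v / r) by field; rewrite gt_eqF.
    lra.
  - by rewrite mulr0 mulr0 addr0.
  - rewrite !mulr0 addr0.
    have nv : (nrm1 v)%:R <= 2 * r by apply: nrm1_le_ns => //; exact: ltW.
    lra.
set m := (B + (1 + e) * (ln r + 4)) / kap; set c := 2 * (1 + e) / (kap * r ^+ 2).
have c0 : 0 <= c by apply: divr_ge0; apply: mulr_ge0 => //; exact: ltW.
have I1 := Ig_lgb Ilg x (bnd_lgb (outU_bnd r)).
rewrite /jump /conv /tail -!ExZ //; last exact: Ig_tailn.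
rewrite -ExD; [|exact: IgZ|by apply: IgZ; exact: Ig_tailn].
apply: Ex_le.
- exact: (Ig_lgb Ilg).
- by apply: IgD; apply: IgZ => //; exact: Ig_tailn.
move=> v; rewrite /outu /outU; have t0 := tailn_ge0 r v.
have [_|_] := boolP (inU r (x + v)); first by rewrite mul0r mulr0 add0r mulr_ge0.
rewrite mul1r mulr1 -(ler_pM2l kap0).
have -> : kap * (m + c * tailn r v) = B + (1 + e) * (ln r + 4 + 2 / r ^+ 2 * tailn r v).
  by rewrite /m /c; field; rewrite !gt_eqF.
have := HB (x + v); rewrite ler_norml => /andP[h _].
have h2 : (1 + e) * lg R (x + v) <= (1 + e) * (ln r + 4 + 2 / r ^+ 2 * tailn r v).
  by rewrite ler_wpM2l.
lra.
Qed.

End FixedRadius.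

Lemma esc_asymptotics e B : 0 <= e <= 1 -> 0 <= B ->
  (forall z, `|lg R z - kap * u z| <= B + e * lg R z) ->
  (exists r, forall z, ~~ inU r z -> off z) ->
  exists r0, 1 <= r0 /\ forall r, r0 <= r -> forall x, inU r x ->
    ((1 - e) * ln r - B) * esc r x <= kap * u x /\
    kap * u x <= (B + (1 + e) * (ln r + 4)) * esc r x + 32 / tr * tail r.
Proof.
move=> /andP[e0 e1] B0 HB [ra Hra]; have [rb rb0 Hrb] := exit_time_bound.
exists (1 + `|ra| + rb); split; first by have := normr_ge0 ra; lra.
move=> r rr x xU; have na := normr_ge0 ra; have r1 : 1 <= r by lra.
have l0 : 0 <= ln r by rewrite ln_ge0.
have offr z : ~~ inU r z -> off z.
  move=> zU; apply: Hra; apply: contra zU; rewrite /inU => h; apply: lt_le_trans h _.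
  rewrite -real_normK ?num_real // lerXn2r ?nnegrE //; lra.
have /andP[p0 p1] := esc_bounds r x.
split.
  have [m0|m0] := leP 0 ((1 - e) * ln r - B); last first.
    apply: (@le_trans _ _ 0); first by rewrite mulr_le0_ge0 // ltW.
    by rewrite mulr_ge0 // ltW.
  have h : ((1 - e) * ln r - B) / kap * esc r x <= u x.
    apply: (esc_lower offr); first by rewrite divr_ge0 // ltW.
    move=> z zU; rewrite ler_pdivrMr // mulrC.
    have rn : r <= (nrm1 z)%:R.
      by apply: ns_le_nrm1; [lra|move: zU; rewrite /inU -leNgt].
    have h1 : ln r <= lg R z by rewrite /lg ler_ln ?posrE ?ltr_pwDl //; lra.
    have h2 : (1 - e) * ln r <= (1 - e) * lg R z by rewrite ler_wpM2l // subr_ge0.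
    have := HB z; rewrite ler_norml => /andP[_]; lra.
  move: h; rewrite mulrAC ler_pdivrMr // => h; by rewrite [leRHS]mulrC.
have rp : 0 < r by lra.
have r20 : 0 < r ^+ 2 by rewrite exprn_gt0.
have T0 := tail_ge0 r.
have h := @esc_upper r r1 offr ((B + (1 + e) * (ln r + 4)) / kap)
   (2 * (1 + e) / (kap * r ^+ 2) * tail r) (8 / tr * r ^+ 2) x.
have {}h : u x <= (B + (1 + e) * (ln r + 4)) / kap * esc r x +
    2 * (1 + e) / (kap * r ^+ 2) * tail r * (8 / tr * r ^+ 2).
  apply: h => //.
  - by rewrite divr_ge0 ?(ltW kap0) // addr_ge0 // mulr_ge0 ?addr_ge0.
  - apply: mulr_ge0 => //; apply: divr_ge0; apply: mulr_ge0 => //; try exact: ltW.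
    by rewrite addr_ge0.
  - by move=> y yU; exact: overshoot_bound.
  - by move=> n y yU; apply: Hrb => //; lra.
move: h; rewrite -(ler_pM2l kap0) => h; apply: le_trans h _.
(* The [r ^ 2] of the exit time cancels the [r ^ -2] of the overshoot, so only the tail moment is
   left. *)
have -> : kap * ((B + (1 + e) * (ln r + 4)) / kap * esc r x +
  2 * (1 + e) / (kap * r ^+ 2) * tail r * (8 / tr * r ^+ 2)) =
  (B + (1 + e) * (ln r + 4)) * esc r x + (1 + e) * (16 / tr * tail r).
  by field; rewrite (gt_eqF kap0) (gt_eqF rp) (gt_eqF tr_gt0).
rewrite lerD2l; have -> : 32 / tr * tail r = 2 * (16 / tr * tail r) by ring.
by apply: ler_wpM2r; [rewrite mulr_ge0 // divr_ge0 // ltW|lra].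
Qed.

End Exit.

(** * Law of the random walk *)

Lemma measurable_Z2 (B : set Z2) : measurable B.
Proof.
have -> : B = \bigcup_(z in B) ([set z.1] `*` [set z.2]).
  apply/seteqP; split => [z Bz|z [[a b] Bab] [/= za zb]]; first by exists z.
  by rewrite (surjective_pairing z) za zb.
rewrite bigcup_mkcond; apply: countable_bigcupT_measurable => [|z]; first exact: countableP.
by case: ifP => // _; apply: measurableX.
Qed.

Section StepLaw.
Context d (T : measurableType d) (R : realType) (P : probability T R).
Context (X : {RV P >-> Z2}).
Implicit Types (f g : Z2 -> R).

Lemma measurable_comp_Z2 d' (T' : measurableType d') (Y : {mfun T >-> Z2}) (f : Z2 -> T') :
  measurable_fun [set: T] (f \o Y).
Proof.
apply: (@measurableT_comp _ _ _ _ _ _ f) => //.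
by move=> _ B mB; exact: measurable_Z2.
Qed.

Definition rvEx f := Rintegral P [set: T] (f \o X).
Definition rvIg f := P.-integrable [set: T] (EFin \o (f \o X)).

Lemma measurable_EFin_Z2 f : measurable_fun [set: T] (EFin \o (f \o X)).
Proof. by apply: measurableT_comp => //; exact: measurable_comp_Z2. Qed.

Lemma rvIg_cst c : rvIg (fun=> c).
Proof. exact: finite_measure_integrable_cst. Qed.

Lemma rvEx_cst c : rvEx (fun=> c) = c.
Proof.
by rewrite /rvEx /comp Rintegral_cst // [X in fine X](@probability_setT _ _ _ P) mulr1.
Qed.

Lemma rvIgD f g : rvIg f -> rvIg g -> rvIg (fun v => f v + g v).
Proof. exact: integrableD. Qed.

Lemma rvExD f g : rvIg f -> rvIg g -> rvEx (fun v => f v + g v) = rvEx f + rvEx g.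
Proof. exact: RintegralD. Qed.

Lemma rvIgZ c f : rvIg f -> rvIg (fun v => c * f v).
Proof. by move=> If; apply: (integrableZl _ c If). Qed.

Lemma rvExZ c f : rvIg f -> rvEx (fun v => c * f v) = c * rvEx f.
Proof. exact: RintegralZl. Qed.

Lemma rvIg_le f g : rvIg g -> (forall v, `|f v| <= g v) -> rvIg f.
Proof.
move=> Ig fg; apply: (le_integrable _ (measurable_EFin_Z2 f) _ Ig) => // w _ /=.
by rewrite lee_fin; apply: le_trans (fg _) (ler_norm _).
Qed.

Lemma rvEx_le f g : rvIg f -> rvIg g -> (forall v, f v <= g v) -> rvEx f <= rvEx g.
Proof. by move=> If Ig fg; apply: le_Rintegral. Qed.

Lemma rvEx_cvg (u : nat -> Z2 -> R) f g : rvIg g ->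
  (forall n v, `|u n v| <= g v) -> (forall v, u ^~ v @ \oo --> f v) ->
  (fun n => rvEx (u n)) @ \oo --> rvEx f.
Proof.
move=> Ig ug uf.
have fg v : `|f v| <= g v.
  have /cvg_norm H := uf v; apply: (cvgr_to_le H); apply: nearW => n; exact: ug.
have If := rvIg_le Ig fg.
apply: (@fine_cvg _ _ _ _ (fun n => \int[P]_w ((u n \o X) w)%:E)%E).
rewrite fineK; last exact: integrable_fin_num.
apply: (@dominated_cvg _ _ _ P setT measurableT _ (EFin \o (f \o X)) (EFin \o (g \o X))) => //.
- by move=> n; exact: (measurable_EFin_Z2 (u n)).
- by move=> w _ /=; apply: cvg_EFin; [exact: nearW|exact: uf].
- by move=> n w _ /=; rewrite lee_fin.
Qed.

Definition rvlaw : step_law R :=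
  StepLaw rvIg_cst rvEx_cst rvIgD rvExD rvIgZ rvExZ rvIg_le rvEx_le rvEx_cvg.

(** Partition by the value of one step, enumerated through [pickle] because countable additivity is
    used for sequences. *)
Definition part (n : nat) : set Z2 := [set v : Z2 | pickle v = n].
Definition part_val f (n : nat) : R := if pickle_inv n is Some v then f v else 0.

Lemma part_valE f v : part_val f (pickle v) = f v.
Proof. by rewrite /part_val pickleK_inv. Qed.

Lemma part_trivIset (E : set T) (Y : T -> Z2) :
  trivIset setT (fun n => E `&` Y @^-1` part n).
Proof. by move=> i j _ _ [w [[_ /= wi] [_ /= wj]]]; rewrite -wi -wj. Qed.

Lemma part_bigcup (E : set T) (Y : T -> Z2) : \bigcup_n (E `&` Y @^-1` part n) = E.
Proof.
by apply/seteqP; split=> [w [n _ []]//|w Ew]; exists (pickle (Y w)).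
Qed.

Lemma measurable_preimage_Z2 (Y : {RV P >-> Z2}) B : measurable (Y @^-1` B).
Proof. by rewrite -[Y @^-1` B]setTI; apply: measurable_funPT => //; exact: measurable_Z2. Qed.

Lemma P_part (E : set T) (Y : {RV P >-> Z2}) : measurable E ->
  P E = (\sum_(0 <= n <oo) P (E `&` Y @^-1` part n))%E.
Proof.
move=> mE0; rewrite -[in LHS](part_bigcup E Y); apply: measure_semi_bigcup.
- by move=> n; apply: measurableI => //; exact: measurable_preimage_Z2.
- exact: part_trivIset.
- by rewrite part_bigcup.
Qed.

Lemma rvEx_part f : rvIg f -> (forall v, 0 <= f v) ->
  ((rvEx f)%:E = \sum_(0 <= n <oo) (part_val f n)%:E * P (X @^-1` part n))%E.
Proof.
move=> If f0; rewrite /rvEx /Rintegral fineK; last exact: integrable_fin_num.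
rewrite -[in LHS](part_bigcup setT X) ge0_integral_bigcup; first last.
- exact: part_trivIset.
- by move=> w _; rewrite lee_fin; exact: f0.
- by apply: measurable_funTS; exact: measurable_EFin_Z2.
- by move=> n; apply: measurableI => //; exact: measurable_preimage_Z2.
apply: eq_eseriesr => n _; rewrite setTI.
rewrite -integral_cst; last exact: measurable_preimage_Z2.
by apply: eq_integral => w; rewrite inE /= => <-; rewrite part_valE.
Qed.

End StepLaw.

Arguments rvlaw : simpl never.

(** * Markov property of the walk *)

Section PathLaw.
Context d (T : measurableType d) (R : realType) (P : probability T R).
Context (X : nat -> {RV P >-> Z2}) (hiid : iid X).
Implicit Types (bs : seq (pred Z2)) (h : nat -> Z2) (x : Z2).
Local Notation L := (rvlaw (X 0%N)).

(** The history is fixed value by value: by countability no other conditioning is needed, and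
    independence gives its probability as a product. *)
Definition past h k : set T := [set w | forall i, (i < k)%N -> X i w = h i].

Fixpoint steps bs k x (w : T) : Prop :=
  if bs is b :: bs' then b (x + X k w) /\ steps bs' k.+1 (x + X k w) w else True.

Definition pathop bs : Z2 -> R := foldr (fun b f => kop L b f) (fun=> 1) bs.

Fixpoint initial k : {fset nat} := if k is k'.+1 then (k' |` initial k')%fset else fset0.

Lemma in_initial k i : (i \in initial k) = (i < k)%N.
Proof.
elim: k => [|k IH] /=; first by rewrite in_fset0 ltn0.
by rewrite in_fset1U IH ltnS [RHS]leq_eqVlt.
Qed.

Lemma measurable_past h k : measurable (past h k).
Proof.
have -> : past h k = \bigcap_(i in [set i | (i < k)%N]) (X i @^-1` [set h i]).
  by apply/seteqP; split=> w H i; have := H i.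
by apply: bigcap_measurableType => i _; exact: measurable_preimage_Z2.
Qed.

Lemma P_past h k : P (past h k) = (\prod_(i <- initial k) P (X i @^-1` [set h i]))%E.
Proof.
rewrite -hiid.1; congr (P _).
by apply/seteqP; split=> w H i; have := H i; rewrite /= in_initial.
Qed.

Lemma P_pastS h k :
  P (past h k.+1) = (P (past h k) * P (X 0%N @^-1` [set h k]))%E.
Proof.
rewrite !P_past /= big_fsetU1 /=; last by rewrite in_initial ltnn.
by rewrite hiid.2 muleC.
Qed.

Lemma measurable_steps bs k x : measurable [set w | steps bs k x w].
Proof.
elim: bs k x => [|b bs IH] k x /=; first exact: measurableT.
have -> : [set w | b (x + X k w) /\ steps bs k.+1 (x + X k w) w] =
    \bigcup_(v in [set v | b (x + v)])
      ((X k @^-1` [set v]) `&` [set w | steps bs k.+1 (x + v) w]).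
  apply/seteqP; split=> [w [bw sw]|w [v /= bv [wv sw]]]; last by rewrite wv.
  by exists (X k w).
rewrite bigcup_mkcond; apply: countable_bigcupT_measurable => [|z]; first exact: countableP.
by case: ifP => // _; apply: measurableI => //; exact: measurable_preimage_Z2.
Qed.

Lemma pathop_bnd bs : bnd 1 (pathop bs).
Proof. by elim: bs => [|b bs IH] /=; [exact: one_bnd|exact: kop_bnd]. Qed.

Lemma pathop_ge0 bs x : 0 <= pathop bs x.
Proof.
elim: bs x => [|b bs IH] x /=; first exact: ler01.
apply: (@Ex_ge0 _ L).
  by apply: (Ig_sh _ _ (bnd_res b (pathop_bnd bs))).
by move=> v; rewrite /res; case: ifP.
Qed.

(** The Markov property, by decomposing according to the next step. The history is arbitrary because
    each step of the induction lengthens it. *)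
Lemma steps_past bs k h x :
  P (past h k `&` [set w | steps bs k x w]) = (P (past h k) * (pathop bs x)%:E)%E.
Proof.
elim: bs k h x => [|b bs IH] k h x.
  have -> : [set w | steps [::] k x w] = setT by [].
  by rewrite setIT mule1.
rewrite (@P_part _ _ _ P _ (X k)); last first.
  by apply: measurableI; [exact: measurable_past|exact: measurable_steps].
have bF := bnd_res b (pathop_bnd bs).
rewrite [pathop _ x](_ : _ = rvEx (X 0%N) (fun v => res b (pathop bs) (x + v))) //.
rewrite rvEx_part; last first.
- by move=> v; rewrite /res; case: ifP => // _; exact: pathop_ge0.
- exact: (@Ig_sh _ L _ _ x bF).
have Pf : P (past h k) \is a fin_num by apply: fin_num_measure; exact: measurable_past.
rewrite -(fineK Pf) -nneseriesZl; last first.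
  move=> n _; apply: mule_ge0 => //; rewrite lee_fin /part_val.
  by case: pickle_inv => // v; rewrite /res; case: ifP => // _; exact: pathop_ge0.
apply: eq_eseriesr => n _; rewrite (fineK Pf) /part_val.
case E : (pickle_inv n : option Z2) => [v|]; last first.
  rewrite mul0e mule0 (_ : _ `&` _ = set0) ?measure0 //.
  by apply/seteqP; split=> // w [_ /= wn]; move: E; rewrite -wn pickleK_inv.
have pE : part n = [set v].
  apply/seteqP; split=> z /= => [zn|->].
    by move: E; rewrite -zn pickleK_inv => -[].
  by have := @pickle_invK Z2 n; rewrite E.
rewrite pE; pose h' i := if i == k then v else h i.
have hk : past h' k = past h k.
  apply/seteqP; split=> w H i ik; have := H i ik; rewrite /h' ?ltn_eqF //.
have pS : past h k `&` X k @^-1` [set v] = past h' k.+1.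
  rewrite -hk; apply/seteqP; split=> [w [H /= Hv] i|w H].
    by rewrite ltnS leq_eqVlt => /predU1P[->|/H //]; rewrite Hv /h' eqxx.
  split=> [i ik|]; first exact: H (ltnW ik).
  by have := H k (ltnSn k); rewrite /h' eqxx.
have hS : P (past h' k.+1) = (P (past h k) * P (X 0%N @^-1` [set v]))%E.
  by rewrite P_pastS hk /h' eqxx.
rewrite /res; case: ifP => bv; last first.
  rewrite mul0e mule0 (_ : _ `&` _ = set0) ?measure0 //.
  by apply/seteqP; split=> // w [[_ [/= bw _]] /= wv]; move: bw; rewrite wv bv.
have -> : past h k `&` [set w | steps (b :: bs) k x w] `&` X k @^-1` [set v] =
    past h' k.+1 `&` [set w | steps bs k.+1 (x + v) w].
  rewrite -pS; apply/seteqP; split=> w /=.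
    by move=> [[H [bw sw]] wv]; split; [split|rewrite -wv].
  by move=> [[H wv] sw]; rewrite wv.
by rewrite IH hS -!muleA [X in (_ * X)%E]muleC.
Qed.

Lemma P_steps bs x : P [set w | steps bs 0 x w] = (pathop bs x)%:E.
Proof.
have := @steps_past bs 0 (fun=> 0) x.
by rewrite [past _ _](_ : _ = setT) ?setTI ?probability_setT ?mul1e // -subTset.
Qed.

Lemma walk0 x w : walk X x w 0 = x.
Proof. by rewrite /walk big_ord0 addr0. Qed.

Lemma walkS x w n : walk X x w n.+1 = walk X x w n + X n w.
Proof. by rewrite /walk big_ord_recr /= addrA. Qed.

Lemma stepsE (b0 : pred Z2) bs x w : steps bs 0 x w <->
  forall i, (i < size bs)%N -> nth b0 bs i (walk X x w i.+1).
Proof.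
suff H k y : y = walk X x w k -> steps bs k y w <->
    forall i, (i < size bs)%N -> nth b0 bs i (walk X x w (k + i.+1)).
  exact: H (esym (walk0 x w)).
elim: bs k y => [|b bs IH] k y yE //=.
have E : y + X k w = walk X x w k.+1 by rewrite walkS yE.
split=> [[bw /(IH _ _ E) H] [_|i]|H].
- by rewrite addn1 -E.
- by rewrite ltnS => /H; rewrite addSnnS.
- split; first by have := H 0%N isT; rewrite addn1 -E.
  by apply/(IH _ _ E) => i ib; rewrite addSnnS; exact: H i.+1 ib.
Qed.

Lemma pathop_nseq n b bs : pathop (nseq n b ++ bs) = iter n (kop L b) (pathop bs).
Proof. by elim: n => //= n ->. Qed.

Definition stay_then (b c : pred Z2) n x : set T :=
  [set w | (forall i, (1 <= i <= n)%N -> b (walk X x w i)) /\ c (walk X x w n.+1)].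

Lemma stay_thenE (b c : pred Z2) n x :
  stay_then b c n x = [set w | steps (nseq n b ++ [:: c]) 0 x w].
Proof.
apply/seteqP; split=> w /=.
  move=> [H1 H2]; apply/(stepsE b) => i; rewrite size_cat size_nseq addn1 ltnS nth_cat size_nseq.
  case: ltnP => [ni _|ni i_n]; first by rewrite nth_nseq ni; exact: H1.
  by have -> : i = n by [apply/eqP; rewrite eqn_leq ni i_n]; rewrite subnn.
move=> /(stepsE b) H; rewrite size_cat size_nseq addn1 in H; split=> [[//|i] /andP[_ ni]|].
  by have := H i (ltnW ni); rewrite nth_cat size_nseq ni nth_nseq ni.
by have := H n (ltnSn n); rewrite nth_cat size_nseq ltnn subnn.
Qed.

Lemma measurable_stay_then (b c : pred Z2) n x : measurable (stay_then b c n x).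
Proof. by rewrite stay_thenE; exact: measurable_steps. Qed.

Lemma P_stay_then (b c : pred Z2) n x :
  P (stay_then b c n x) = (iter n (kop L b) (conv L (fun z => (c z)%:R)) x)%:E.
Proof.
have -> : conv L (fun z => (c z)%:R) = pathop [:: c].
  apply/funext => z; congr (Ex L _); apply/funext => v.
  by rewrite /res; case: (c _).
by rewrite -pathop_nseq -P_steps stay_thenE.
Qed.

End PathLaw.

(** * Expansion of the escape probability *)

Section EscapeExpansion.
Context (R : realType).

(** Here [s] stands for the escape probability, [l] for [ln r] and [m] for [kap * u x]. The lower
    bound gives [s * l <= 2 m] because [e <= 1/4] and [4 B <= l]; inserted into the additive errors,
    this makes them relative. The [8] leaves room for [4 (1 + e)]. *)
Lemma ratio_bound (e B l m s w : R) : 0 <= e <= 1 / 4 -> 0 <= B -> 0 < l -> 4 * B <= l ->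
  0 < m -> 0 <= s -> 0 <= w ->
  ((1 - e) * l - B) * s <= m -> m <= (B + (1 + e) * (l + 4)) * s + w ->
  `|s * l / m - 1| <= 2 * e + 2 * (B + 8) / l + w / m.
Proof.
move=> /andP[e0 e4] B0 l0 Bl m0 s0 w0 H1 H2.
have sl : s * l <= 2 * m.
  have : (1 / 2 * l) * s <= ((1 - e) * l - B) * s.
    by apply: ler_wpM2r => //; have := ler_wpM2r (ltW l0) e4; lra.
  lra.
have mE : s * l / m - 1 = (s * l - m) / m by rewrite mulrBl divff // gt_eqF.
have bE : (2 * e + 2 * (B + 8) / l) * m = (e * l + (B + 8)) * (2 * m / l).
  by field; rewrite gt_eqF.
have s2 : s <= 2 * m / l by rewrite ler_pdivlMr.
have es : (e * l + (B + 8)) * s <= (2 * e + 2 * (B + 8) / l) * m.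
  rewrite bE; apply: ler_wpM2l s2; apply: addr_ge0; last lra.
  exact: mulr_ge0 e0 (ltW l0).
have e8 : e * s <= 1 / 4 * s by apply: ler_wpM2r.
have wE : (2 * e + 2 * (B + 8) / l + w / m) * m = (2 * e + 2 * (B + 8) / l) * m + w.
  by rewrite mulrDl divfK // gt_eqF.
rewrite mE normrM (ger0_norm (x := m^-1)) ?invr_ge0 ?(ltW m0) // ler_pdivrMr // wE.
by rewrite ler_norml; apply/andP; split; nra.
Qed.

Lemma ratioK (s l m : R) : l != 0 -> m != 0 -> s = m / l * (s * l / m).
Proof. by move=> l0 m0; field; rewrite l0 m0. Qed.

Lemma le_ln_expR (M r : R) : expR M <= r -> M <= ln r.
Proof.
by move=> Mr; rewrite -[M]expRK ler_ln // posrE ?expR_gt0 // (lt_le_trans (expR_gt0 M)).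
Qed.

(** The theorem at the level of the step law, before [esc] and the Green series are identified with
    probabilities of path events. *)
Lemma escape_expansion (L : step_law R) (IL : Ig L (nsq R)) (irrL : irr L)
    (mean1 : Ex L (fun v => v.1%:~R) = 0) (mean2 : Ex L (fun v => v.2%:~R) = 0)
    (A : seq Z2) (xi0 : Z2) : uniq A -> xi0 \in A ->
  let q11 := Ex L (fun v => v.1%:~R * v.1%:~R) in
  let q12 := Ex L (fun v => v.1%:~R * v.2%:~R) in
  let q22 := Ex L (fun v => v.2%:~R * v.2%:~R) in
  let kap := pi * Num.sqrt (q11 * q22 - q12 ^+ 2) in
  let off z := z \notin A in
  exists (u : Z2 -> R) (G : Z2 -> Z2 -> R) (err : R -> Z2 -> R),
  [/\ forall x y, (fun n => \sum_(k < n) iter k (kop L off) (fun z => dirac R (z - y)) x)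
        @ \oo --> G x y,
      forall x, vanish (fun y => G x y - u x),
      exists r0, forall r, r0 <= r -> forall x, inU r x ->
        esc L off r x = kap * u x / ln r * (1 + err r x),
      forall eps, 0 < eps -> exists r0, forall r, r0 <= r -> forall x, inU r x ->
        `|err r x| <= eps
    & Ig L (fun v => nsq R v * lg R v) -> exists C r0, forall r, r0 <= r ->
        forall x, inU r x -> `|err r x| <= C / ln r].
Proof.
move=> uA xiA q11 q12 q22 kap off.
have [a [K [Ha _ Hincr Hvan [Hlg Hlog]]]] := potential_kernel_exists IL irrL mean1 mean2.
have Ilg : Ig L (lg R).
  apply: (Ig_le IL) => v; rewrite ger0_norm ?lg_ge0 //.
  apply: le_trans (nrm1_le_sq R v); exact: lg_le_nrm1.
have kap0 : 0 < kap by rewrite mulr_gt0 ?pi_gt0 // sqrtr_gt0; exact: det_gt0.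
rewrite -/q11 -/q12 -/q22 -/kap in Hlg Hlog; move: kap kap0 Hlg Hlog => k kap0 Hlg Hlog.
have tr0 : 0 < q11 + q22.
  apply: ltr_wpDr (q11_gt0 IL irrL); apply: Ex_ge0 => [|v]; first exact: Ig_v22.
  by rewrite -expr2 sqr_ge0.
pose u := uf L A xi0 a.
have [c c0 gap] := uf_gap Ilg irrL uA xiA kap0 Ha Hincr Hvan Hlg.
have u0 x : 0 <= u x := uf_ge0 Ilg irrL uA xiA kap0 Ha Hincr Hvan Hlg x.
have ul : lgb u := uf_lgb Ilg uA xi0 Hincr.
have uK x : kop L off u x = u x := kop_uf Ilg uA xiA Ha Hincr x.
have offU : exists r, forall z, ~~ @inU R r z -> off z.
  exists (1 + \sum_(y <- A) ns R y) => z; apply: contra => zA.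
  have S0 : 0 <= \sum_(y <- rem z A) ns R y by apply: sumr_ge0 => y _; exact: ns_ge0.
  rewrite /inU (perm_big _ (perm_to_rem zA)) big_cons /=.
  by have := ns_ge0 R z; nra.
have esc0 r x : 0 <= esc L off r x by case/andP: (esc_bounds IL off r x).
have asym e B := @esc_asymptotics _ _ IL mean1 mean2 tr0 off u k kap0 ul u0 uK e B.
have D0 : 0 < 32 / (q11 + q22) by rewrite divr_gt0.
move: (32 / (q11 + q22)) D0 asym => D D0 asym; clear tr0.
(* Where [u] vanishes, so does [esc] for large [r]; the value [0] keeps the formula true there
   without a division by [0]. *)
pose err r x := if u x == 0 then 0 else esc L off r x * ln r / (k * u x) - 1.
have kc0 : 0 < k * c by rewrite mulr_gt0.
have main e B : 0 <= e <= 1 / 4 -> (forall x, `|lg R x - k * a x| <= B + e * lg R x) ->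
    exists B', 0 <= B' /\ exists r0, 1 < r0 /\ forall r, r0 <= r -> forall x, inU r x ->
      [/\ 0 < ln r, esc L off r x = k * u x / ln r * (1 + err r x) &
      `|err r x| <= 2 * e + 2 * (B' + 8) / ln r + D * tail L r / (k * c)].
  move=> e4 HB; have e0 : 0 <= e by case/andP: e4.
  have [B1 HB1] := uf_lg Ilg uA xi0 kap0 e0 HB.
  pose B' := `|B1|; have B0 : 0 <= B' by exact: normr_ge0.
  have HB' x : `|lg R x - k * u x| <= B' + e * lg R x.
    by apply: le_trans (HB1 x) _; rewrite lerD2r ler_norm.
  have e1 : 0 <= e <= 1 by case/andP: e4 => _; move: e0; clear => *; apply/andP; split; lra.
  have [r0 [r1 H]] := asym e B' e1 B0 HB' offU.
  exists B'; split=> //; exists (r0 + expR (4 * B' + 1)).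
  split; first by have := expR_gt0 (4 * B' + 1 : R); move: r1; clear => *; lra.
  move=> r rr x xU; have E0 := expR_gt0 (4 * B' + 1 : R).
  have rr0 : r0 <= r by move: rr E0; clear => *; lra.
  have [H1 H2] := H r rr0 x xU.
  have lr : 4 * B' + 1 <= ln r by apply: le_ln_expR; move: rr r1; clear => *; lra.
  have l0 : 0 < ln r by move: lr B0; clear => *; lra.
  have B4 : 4 * B' <= ln r by move: lr; clear => *; lra.
  have w0 : 0 <= D * tail L r by rewrite mulr_ge0 ?(ltW D0) ?tail_ge0.
  have R0 : 0 <= 2 * e + 2 * (B' + 8) / ln r by move: e0 B0 l0; clear => *; apply: addr_ge0; [lra|apply: divr_ge0; lra].
  rewrite /err; have [ux|ux] := eqVneq (u x) 0.
    split=> //; last by rewrite normr0 addr_ge0 // divr_ge0 // ltW.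
    (* With [u x = 0] the lower bound says that [esc] times a coefficient, positive by the choice of
       [r], is at most [0]. *)
    rewrite ux mulr0 !mul0r; apply/eqP; rewrite eq_le esc0 andbT.
    rewrite ux mulr0 in H1; have e14 : (3 / 4 * ln r - B') * esc L off r x <= 0.
      apply: le_trans H1; apply: ler_wpM2r => //.
      by case/andP: e4 => _ e4; have := ler_wpM2r (ltW l0) e4; clear => *; lra.
    rewrite leNgt; apply/negP => ep.
    have : 0 < (3 / 4 * ln r - B') * esc L off r x by apply: mulr_gt0 => //; move: lr B0; clear => *; lra.
    by rewrite ltNge e14.
  (* The gap makes the tail error, divided by [u x], uniform in [x]. *)
  have uc : c <= u x by case: (gap x) => // /eqP; rewrite -/u (negbTE ux).
  have m0 : 0 < k * u x by rewrite mulr_gt0 // (lt_le_trans c0).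
  split=> //; first by rewrite (addrC 1) subrK; apply: ratioK; rewrite gt_eqF.
  have := ratio_bound e4 B0 l0 B4 m0 (esc0 r x) w0 H1 H2.
  move=> /le_trans; apply; rewrite lerD2l; apply: ler_wpM2l => //.
  by rewrite lef_pV2 ?posrE // ler_pM2l.
exists u, (fun x y => greenf L A xi0 a y x), err; split.
- by move=> x y; exact: (@green_cvg _ _ Ilg irrL _ uA _ xiA _ _ _ kap0 Ha Hincr Hlg).
- by move=> x; exact: (greenf_uf Ilg irrL uA xiA kap0 Ha Hincr Hvan Hlg x).
- have [B HB] := Hlg (1 / 4) (divr_gt0 ltr01 (ltr0n _ 4)).
  have [|B' [_ [r0 [_ H]]]] := main (1 / 4) B _ HB; first by rewrite lexx divr_ge0.
  by exists r0 => r rr x xU; have [] := H r rr x xU.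
(* The three errors share [eps]: each of them is at most [eps / 4]. *)
- move=> eps eps0; pose e := Num.min (1 / 4) (eps / 8).
  have ee : e <= eps / 8 by rewrite /e ge_min lexx orbT.
  have e0 : 0 < e by rewrite /e lt_min !divr_gt0.
  have e4 : 0 <= e <= 1 / 4 by rewrite ltW //= /e ge_min lexx.
  have [B HB] := Hlg e e0.
  have [B' [B0 [r0 [r1 H]]]] := main e B e4 HB.
  have t0 : 0 < eps / 4 * (k * c) / D.
    by apply: divr_gt0 => //; apply: mulr_gt0 => //; rewrite divr_gt0.
  have [r2 r20 Ht] := tail_small IL t0.
  exists (r0 + r2 + expR (8 * (B' + 8) / eps)) => r rr x xU.
  have E0 := expR_gt0 (8 * (B' + 8) / eps).
  have [rr0 rr2] : r0 <= r /\ r2 <= r.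
    by move: rr E0 r1 r20; clear => *; split; lra.
  have [l0 _] := H r rr0 x xU; move=> /le_trans; apply.
  have lr : 8 * (B' + 8) / eps <= ln r.
    by apply: le_ln_expR; move: rr r1 r20; clear => *; lra.
  have T1 : 2 * (B' + 8) / ln r <= eps / 4.
    by rewrite ler_pdivrMr //; move: lr; rewrite ler_pdivrMr //; clear => *; lra.
  have T2 : D * tail L r / (k * c) <= eps / 4.
    rewrite ler_pdivrMr // mulrC -ler_pdivlMr //; apply: Ht; exact: rr2.
  by move: ee T1 T2 eps0; clear => *; lra.
(* Under the logarithmic moment the kernel expansion has bounded error, so [e = 0] is allowed, and
   the tail is itself [O(1 / ln r)]. *)
- move=> Inl; have [B HB] := Hlog Inl.
  have [||B' [B0 [r0 [r1 H]]]] := main 0 B.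
  - by rewrite lexx divr_ge0.
  - by move=> x; rewrite mul0r addr0.
  exists (2 * (B' + 8) + D * Ex L (fun v => nsq R v * lg R v) / (k * c)), r0 => r rr x xU.
  have [l0 _] := H r rr x xU; move=> /le_trans; apply.
  rewrite mulr0 add0r (mulrDl (2 * (B' + 8))) lerD2l (mulrAC (D * _)); apply: ler_wpM2r.
    by rewrite invr_ge0 ltW.
  rewrite -[leRHS]mulrA (ler_pM2l D0).
  by apply: (tail_log IL Inl); exact: lt_le_trans r1 rr.
Qed.

End EscapeExpansion.

(** * Moment hypotheses in terms of the step law *)

Section Moments.
Context d (T : measurableType d) (R : realType) (P : probability T R).
Context (X : nat -> {RV P >-> Z2}).
Implicit Types (f : Z2 -> R) (z : Z2).
Local Notation L := (rvlaw (X 0%N)).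

Lemma expectation_rvEx f : fine 'E_P[fun w => f (X 0%N w)]%E = Ex L f.
Proof. by rewrite unlock. Qed.

Lemma expectation_Ig f : (forall v, 0 <= f v) ->
  ('E_P[fun w => f (X 0%N w)] < +oo)%E -> Ig L f.
Proof.
rewrite unlock => f0 fE; apply/integrableP; split; first exact: measurable_EFin_Z2.
by move: fE; congr (_ < _)%E; apply: eq_integral => w _; rewrite /= ger0_norm.
Qed.

Lemma enorm_ge0 z : 0 <= enorm R z. Proof. exact: sqrtr_ge0. Qed.

Lemma enorm_sqr z : enorm R z ^+ 2 = ns R z.
Proof.
rewrite sqr_sqrtr; last by apply: sumr_ge0 => i _; exact: sqr_ge0.
by rewrite !big_ord_recl big_ord0 addr0.
Qed.

Lemma disc_inU (r : R) z : 0 < r -> disc r z <-> inU r z.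
Proof.
move=> r0; rewrite /inU -enorm_sqr ltr_sqr ?nnegrE ?enorm_ge0 ?ltW //.
Qed.

Lemma enorm_ge1 z : z != 0 -> 1 <= enorm R z.
Proof.
move=> z0; rewrite -(ler_pXn2r (n:=2)) ?nnegrE ?enorm_ge0 // expr1n enorm_sqr.
have n1 : (1 : R) <= (nrm1 z)%:R by rewrite ler1n lt0n nrm1_eq0.
have z12 : 0 < ns R z.
  have := nsq_ns R z; have : 1 <= nsq R z by rewrite /nsq expr_ge1 // ler0n.
  lra.
have nsE : ns R z = (z.1 ^+ 2 + z.2 ^+ 2)%:~R by rewrite intrD !rmorphXn.
by move: z12; rewrite nsE ltr0z ler1z gtz0_ge1.
Qed.

Lemma finite_variance_Ig : finite_variance X -> Ig L (nsq R).
Proof.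
move=> fv; have I : Ig L (fun z => enorm R z ^+ 2).
  by apply: expectation_Ig fv => v; exact: sqr_ge0.
apply: (Ig_le (IgZ 2 I)) => z; rewrite ger0_norm ?nsq_ge0 // enorm_sqr.
exact: nsq_ns.
Qed.

Lemma centered_mean : centered X ->
  Ex L (fun v => v.1%:~R) = 0 /\ Ex L (fun v => v.2%:~R) = 0.
Proof.
move=> c; rewrite -!expectation_rvEx; split.
  by have -> : 'E_P[fun w => (X 0%N w).1%:~R]%E = 0%E by exact: (c ord0).
by have -> : 'E_P[fun w => (X 0%N w).2%:~R]%E = 0%E by exact: (c ord_max).
Qed.

(** Centring turns the covariances into second moments. *)
Lemma kappaE : centered X -> kappa X =
  pi * Num.sqrt (Ex L (fun v => v.1%:~R * v.1%:~R) * Ex L (fun v => v.2%:~R * v.2%:~R) -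
    Ex L (fun v => v.1%:~R * v.2%:~R) ^+ 2).
Proof.
move=> c; rewrite /kappa; congr (_ * Num.sqrt _).
have cE i j : fine (covariance P (coordRV X i) (coordRV X j)) =
    Ex L (fun v => (coordZ2 i v)%:~R * (coordZ2 j v)%:~R).
  rewrite -expectation_rvEx unlock !c; congr (fine 'E_P[_]%E).
  apply/funext => w; transitivity ((coordRV X i w - 0) * (coordRV X j w - 0)) => //.
  by rewrite !subr0.
rewrite (expand_det_row _ ord0) !big_ord_recl big_ord0 /cofactor !det_mx11 !mxE !cE /=.
rewrite /coordZ2 /= expr0 expr1 !mul1r mulN1r addr0 mulrN expr2; congr (_ - _ * _).
by congr (Ex L _); apply/funext => v; rewrite mulrC.
Qed.

Lemma lg_enorm z : z != 0 -> lg R z <= ln (enorm R z) + 2.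
Proof.
move=> z0; have n1 := enorm_ge1 z0.
have n2 : (nrm1 z)%:R <= 2 * enorm R z.
  by apply: nrm1_le_ns; [exact: enorm_ge0|rewrite enorm_sqr].
(* Puts the factor of [1 + nrm1 z <= 3 |z|] into the additive [2]. *)
have e3 : 3 <= expR 2 :> R by have := expR_ge1Dx (2 : R); lra.
rewrite -[X in _ + X]expRK -lnM ?posrE ?expR_gt0 //; last lra.
rewrite /lg ler_ln ?posrE; last 2 first.
- by rewrite ltr_pwDl.
- by rewrite mulr_gt0 ?expR_gt0 //; lra.
have := ler_wpM2l (enorm_ge0 z) e3; lra.
Qed.

(** Nonzero lattice points have norm at least [1], so the integrand is nonnegative and a finite
    expectation means integrability. *)
Lemma finite_log_variance_Ig : finite_variance X -> finite_log_variance X ->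
  Ig L (fun v => nsq R v * lg R v).
Proof.
move=> fv fl; have I2 := finite_variance_Ig fv.
have ln0 z : 0 <= enorm R z ^+ 2 * ln (enorm R z).
  have [->|z0] := eqVneq z 0; last by rewrite mulr_ge0 ?sqr_ge0 // ln_ge0 // enorm_ge1.
  by rewrite enorm_sqr /ns !expr0n /= addr0 mul0r.
have I : Ig L (fun z => enorm R z ^+ 2 * ln (enorm R z)) by exact: expectation_Ig fl.
apply: (Ig_le (IgD (IgZ 2 I) (IgZ 2 I2))) => z.
have [->|z0] := eqVneq z 0.
  by rewrite /nsq nrm1_0 expr0n /= mul0r normr0 mulr0 addr0 mulr_ge0 ?ln0.
rewrite ger0_norm ?mulr_ge0 ?nsq_ge0 ?lg_ge0 //.
have := nsq_ns R z; have := lg_enorm z0; rewrite -enorm_sqr => h1 h2.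
have l0 : 0 <= ln (enorm R z) by rewrite ln_ge0 // enorm_ge1.
have h3 := ler_wpM2l (nsq_ge0 R z) h1; have h4 := ler_wpM2r l0 h2; lra.
Qed.

End Moments.

(** * Irreducibility and stopping times as path events *)

Section Bridge.
Context d (T : measurableType d) (R : realType) (P : probability T R).
Context (X : nat -> {RV P >-> Z2}) (hiid : iid X).
Implicit Types (A B : set Z2) (s : nat -> Z2) (x y z : Z2).
Local Notation L := (rvlaw (X 0%N)).

Lemma irreducible_irr : irreducible X -> irr L.
Proof.
(* Since [retn] describes paths that end at the origin, the target for a start at [0] is [- x]. *)
move=> hirr x; have [[//|n] _] := hirr (- x); rewrite /Pr.
have := P_stay_then hiid predT (pred1 (- x)) n 0 => H h; exists n.+1 => //.
rewrite -lte_fin; apply: lt_le_trans h _.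
have -> : [set w | walk X 0 w n.+1 = - x] = stay_then X predT (pred1 (- x)) n 0.
  apply/seteqP; split=> w /=; last by move=> [_ /eqP].
  by move=> wx; split=> //; apply/eqP.
rewrite H lee_fin.
have -> : (fun z => (pred1 (- x) z)%:R) = (fun z => dirac R (z + x)).
  by apply/funext => z; rewrite /dirac /= addr_eq0.
have -> : kop L predT = conv L by [].
by rewrite -iterSr iter_conv_sh add0r.
Qed.

Lemma sigma_gtP A s n : (n%:R%:E < sigma R A s)%E <->
  forall m, (1 <= m <= n)%N -> ~ A (s m).
Proof.
split=> [ns m /andP[m1 mn] Am|H].
  move: ns; rewrite ltNge => /negP; apply; apply: le_trans (_ : m%:R%:E <= _)%E.
    by apply: ereal_inf_lbound; exists m.
  by rewrite lee_fin ler_nat.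
apply: (@lt_le_trans _ _ n.+1%:R%:E); first by rewrite lte_fin ltr_nat.
apply/ereal_infP => _ [m [m1 Am] <-]; rewrite lee_fin ler_nat ltnNge.
by apply/negP => mn; apply: (H m); rewrite ?m1.
Qed.

(** As [A] lies inside [B], the exit point is off [A], and the comparison is decided at the first
    exit time. *)
Lemma tau_lt_sigmaP A B s : A `<=` B -> (tau R B s < sigma R A s)%E <->
  exists n, (forall i, (1 <= i <= n)%N -> ~ A (s i) /\ B (s i)) /\ ~ B (s n.+1).
Proof.
move=> AB; split=> [/ereal_inf_lt [_ [n [n1 Bn] <-] /sigma_gtP H]|[n [H Bn]]].
- have ex : exists m, (0 < m)%N && `[< ~ B (s m) >] by exists n; rewrite n1; apply/asboolP.
  case: (ex_minnP ex) => -[//|m] /asboolP Bm mmin; exists m; split=> // i /andP[i1 im]; split.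
    apply: H; rewrite i1 (leq_trans im) // (leq_trans (leqnSn m)) // mmin // n1.
    exact/asboolP.
  apply: contrapT => Bi; have := mmin i; rewrite i1 /= ltnNge im.
  by move=> /(_ _)/negP; apply=> //; apply/asboolP.
- apply: (@le_lt_trans _ _ n.+1%:R%:E); first by apply: ereal_inf_lbound; exists n.+1.
  apply/sigma_gtP => m /andP[m1]; rewrite leq_eqVlt => /predU1P[-> /AB//|mn].
  by have [] := H m; rewrite ?m1.
Qed.

End Bridge.

(** * Green function, [u_A] and escape probability of the walk *)

Section Potential.
Context d (T : measurableType d) (R : realType) (P : probability T R).
Context (X : nat -> {RV P >-> Z2}) (hiid : iid X).
Context (A : set Z2) (As : seq Z2) (AE : forall z, A z <-> z \in As).
Implicit Types (s : nat -> Z2) (x y z : Z2) (r : R).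
Local Notation L := (rvlaw (X 0%N)).
Local Notation off := (fun z : Z2 => z \notin As).

Lemma killedE n x y :
  killed X A n x y = (iter n (kop L off) (fun z => dirac R (z - y)) x)%:E.
Proof.
rewrite /killed /Pr; case: n => [|n].
  (* At time [0] no visit has been counted, so the value is the Kronecker delta even inside [A]. *)
  rewrite /= /dirac subr_eq0; case: eqP => [->|xy].
    rewrite (_ : [set w | _] = setT) ?probability_setT //.
    apply/seteqP; split=> // w _; split; first exact: walk0.
    by apply/sigma_gtP => -[|m].
  rewrite (_ : [set w | _] = set0) ?measure0 //.
  by apply/seteqP; split=> // w [/=]; rewrite walk0.
rewrite iterSr; have := P_stay_then hiid off (fun z => off z && (z == y)) n x.
have -> : conv L (fun z => (off z && (z == y))%:R) = kop L off (fun z => dirac R (z - y)).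
  apply/funext => z; congr (Ex L _); apply/funext => v.
  by rewrite /res /dirac subr_eq0; case: (_ \in _).
move=> <-; congr (P _); apply/seteqP; split=> w /=.
  move=> [wy /sigma_gtP H]; have offw i : (1 <= i <= n.+1)%N -> off (walk X x w i).
    by move=> /H h; apply/negP => /AE.
  split=> [i /andP[i1 ni]|]; first by apply: offw; rewrite i1 leqW.
  by rewrite wy eqxx andbT -wy; apply: offw; rewrite leqnn.
move=> [H /andP[H1 /eqP wy]]; split=> //; apply/sigma_gtP => m /andP[m1].
rewrite leq_eqVlt => /predU1P[->|mn]; first by move=> /AE; rewrite (negbTE H1).
by move=> /AE; apply/negP/H; rewrite m1.
Qed.

Lemma greenE (g : R) x y :
  (fun n => \sum_(k < n) iter k (kop L off) (fun z => dirac R (z - y)) x) @ \oo --> g ->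
  green X A x y = g%:E.
Proof.
move=> gc; rewrite /green (_ : (fun n => _) = EFin \o
  (fun n => \sum_(k < n) iter k (kop L off) (fun z => dirac R (z - y)) x)).
  by apply: cvg_lim => //; apply: cvg_EFin gc; exact: nearW.
apply/funext => n; rewrite /= big_mkord -sumEFin.
by apply: eq_bigr => k _; exact: killedE.
Qed.

Global Instance at_infinity_proper : ProperFilter (at_infinity R).
Proof.
apply: filter_from_proper => [|r _].
  apply: filter_fromT_filter; first by exists 0.
  move=> i j; exists (Num.max i j) => y /=; rewrite gt_max => /andP[]; by split.
have [n rn] := nat_gt `|r|; exists (n%:Z, 0); apply: le_lt_trans (ler_norm r) _.
apply: lt_le_trans rn _.
rewrite -(ler_pXn2r (n:=2)) ?nnegrE ?enorm_ge0 // enorm_sqr /ns /= expr0n addr0.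
exact: lexx.
Qed.

Lemma uAE (G u : Z2 -> R) x : (forall y, green X A x y = (G y)%:E) ->
  vanish (fun y => G y - u x) -> uA X A x = (u x)%:E.
Proof.
move=> HG Hv; apply: cvg_lim => //.
have -> : green X A x = EFin \o G by apply/funext => y; rewrite HG.
apply: cvg_EFin; first exact: nearW.
apply/cvgrPdist_le => e e0; have [M HM] := Hv e e0.
exists M%:R => // y /= My; rewrite distrC; apply: HM.
rewrite -(ler_nat R); apply: ns_le_nrm1 => //.
by rewrite -enorm_sqr ler_pXn2r ?nnegrE ?enorm_ge0 // ltW.
Qed.

(** The event is a disjoint union over the exit time, and its measure is the series that defines
    [esc]. *)
Lemma escE r x : Ig L (nsq R) -> 0 < r -> A `<=` disc r ->
  Pr X x [set s | (tau R (disc r) s < sigma R A s)%E] = (esc L off r x)%:E.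
Proof.
move=> IL r0 Ar.
have Ilg : Ig L (lg R).
  apply: (Ig_le IL) => v; rewrite ger0_norm ?lg_ge0 //.
  apply: le_trans (nrm1_le_sq R v); exact: lg_le_nrm1.
pose F n := stay_then X (stay off r) (fun z => ~~ inU r z) n x.
have PF n : P (F n) = (iter n (kop L (stay off r)) (jump L r) x)%:E.
  exact: P_stay_then.
have stayP z : stay off r z <-> ~ A z /\ disc r z.
  split=> [/andP[zA zr]|[zA zr]]; first by split; [move=> /AE; apply/negP|apply/disc_inU].
  by apply/andP; split; [apply/negP => /AE|apply/disc_inU].
have -> : Pr X x [set s | (tau R (disc r) s < sigma R A s)%E] = P (\bigcup_n F n).
  congr (P _); apply/seteqP; split=> w /=.
    move=> /(tau_lt_sigmaP R _ Ar) [n [H Hn]]; exists n => //; split=> [i /H/stayP //|].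
    by apply/negP => /(disc_inU _ r0).
  move=> [n _ [H Hn]]; apply/(tau_lt_sigmaP R _ Ar); exists n; split=> [i /H/stayP //|].
  by move/(disc_inU _ r0); apply/negP.
rewrite measure_semi_bigcup.
- rewrite (_ : (fun n => _) = EFin \o (escn L off r)^~ x).
    by apply: cvg_lim => //; apply: cvg_EFin (@esc_cvg _ _ IL off r x); exact: nearW.
  apply/funext => n; rewrite /= big_mkord /escn (psumE Ilg _ _ _ (jump_bnd L r)) -sumEFin.
  by apply: eq_bigr => k _; exact: PF.
- by move=> n; exact: measurable_stay_then.
- move=> m n _ _ [w [[Hm m1] [Hn n1]]]; case: (ltngtP m n) => // mn.
    by have /andP[_] := Hn m.+1 mn; rewrite (negbTE m1).
  by have /andP[_] := Hm n.+1 mn; rewrite (negbTE n1).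
- by apply: bigcupT_measurable => n; exact: measurable_stay_then.
Qed.

End Potential.

Theorem proposition1 (d : measure_display) (T : measurableType d)
    (R : realType) (P : probability T R) (X : nat -> {RV P >-> Z2})
    (hiid : iid X) (hirr : irreducible X)
    (hmean : centered X) (hvar : finite_variance X)
    (A : set Z2) (hA0 : A !=set0) (hAfin : finite_set A)
    (hA : forall x y : Z2, ~ A x -> ~ A y ->
      exists2 n : nat, (1 <= n)%N & (0 < killed X A n x y)%E) :
  exists err : R -> Z2 -> R,
    [/\ (\forall r \near +oo, forall x : Z2, disc r x ->
           Pr X x [set s | (tau R (disc r) s < sigma R A s)%E] =
           ((kappa X)%:E * uA X A x * ((ln r)^-1)%:E * (1 + err r x)%:E)%E),
        (forall eps : R, 0 < eps ->
           \forall r \near +oo, forall x : Z2, disc r x -> `|err r x| <= eps)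
      & (finite_log_variance X ->
           exists C : R,
             \forall r \near +oo, forall x : Z2, disc r x ->
               `|err r x| <= C / ln r)].
Proof.
have [As [uAs AE]] : exists As : seq Z2, uniq As /\ forall z, A z <-> z \in As.
  have /finite_seqP[s ->] := hAfin; exists (undup s); rewrite undup_uniq; split=> // z.
  by rewrite mem_undup.
have [xi0 /AE xiA] := hA0.
have IL := finite_variance_Ig hvar; have [mean1 mean2] := centered_mean hmean.
have irrL := irreducible_irr hiid hirr.
have [u [G [err [HG Hv [r1 H1] H2 H3]]]] := escape_expansion IL irrL mean1 mean2 uAs xiA.
have near_disc (Q : R -> Z2 -> Prop) r0 : (forall r, r0 <= r -> forall x, inU r x -> Q r x) ->
    \forall r \near +oo, forall x : Z2, disc r x -> Q r x.
  move=> HQ; exists (`|r0| + 1); split; first by rewrite num_real.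
  move=> r rr x dx; have h := ler_norm r0; have h' := normr_ge0 r0.
  by apply: HQ; [lra|apply/disc_inU => //; lra].
have uE x : uA X A x = (u x)%:E.
  apply: (@uAE _ _ _ _ X A (G x) u x) (Hv x) => y.
  by apply: (greenE hiid AE); exact: HG.
(* The radius [1 + sum |y|^2] exceeds every norm in [A], as [|y|^2 < (1 + |y|^2)^2]. *)
have Adisc : exists r0 : R, forall r : R, r0 <= r -> A `<=` disc r.
  exists (1 + \sum_(y <- As) ns R y) => r rr z /AE zA.
  have S0 : 0 <= \sum_(y <- rem z As) ns R y by apply: sumr_ge0 => y _; exact: ns_ge0.
  move: rr; rewrite (perm_big _ (perm_to_rem zA)) big_cons /= => rr.
  have n0 := ns_ge0 R z; apply/disc_inU; first lra.
  rewrite /inU; nra.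
have [r2 HA] := Adisc.
exists err; split.
- apply: (near_disc _ (`|r1| + `|r2| + 1)) => r rr x xU.
  have a1 := ler_norm r1; have a2 := ler_norm r2.
  have b1 := normr_ge0 r1; have b2 := normr_ge0 r2.
  rewrite (escE hiid AE x IL) ?uE; [|lra|apply: HA; lra].
  have r1r : r1 <= r by lra.
  by rewrite (H1 r r1r x xU) (kappaE hmean) !EFinM.
- by move=> eps /H2 [r0 H]; exact: near_disc H.
- move=> /(finite_log_variance_Ig hvar) /H3 [C [r0 H]].
  by exists C; exact: (near_disc (fun r x => `|err r x| <= C / ln r) r0 H).
Qed.
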